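(* Let $q>2$ be an integer and $\Sigma_q=\{\theta^1,\dots,\theta^q\}^{\mathbb{N}}$. For $1\le k\le q$ and $b\in\mathbb{R}$, let $\widetilde{\mu}^k_b$ be the dynamical Gibbs measure for the potential $b\,\mathbf{1}_{[\theta^k]}$. Let $\beta_c=\frac{2(q-1)\log(q-1)}{q-2}$. For $0<\beta<\beta_c$ set $s_\beta=0$, and for $\beta\ge\beta_c$ let $s_\beta$ be the largest solution of the equation $$s=\frac{e^{\beta s}-1}{e^{\beta s}+q-1}.$$ Then, as $n\to+\infty$, the probabilistic Gibbs measures $\mu_{n,\beta}$ of the Curie-Weiss-Potts model converge weakly: $$\mu_{n,\beta}\xrightarrow[n\to+\infty]{w}\begin{cases}\rho^{\otimes\mathbb{N}} & \text{if } 0<\beta<\beta_c,\\[6pt] \dfrac1q\displaystyle\sum_{k=1}^q\widetilde{\mu}^k_{\beta s_\beta} & \text{if } \beta>\beta_c,\\[10pt] \dfrac{A\,\widetilde{\mu}^1_0+B\sum_{k=1}^q\widetilde{\mu}^k_{\beta_c s_{\beta_c}}}{A+qB} & \text{if } \beta=\beta_c,\end{cases}$$ with $A=\left(1-\frac{\beta_c}{q(q-1)}\right)^{\frac{q-2}{2}}$ and $B=\left(1-\frac{\beta_c}{q}\right)^{\frac{q-2}{2}}$.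
   Context: Setting: $\Lambda=\{\theta^1,\dots,\theta^q\}$ is an alphabet of $q$ distinct letters and $\Sigma_q=\Lambda^{\mathbb{N}}$ is the set of infinite sequences $x=x_0x_1x_2\ldots$ with letters in $\Lambda$, with the metric $d(x,y)=2^{-\min\{n:\ x_n\ne y_n\}}$ (for $x\neq y$) and the shift $\sigma(x_0x_1\ldots)=x_1x_2\ldots$. The cylinder $[\theta^k]$ is $\{x: x_0=\theta^k\}$. Dynamical Gibbs measure: for a Lipschitz function $\phi:\Sigma_q\to\mathbb{R}$, the pressure is $\mathcal{P}(\phi)=\sup_\mu\{h_\mu+\int\phi\,d\mu\}$, the supremum being over $\sigma$-invariant Borel probability measures $\mu$, where $h_\mu$ is the Kolmogorov-Sinai entropy. There is a unique measure attaining the supremum (the equilibrium state), and it is called the dynamical Gibbs measure for $\phi$. Curie-Weiss-Potts model: for a word or sequence $\omega$, $H_n(\omega)=-\frac{1}{2n}\sum_{i,j=0}^{n-1}\mathbf{1}_{\omega_j=\omega_i}=-\frac{1}{2n}\|L_n(\omega)\|^2$, where $L_n(\omega)=(L_{n,1}(\omega),\dots,L_{n,q}(\omega))$, $L_{n,k}(\omega)=\sum_{i=0}^{n-1}\mathbf{1}_{\omega_i=\theta^k}$, and $\|\cdot\|$ is the Euclidean norm on $\mathbb{R}^q$. Let $\rho=\frac1q\sum_{k=1}^q\delta_{\theta^k}$ and $\mathbb{P}=\rho^{\otimes\mathbb{N}}$. The probabilistic Gibbs measure on $\Sigma_q$ is $$\mu_{n,\beta}(d\omega)=\frac{e^{-\beta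 H_n(\omega)}}{Z_{n,\beta}}\,\mathbb{P}(d\omega),\qquad Z_{n,\beta}=\frac1{q^n}\sum_{\omega'\in\Lambda^n}e^{\frac{\beta}{2n}\|L_n(\omega')\|^2}.$$ Weak convergence $P_n\xrightarrow{w}P$ means $\int f\,dP_n\to\int f\,dP$ for every bounded continuous real function $f$. *)

(* Defs.v *)
From HB Require Import structures.
From mathcomp Require Import all_boot all_order all_algebra.
From mathcomp Require Import all_classical all_reals all_analysis.
From mathcomp Require Import measurable_realfun.

Set Implicit Arguments.
Unset Strict Implicit.
Unset Printing Implicit Defensive.

Import Order.TTheory GRing.Theory Num.Theory.
Import numFieldNormedType.Exports.

Local Open Scope classical_set_scope.
Local Open Scope ring_scope.

(** The alphabet with [q = p.+1] letters is ['I_p.+1]; the letter written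
    theta^k (1 <= k <= q) in the usual notation is the ordinal [k - 1]. The
    successor form makes the alphabet inhabited, as required by
    [measurableType]. *)

HB.instance Definition _ (p : nat) := isPointed.Build 'I_p.+1 ord0.
HB.instance Definition _ (p : nat) :=
  @isMeasurable.Build default_measure_display 'I_p.+1 discrete_measurable
    discrete_measurable0 discrete_measurableC discrete_measurableU.

(** The field [R] is a parameter of the type because the distance is
    [R]-valued. *)
Definition Sigma (R : realType) (p : nat) : Type := nat -> 'I_p.+1.

HB.instance Definition _ (R : realType) (p : nat) :=
  Pointed.copy (Sigma R p) (nat -> 'I_p.+1).

Section distance.
Context {R : realType} {p : nat}.
Implicit Types x y z : Sigma R p.

Definition sdist x y : R :=
  if pselect (exists n, x n != y n) is left h then 2 ^- ex_minn h else 0.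

Lemma sdist_ge x y n : x n != y n -> 2 ^- n <= sdist x y.
Proof.
move=> xyn; rewrite /sdist; case: pselect => [h|]; last by case; exists n.
case: ex_minnP => m _ /(_ n xyn) mn.
by rewrite lef_pV2 ?posrE ?exprn_gt0// ler_eXn2l// ltr1n.
Qed.

Lemma sdist_lt x y n : sdist x y < 2 ^- n -> x n = y n.
Proof.
move=> xyn; apply/eqP; apply: contraT => /sdist_ge.
by rewrite leNgt xyn.
Qed.

Lemma sdistxx x : sdist x x = 0.
Proof.
rewrite /sdist; case: pselect => // h.
by case: ex_minnP => n; rewrite eqxx.
Qed.

Lemma sdist_eq0 x y : sdist x y = 0 -> x = y.
Proof.
move=> xy0; apply/funext => n; apply: sdist_lt.
by rewrite xy0 invr_gt0 exprn_gt0.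
Qed.

Lemma sdist_sym x y : sdist x y = sdist y x.
Proof.
rewrite /sdist; case: pselect => [h|h]; case: pselect => [k|k] //.
- congr (_ ^- _); apply/eqP; rewrite eqn_leq.
  case: ex_minnP => m xm hm; case: ex_minnP => l xl hl.
  by rewrite hm 1?eq_sym// hl// eq_sym.
- by exfalso; apply: k; case: h => n hn; exists n; rewrite eq_sym.
- by exfalso; apply: h; case: k => n hn; exists n; rewrite eq_sym.
Qed.

Lemma sdist_ge0 x y : 0 <= sdist x y.
Proof.
by rewrite /sdist; case: pselect => // h; rewrite invr_ge0 exprn_ge0.
Qed.

Lemma sdist_triangle y x z : sdist x z <= sdist x y + sdist y z.
Proof.
rewrite {1}/sdist; case: pselect => [h|_]; last by rewrite addr_ge0 ?sdist_ge0.
case: ex_minnP => m xzm _.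
have [xym|/sdist_ge xym] := eqVneq (x m) (y m).
  by rewrite -[leLHS]add0r lerD ?sdist_ge0// sdist_ge// -xym.
by rewrite -[leLHS]addr0 lerD ?sdist_ge0.
Qed.

End distance.

HB.instance Definition _ (R : realType) (p : nat) :=
  @isMetric.Build R (Sigma R p) sdist sdistxx sdist_eq0 sdist_sym
    sdist_triangle.

(** The Borel sigma-algebra of the metric topology. *)
HB.instance Definition _ (R : realType) (p : nat) :=
  Measurable.copy (Sigma R p) (g_sigma_algebraType (@open (Sigma R p))).

Definition left_shift {R : realType} {p : nat} (x : Sigma R p) : Sigma R p :=
  fun n => x n.+1.

Definition cylinder {R : realType} {p : nat} (k : 'I_p.+1) : set (Sigma R p) :=
  [set x | x 0 = k].

(** Convergence of the integrals of all bounded continuous real functions. *)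
Definition weak_cvg {R : realType} {p : nat}
    (mu_ : nat -> {measure set (Sigma R p) -> \bar R})
    (mu : {measure set (Sigma R p) -> \bar R}) : Prop :=
  forall f : Sigma R p -> R, continuous f -> bounded_fun f ->
    (fun n => \int[mu_ n]_x (f x)%:E)%E @ \oo --> (\int[mu]_x (f x)%:E)%E.

Section entropy.
Context {R : realType} d {T : measurableType d}.
Variables (mu : probability T R) (S : T -> T).

(** The convention [0 * log 0 = 0] holds since [ln 0 = 0]. *)
Definition partition_entropy (I : finType) (xi : I -> set T) : R :=
  - \sum_(i : I) fine (mu (xi i)) * ln (fine (mu (xi i))).

(** The atoms of the join of [xi], [S^-1 xi], ..., [S^-(n-1) xi], indexed by
    the words of length [n]; atoms may be empty, which does not affect the
    entropy. *)
Definition dynamical_join (I : finType) (xi : I -> set T) (n : nat)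
    (w : {ffun 'I_n -> I}) : set T :=
  \bigcap_(i in [set: 'I_n]) (iter i S @^-1` xi (w i)).

Definition entropy_rate (I : finType) (xi : I -> set T) : R :=
  limn (fun n => n%:R^-1 * partition_entropy (dynamical_join xi (n := n))).

Definition KS_entropy : \bar R :=
  ereal_sup [set h | exists (m : nat) (xi : 'I_m -> set T),
    [/\ forall i, measurable (xi i),
        classical_sets.partition [set: 'I_m] xi [set: T] &
        h = (entropy_rate xi)%:E]].

Definition invariant_measure : Prop :=
  forall A, measurable A -> mu (S @^-1` A) = mu A.

End entropy.

Section dynamical_gibbs.
Context {R : realType} {p : nat}.
Implicit Types (phi : Sigma R p -> R) (mu : probability (Sigma R p) R).

Definition free_energy phi mu : \bar R :=
  (KS_entropy mu left_shift + \int[mu]_x (phi x)%:E)%E.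

Definition pressure phi : \bar R :=
  ereal_sup [set free_energy phi mu |
             mu in [set mu | invariant_measure mu left_shift]].

Definition equilibrium_state phi mu : Prop :=
  invariant_measure mu left_shift /\ free_energy phi mu = pressure phi.

(** For Lipschitz [phi] the equilibrium state exists and is unique as a Borel
    measure. Elements of [probability] are defined on all subsets and are only
    constrained on the measurable ones, whence the choice of a representative;
    integrals do not depend on it. *)
Definition dynamical_gibbs phi : probability (Sigma R p) R :=
  get (equilibrium_state phi).

Definition letter_potential (k : 'I_p.+1) (b : R) : Sigma R p -> R :=
  fun x => b * \1_(cylinder k) x.

End dynamical_gibbs.

(** [sum_(k < p.+1) m k] as a measure; [msum] is indexed by natural numbers,
    and [inord] reads [k < p.+1] as a letter. *)
Definition letter_sum {R : realType} {p : nat} d {T : measurableType d}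
    (m : 'I_p.+1 -> {measure set T -> \bar R}) : {measure set T -> \bar R} :=
  msum (fun k : nat => m (inord k)) p.+1.

Section curie_weiss_potts.
Context {R : realType} {p : nat}.
Local Notation q := p.+1.

Definition rho : {measure set 'I_p.+1 -> \bar R} :=
  mscale (q%:R^-1)%:nng (letter_sum (fun k : 'I_p.+1 => \d_k)).

(** [P] is the product of countably many copies of [nu]. *)
Definition is_product_measure (nu : {measure set 'I_p.+1 -> \bar R})
    (P : probability (Sigma R p) R) : Prop :=
  forall (n : nat) (A : 'I_n -> set 'I_p.+1),
    P [set x | forall i : 'I_n, A i (x i)] = (\prod_(i < n) nu (A i))%E.

Definition product_measure (nu : {measure set 'I_p.+1 -> \bar R}) :
    probability (Sigma R p) R :=
  get (is_product_measure nu).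

Definition initial_word (x : Sigma R p) (n : nat) : {ffun 'I_n -> 'I_p.+1} :=
  [ffun i : 'I_n => x i].

Definition occ (n : nat) (w : {ffun 'I_n -> 'I_p.+1}) (k : 'I_p.+1) : R :=
  \sum_(i < n) (w i == k)%:R.

Definition hamiltonian (n : nat) (w : {ffun 'I_n -> 'I_p.+1}) : R :=
  - ((2 * n%:R)^-1 * \sum_(i < n) \sum_(j < n) (w j == w i)%:R).

(** The sum over [k] is the squared Euclidean norm of the occupation vector. *)
Definition partition_function (n : nat) (beta : R) : R :=
  (q%:R ^+ n)^-1 * \sum_(w : {ffun 'I_n -> 'I_p.+1})
    expR (beta / (2 * n%:R) * \sum_(k : 'I_p.+1) occ w k ^+ 2).

Definition gibbs_density (n : nat) (beta : R) (x : Sigma R p) : R :=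
  expR (- beta * hamiltonian (initial_word x n)) / partition_function n beta.

(** The measure with density [gibbs_density] with respect to the product of
    the uniform law; in the (meaningless) case [n = 0] the convention
    [0^-1 = 0] makes the density 1. *)
Definition prob_gibbs (n : nat) (beta : R) (A : set (Sigma R p)) : \bar R :=
  (\int[product_measure rho]_(x in A) (gibbs_density n beta x)%:E)%E.

Lemma gibbs_density_ge0 n beta x : 0 <= gibbs_density n beta x.
Proof.
apply: divr_ge0; first exact: expR_ge0.
apply: mulr_ge0; first by rewrite invr_ge0 exprn_ge0.
by apply: sumr_ge0 => w _; exact: expR_ge0.
Qed.

Lemma measurable_initial_word (n : nat) (g : {ffun 'I_n -> 'I_p.+1} -> R) :
  measurable_fun [set: Sigma R p] (fun x => g (initial_word x n)).
Proof.
move=> _ Y _; rewrite setTI; apply: sub_sigma_algebra => /=.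
rewrite openE => x /= Yx; rewrite /interior.
rewrite -nbhs_ballE; exists (2 ^- n) => /=; first by rewrite invr_gt0 exprn_gt0.
move=> y; rewrite ballEmdist /= => xy.
suff -> : initial_word y n = initial_word x n by [].
apply/ffunP => i; rewrite !ffunE; apply/esym/sdist_lt.
apply: (lt_le_trans xy); rewrite lef_pV2 ?posrE ?exprn_gt0//.
by rewrite ler_eXn2l ?ltr1n// ltnW.
Qed.

Lemma measurable_gibbs_density n beta :
  measurable_fun [set: Sigma R p] (EFin \o gibbs_density n beta).
Proof.
apply/measurable_EFinP.
exact: (@measurable_initial_word n
  (fun w => expR (- beta * hamiltonian w) / partition_function n beta)).
Qed.

Section prob_gibbs_measure.
Variables (n : nat) (beta : R).

Let prob_gibbs0 : prob_gibbs n beta set0 = 0%E.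
Proof. by rewrite /prob_gibbs integral_set0. Qed.

Let prob_gibbs_ge0 A : (0 <= prob_gibbs n beta A)%E.
Proof.
by apply: integral_ge0 => x _; rewrite lee_fin gibbs_density_ge0.
Qed.

Let prob_gibbs_sigma_additive : semi_sigma_additive (prob_gibbs n beta).
Proof.
move=> F mF tF mUF; rewrite /prob_gibbs ge0_integral_bigcup//.
- apply: is_cvg_ereal_nneg_natsum_cond => k _ _.
  exact: prob_gibbs_ge0.
- exact: measurable_funTS (measurable_gibbs_density n beta).
- by move=> x _; rewrite lee_fin gibbs_density_ge0.
Qed.

HB.instance Definition _ := isMeasure.Build _ _ _ (prob_gibbs n beta)
  prob_gibbs0 prob_gibbs_ge0 prob_gibbs_sigma_additive.

End prob_gibbs_measure.

End curie_weiss_potts.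

Section parameters.
Variables (R : realType) (q : nat).

Definition beta_c : R := 2 * (q%:R - 1) * ln (q%:R - 1) / (q%:R - 2).

Definition s_solutions (beta : R) : set R :=
  [set s | s = (expR (beta * s) - 1) / (expR (beta * s) + q%:R - 1)].

(** For [beta_c <= beta], the largest solution. *)
Definition s_ (beta : R) : R :=
  if beta < beta_c then 0
  else get (s_solutions beta `&` ubound (s_solutions beta)).

Definition weightA : {nonneg R} :=
  NngNum (powR_ge0 (1 - beta_c / (q%:R * (q%:R - 1))) ((q%:R - 2) / 2)).

Definition weightB : {nonneg R} :=
  NngNum (powR_ge0 (1 - beta_c / q%:R) ((q%:R - 2) / 2)).

End parameters.

Arguments beta_c {R} q.
Arguments s_ {R} q beta.
Arguments weightA {R} q.
Arguments weightB {R} q.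

(* Main.v *)
Require Import Defs.
From HB Require Import structures.
From mathcomp Require Import all_boot all_order all_algebra fingroup perm.
From mathcomp Require Import all_classical all_reals all_analysis.
From mathcomp Require Import measurable_realfun.
From mathcomp Require Import ring lra.

Import Order.TTheory GRing.Theory Num.Theory.
Import numFieldNormedType.Exports.

Set Implicit Arguments.
Unset Strict Implicit.
Unset Printing Implicit Defensive.

Local Open Scope classical_set_scope.
Local Open Scope ring_scope.

(** Words of length [n] are weighted by [exp (beta |L|^2 / 2n)], [L] being the
    vector of the numbers of occurrences of the letters. The weight of a word
    equals, up to a polynomial factor, the exponential of [- n G(L / n)] with
    [G x = beta |x|^2 / 2 - ln (sum_k exp (beta x_k))], so the frequencies [L / n]
    concentrate at the minimisers of [G] on the simplex. A minimiser is a fixed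
    point of the softmax map and at most one of its coordinates exceeds
    [1 / beta]; so it is the barycentre, or it has one large coordinate [a] and
    the others equal, and [s = a - (1 - a) / (q - 1)] solves the equation for
    [s_beta]. Its coordinates are the letter probabilities of the equilibrium
    state of [beta s_beta 1_[theta^k]], a Bernoulli measure: by the Gibbs
    inequality no invariant measure does better, and the Kolmogorov-Sinai
    entropy is at most [H_m / m], [H_m] the entropy of the words of length [m].
    By exchangeability the probability that a word starts with [v] differs by
    [o(1)] from the mean of the product of the frequencies of the letters of [v].
    This settles all cases up to the masses of the minimisers. Those that differ
    by a permutation of the letters have the same mass.

    At [beta_c], split according to the number [l] of occurrences of one letter.
    The weight of the words with [l] such occurrences is a factor invariant under
    [l -> n - l], which exchanges the barycentre and the spike of that letter,
    times the average [F_N(t)] over uniform words of length [N = n - l] in the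
    [r = q - 1] other letters of [exp (t V / 2)], [V] being the chi-square
    statistic of the word. Resampling one letter gives an exact Stein identity
    for [V], whence [d/dt ln F_N(t)] tends to [(r - 1) / (2 (r - t))] and [F_N(t)]
    to [(1 - t / r)^(-(r - 1) / 2)]. The ratio of the two masses is the quotient
    of the limits at [t = beta_c (q - 1) / q] and [t = beta_c / q], namely [A / B]. *)

(** * Random variables with finitely many values *)

(** Sums of weights are bounded by replacing the quadratic exponent with its tangent at [n x], which
    factorises over the letters. This avoids Stirling's formula but yields [G] ([cw_free]) rather
    than the entropy functional [cw_entropic]. The latter dominates [G] on the simplex and agrees
    with it at the minimisers, so each question goes to the functional that suits it: [G] is defined
    on all of [R^q] and allows test points off the simplex, while [cw_entropic] is affine in beta
    and explicit along spikes. At [beta_c] the barycentre and the spikes have equal free energy, so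
    subexponential factors decide the masses. The exchange of [l] and [n - l] is exact at finite [n]
    because [beta_c (P - 1) = 2 P ln P] for [P = q - 1]. Hence the two windows are compared term by
    term, with no asymptotics of binomial coefficients, and only the fluctuation factors need
    limits. Their parameter [beta_c (n - l) / n] varies with [l] and may exceed its central value,
    so these limits are uniform on an interval reaching slightly beyond it. *)

Section finite_random_variables.
Context {R : realType} d {T : measurableType d}.
Variable mu : {measure set T -> \bar R}.
Hypothesis mu1 : mu [set: T] = 1%E.

Lemma unit_mass_fin_num A : measurable A -> mu A \is a fin_num.
Proof.
move=> mA; rewrite ge0_fin_numE//; apply: (@le_lt_trans _ _ (mu setT)).
  by apply: le_measure; rewrite ?inE.
by rewrite mu1 ltry.
Qed.

Lemma unit_mass_bounded_integrable (f : T -> R) (M : R) :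
  measurable_fun setT f -> (forall x, `|f x| <= M) ->
  mu.-integrable setT (EFin \o f).
Proof.
move=> mf fM; apply: measurable_bounded_integrable => //.
  by rewrite mu1 ltry.
by exists M; split; [exact: num_real|move=> N MN x _; exact: le_trans (fM x) (ltW MN)].
Qed.

(** Measurability of all the events of [X], so that [J] needs no sigma-algebra. *)
Definition finite_valued (J : finType) (X : T -> J) :=
  forall B : pred J, measurable [set x | B (X x)].

Definition fdist (J : finType) (X : T -> J) (u : J) : R :=
  fine (mu [set x | X x == u]).

Lemma finite_valued_fiber (J : finType) (X : T -> J) :
  (forall u, measurable [set x | X x == u]) -> finite_valued X.
Proof.
move=> mX B; rewrite (_ : [set _ | _] =
    \bigcup_(u in [set` B]) [set x | X x == u]); last first.
  apply/seteqP; split=> x /=.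
    by move=> Bx; exists (X x) => /=.
  by move=> [u /= Bu /eqP ->].
by apply: fin_bigcup_measurable => [|u _]; [exact: finite_finset|exact: mX].
Qed.

Lemma finite_valued_comp (J K : finType) (X : T -> J) (f : J -> K) :
  finite_valued X -> finite_valued (fun x => f (X x)).
Proof. by move=> mX B; exact: (mX (fun u => B (f u))). Qed.

Lemma finite_valued_pair (J K : finType) (X : T -> J) (Y : T -> K) :
  finite_valued X -> finite_valued Y -> finite_valued (fun x => (X x, Y x)).
Proof.
move=> mX mY; apply: finite_valued_fiber => -[u v].
rewrite (_ : [set _ | _] = [set x | X x == u] `&` [set x | Y x == v]).
  by apply: measurableI; [exact: (mX (pred1 u))|exact: (mY (pred1 v))].
by apply/seteqP; split=> x /=; rewrite xpair_eqE => /andP.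
Qed.

Lemma fdist_ge0 (J : finType) (X : T -> J) u : 0 <= fdist X u.
Proof. by rewrite /fdist fine_ge0. Qed.

Lemma integral_fdist (J : finType) (X : T -> J) (g : J -> R) :
  finite_valued X ->
  (\int[mu]_x (g (X x))%:E)%E = (\sum_u g u * fdist X u)%:E.
Proof.
move=> mX.
have mF u : measurable [set x | X x == u] by exact: (mX (pred1 u)).
transitivity (\int[mu]_x (\sum_(u : J)
    ((g u)%:E * (\1_[set y | X y == u] x)%:E)))%E.
  apply: eq_integral => x _; rewrite (bigD1 (X x))//= big1 ?adde0.
    by rewrite indicE mem_set//= mule1.
  by move=> u ux; rewrite indicE memNset ?mule0//= => /eqP /esym /eqP; apply/negP.
have iF u : mu.-integrable setT (fun x => (\1_[set y | X y == u] x)%:E).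
  apply: (@unit_mass_bounded_integrable _ 1) => // x.
  by rewrite indicE; case: (_ \in _); rewrite ?normr1 ?normr0.
rewrite integral_sum//; last by move=> u; exact: integrableZl.
rewrite -sumEFin; apply: eq_bigr => u _.
by rewrite integralZl// integral_indic// setIT EFinM /fdist fineK ?unit_mass_fin_num.
Qed.

Lemma fdist_event (J : finType) (X : T -> J) (B : pred J) :
  finite_valued X -> fine (mu [set x | B (X x)]) = \sum_(u | B u) fdist X u.
Proof.
move=> mX; have := integral_fdist (fun u => (B u)%:R) mX.
rewrite (_ : (fun x => _) = (fun x => (\1_[set y | B (X y)] x)%:E)); last first.
  by apply/funext => x; rewrite indicE mem_setE.
rewrite integral_indic//= setIT => ->/=.
by rewrite [RHS]big_mkcond; apply: eq_bigr => u _; case: (B u); rewrite ?mul1r ?mul0r.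
Qed.

Lemma fdist_comp (J K : finType) (X : T -> J) (f : J -> K) v :
  finite_valued X -> fdist (fun x => f (X x)) v = \sum_(u | f u == v) fdist X u.
Proof. by move=> mX; exact: (fdist_event (fun u => f u == v) mX). Qed.

Lemma fdist_sum1 (J : finType) (X : T -> J) :
  finite_valued X -> \sum_u fdist X u = 1.
Proof.
move=> mX; have := fdist_event predT mX.
rewrite (_ : [set _ | _] = setT); last by apply/seteqP; split.
by rewrite mu1 /= => <-.
Qed.

Lemma fdist_expect_comp (J K : finType) (X : T -> J) (f : J -> K) (g : K -> R) :
  finite_valued X ->
  \sum_v g v * fdist (fun x => f (X x)) v = \sum_u g (f u) * fdist X u.
Proof.
move=> mX; apply: EFin_inj; rewrite -(integral_fdist g) -?(integral_fdist (g \o f))//.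
exact: finite_valued_comp.
Qed.

End finite_random_variables.

(** * The sequence space and weak convergence *)

Section symbolic_space.
Context {R : realType} {p : nat}.
Implicit Types (x y z : Sigma R p) (U : set (Sigma R p)).

Lemma initial_wordP x y n :
  initial_word x n = initial_word y n <-> forall i, (i < n)%N -> x i = y i.
Proof.
split=> [xy i ni|xy]; last by apply/ffunP => i; rewrite !ffunE xy.
by have /ffunP/(_ (Ordinal ni)) := xy; rewrite !ffunE.
Qed.

Lemma initial_word_le x y m n : (m <= n)%N ->
  initial_word x n = initial_word y n -> initial_word x m = initial_word y m.
Proof.
by move=> mn /initial_wordP xy; apply/initial_wordP => i im; exact/xy/(leq_trans im).
Qed.

Lemma sdist_lt_initial_word x y n :
  sdist x y < 2 ^- n -> initial_word x n = initial_word y n.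
Proof.
move=> xyn; apply/initial_wordP => i ni; apply: sdist_lt.
apply: (lt_le_trans xyn); rewrite lef_pV2 ?posrE ?exprn_gt0//.
by rewrite ler_eXn2l ?ltr1n// ltnW.
Qed.

Lemma initial_word_sdist x y n :
  initial_word x n = initial_word y n -> sdist x y <= 2 ^- n.
Proof.
move=> /initial_wordP xy; rewrite /sdist; case: pselect => [h|_]; last first.
  by rewrite invr_ge0 exprn_ge0.
case: ex_minnP => m xym _.
rewrite lef_pV2 ?posrE ?exprn_gt0// ler_eXn2l ?ltr1n// leqNgt.
by apply: contra xym => mn; rewrite xy.
Qed.

Lemma nbhs_initial_wordP x (A : set (Sigma R p)) : nbhs x A <->
  exists n, forall y, initial_word x n = initial_word y n -> A y.
Proof.
split=> [|[n xA]].
  rewrite -nbhs_ballE => -[e /= e0 xeA].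
  have [n ne] : exists n, 2 ^- n < e :> R.
    have /cvgrPdist_lt/(_ _ e0) : (fun n => (2^-1 : R) ^+ n) @ \oo --> (0:R).
      by apply: cvg_expr; rewrite ger0_norm ?invr_ge0// invf_lt1// ltr1n.
    move=> [n _ /(_ n (leqnn n))]; rewrite sub0r normrN.
    by rewrite ger0_norm ?exprn_ge0 ?invr_ge0// exprVn; exists n.
  exists n => y xy; apply: xeA; rewrite ballEmdist /=.
  exact: le_lt_trans (initial_word_sdist xy) ne.
rewrite -nbhs_ballE; exists (2 ^- n) => /=; first by rewrite invr_gt0 exprn_gt0.
by move=> y; rewrite ballEmdist /= => /sdist_lt_initial_word /xA.
Qed.

Lemma initial_word_finite_valued n :
  finite_valued (fun x : Sigma R p => initial_word x n).
Proof.
move=> B; have := @measurable_initial_word R p n (fun w => (B w)%:R) measurableT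
  [set 1] (measurable_set1 1).
rewrite setTI; congr measurable; apply/seteqP; split=> x /=.
  by case: (B _) => //= /eqP; rewrite eq_sym oner_eq0.
by move=> ->.
Qed.

(** The union of the cylinders of length [n] contained in [U]; an open set is the increasing union
    of these. *)
Definition word_interior n U : set (Sigma R p) :=
  [set x | forall y, initial_word x n = initial_word y n -> U y].

(** Exhibits the set as an event of the initial word, the form in which [finite_valued] gives its
    measurability. *)
Lemma word_interiorE n U : word_interior n U =
  [set x | `[<exists2 y, initial_word y n = initial_word x n &
                         word_interior n U y>]].
Proof.
apply/seteqP; split=> x /=; first by move=> xU; apply/asboolP; exists x.
by move=> /asboolP [y xy yU] z xz; apply: yU; rewrite xy.
Qed.

Lemma open_word_interior U : open U -> U = \bigcup_n word_interior n U.
Proof.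
rewrite openE => oU; apply/seteqP; split=> x; last by move=> [n _]; exact.
by move=> /oU /nbhs_initial_wordP [n xU]; exists n.
Qed.

Lemma nondecreasing_word_interior U :
  nondecreasing_seq (fun n => word_interior n U).
Proof.
move=> m n mn; apply/subsetPset => x xU y xy; apply: xU.
exact: initial_word_le mn xy.
Qed.

Lemma open_measurable_Sigma U : open U -> measurable U.
Proof. exact: sub_sigma_algebra. Qed.

Lemma continuous_measurable_Sigma (f : Sigma R p -> R) :
  continuous f -> measurable_fun setT f.
Proof.
move=> cf; apply: (measurability _ (RGenOpens.measurableE R)).
move=> _ [_ [a [b ->]] <-]; rewrite setTI; apply: open_measurable_Sigma.
by move/continuousP : cf; apply; exact: interval_open.
Qed.

(* König's lemma: if oscillations of size [e] occurred on arbitrarily long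
   cylinders, these cylinders would accumulate at a sequence [z] where [f] is
   not continuous. *)
Lemma continuous_unif_Sigma (f : Sigma R p -> R) (e : R) :
  continuous f -> 0 < e ->
  exists n, forall x y, initial_word x n = initial_word y n ->
    `|f x - f y| <= e.
Proof.
move=> cf e0; apply: contrapT => /forallNP nu.
pose bad m z := forall n, exists x y, [/\ initial_word x n = initial_word y n,
  initial_word x m = initial_word z m & e < `|f x - f y|].
pose upd z m (k : 'I_p.+1) : Sigma R p := fun i => if i == m then k else z i.
have bad0 : bad 0 (fun=> ord0).
  move=> n; have /existsNP[x /existsNP[y /not_implyP[xy /negP]]] := nu n.
  rewrite -ltNge => fxy; exists x, y; split => //.
  by apply/ffunP => -[].
have badS m z : bad m z -> exists k, bad m.+1 (upd z m k).
  move=> bz; apply: contrapT => /forallNP nk.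
  have /choice[N NP] : forall k, exists n, forall x y,
      initial_word x n = initial_word y n ->
      initial_word x m.+1 = initial_word (upd z m k) m.+1 ->
      `|f x - f y| <= e.
    move=> k; have /existsNP[n nP] := nk k; exists n => x y xy xz.
    rewrite leNgt; apply/negP => fxy; apply: nP.
    by exists x, y.
  have [x [y [xy xz fxy]]] := bz (\max_k N k).
  suff : `|f x - f y| <= e by rewrite leNgt fxy.
  apply: (NP (x m)); first exact: (initial_word_le (leq_bigmax (x m)) xy).
  apply/initial_wordP => i; rewrite ltnS leq_eqVlt /upd.
  have [->//|im /=] := eqVneq i m.
  by move=> im'; have /initial_wordP := xz; apply.
have /choice[k kP] : forall mz, exists k, bad mz.1 mz.2 -> bad mz.1.+1 (upd mz.2 mz.1 k).
  move=> [m z] /=; have [/badS[k ?]|?] := pselect (bad m z); first by exists k.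
  by exists ord0.
pose Z := fix Z m : Sigma R p :=
  if m is m'.+1 then upd (Z m') m' (k (m', Z m')) else fun=> ord0.
have badZ m : bad m (Z m).
  by elim: m => // m /(kP (m, Z m)).
pose z : Sigma R p := fun m => Z m.+1 m.
have Zz m : initial_word (Z m) m = initial_word z m.
  apply/initial_wordP; elim: m => // m IH i.
  rewrite ltnS leq_eqVlt => /orP[/eqP ->//|im].
  by rewrite -IH//= /upd ltn_eqF.
have /cvgrPdist_lt/(_ (e / 2)) := cf z; rewrite divr_gt0// => /(_ isT).
move=> /nbhs_initial_wordP[n zn].
have [x [y [xy xz]]] := badZ n n; rewrite ltNge => /negP; apply.
have xz' : initial_word z n = initial_word x n by rewrite xz Zz.
have /ltW fx := zn x xz'.
have /ltW fy := zn y (etrans xz' xy).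
rewrite (_ : f x - f y = - (f z - f x) + (f z - f y)); last by ring.
apply: (le_trans (ler_normD _ _)); rewrite normrN; apply: (le_trans (lerD fx fy)).
by rewrite -splitr.
Qed.

(** A continuous function is uniformly close to one that depends on finitely many letters, whose
    integral is a finite combination of cylinder masses. The approximation error is the same for all
    measures of mass 1, so the length of the cylinders is fixed before [n] varies. *)
Lemma weak_cvg_cylinder (mu_ : nat -> {measure set (Sigma R p) -> \bar R})
    (mu : {measure set (Sigma R p) -> \bar R}) :
  (forall n, mu_ n setT = 1%E) -> mu setT = 1%E ->
  (forall m (w : {ffun 'I_m -> 'I_p.+1}),
    fdist (mu_ n) (initial_word ^~ m) w @[n --> \oo] -->
    fdist mu (initial_word ^~ m) w) ->
  weak_cvg mu_ mu.
Proof.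
move=> mu_1 mu1 muw f cf [M [_ /(_ (M + 1)) fM]].
have {}fM x : `|f x| <= M + 1 by apply: fM => //; rewrite ltrDl.
have mf := continuous_measurable_Sigma cf.
have fin (nu : {measure set (Sigma R p) -> \bar R}) : nu setT = 1%E ->
    nu.-integrable setT (EFin \o f).
  by move=> nu1; exact: (unit_mass_bounded_integrable nu1 mf fM).
have ffin (nu : {measure set (Sigma R p) -> \bar R}) : nu setT = 1%E -> (\int[nu]_x (f x)%:E)%E \is a fin_num.
  by move=> nu1; apply: integrable_fin_num => //; exact: fin.
(* A point of each cylinder, at which [f] is sampled. *)
pose pad n (w : {ffun 'I_n -> 'I_p.+1}) : Sigma R p :=
  fun i => if insub i is Some j then w j else ord0.
have padE x n : initial_word (pad _ (initial_word x n)) n = initial_word x n.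
  by apply/initial_wordP => i ni; rewrite /pad insubT ffunE.
have approx (e : R) : 0 < e -> exists n, forall (nu : {measure set (Sigma R p) -> \bar R}), nu setT = 1%E ->
    `|fine (\int[nu]_x (f x)%:E)%E -
      \sum_w f (pad n w) * fdist nu (initial_word ^~ n) w| <= e.
  move=> e0; have [n fn] := continuous_unif_Sigma cf e0.
  exists n => nu nu1.
  pose g x := f (pad n (initial_word x n)).
  have mg : measurable_fun setT g.
    exact: (@measurable_initial_word R p n (fun w => f (pad n w))).
  have ig := unit_mass_bounded_integrable nu1 mg (fun x => fM _).
  have -> : \sum_w f (pad n w) * fdist nu (initial_word ^~ n) w =
      fine (\int[nu]_x (g x)%:E)%E.
    rewrite (integral_fdist nu1 (fun w => f (pad n w)))//.
    exact: initial_word_finite_valued.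
  rewrite -fineB ?ffin//; last exact: integrable_fin_num.
  rewrite -integralB_EFin//; last exact: fin.
  rewrite -lee_fin -fine_abse//; last first.
    by apply: integrable_fin_num => //; apply: integrableB => //; exact: fin.
  have H : (`|\int[nu]_x ((f x)%:E - (g x)%:E)| <= e%:E)%E.
    apply: le_trans (_ : (e%:E * nu setT <= e%:E)%E); last by rewrite nu1 mule1.
    apply: le_trans (le_abse_integral _ _ _) _ => //.
      exact/measurable_EFinP/measurable_funB.
    apply: integral_le_bound => //.
    - exact/measurable_EFinP/measurable_funB.
    - by rewrite lee_fin ltW.
    - by apply: aeW => x _ /=; rewrite lee_fin fn// padE.
  rewrite fineK//; last by rewrite ge0_fin_numE//; apply: le_lt_trans H _; rewrite ltry.
rewrite -(fineK (ffin _ mu1)).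
rewrite (_ : (fun n => _) = (fun n => (fine (\int[mu_ n]_x (f x)%:E))%:E)); last first.
  by apply/funext => n; rewrite fineK// ffin.
apply: cvg_EFin.
  exact: nearW.
rewrite [X in X @ _](_ : _ = fun n => fine (\int[mu_ n]_x (f x)%:E)); last by [].
apply/cvgrPdist_le => /= e e0.
have e30 : 0 < e / 3 by rewrite divr_gt0.
have [m am] := approx (e / 3) e30.
have : \sum_w f (pad m w) * fdist (mu_ n) (initial_word ^~ m) w @[n --> \oo] -->
       \sum_w f (pad m w) * fdist mu (initial_word ^~ m) w.
  apply: cvg_big => [|w _]; first exact: add_continuous.
  by apply: cvgM; [exact: cvg_cst|exact: muw].
move=> /cvgrPdist_le/(_ _ e30) cn.
near=> n; have cnn : `|\sum_w f (pad m w) * fdist mu (initial_word ^~ m) w -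
  \sum_w f (pad m w) * fdist (mu_ n) (initial_word ^~ m) w| <= e / 3.
  by near: n; exact: cn.
move: (am _ (mu_1 n)) (am _ mu1) cnn => /=; rewrite !ler_norml; lra.
Unshelve. all: by end_near.
Qed.

End symbolic_space.

(** * Bernoulli measures *)

Section bernoulli_measure.
Context {R : realType} {p : nat} (pi : 'I_p.+1 -> R).
Hypotheses (pi_gt0 : forall k, 0 < pi k) (pi_sum1 : \sum_k pi k = 1).

(** The measure is built from [[0, 1[]: numbers are expanded in digits, the digit [k] owning the
    interval of length [pi k] that starts at [cdf k]. *)
Let cdf (k : nat) : R := \sum_(j < p.+1 | (j < k)%N) pi j.

Let cdfS (k : 'I_p.+1) : cdf k.+1 = cdf k + pi k.
Proof.
rewrite /cdf (bigD1 k)//= addrC; congr (_ + _).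
by apply: eq_bigl => j; rewrite ltnS [RHS]ltn_neqAle andbC.
Qed.

Let le_cdf j k : (j <= k)%N -> cdf j <= cdf k.
Proof.
move=> jk; rewrite /cdf big_mkcond [leRHS]big_mkcond; apply: ler_sum => i _.
by case: ifPn => [ij|_]; [rewrite (leq_trans ij jk)|case: ifPn => // _; exact: ltW].
Qed.

Let cdf0 : cdf 0 = 0. Proof. by rewrite /cdf big_pred0. Qed.

Let cdf1 : cdf p.+1 = 1.
Proof. by rewrite -pi_sum1; apply: eq_bigl => j; rewrite ltn_ord. Qed.

Let cdf_uniq x (j k : 'I_p.+1) :
  cdf j <= x < cdf j + pi j -> cdf k <= x < cdf k + pi k -> j = k.
Proof.
move=> /andP[jx xj] /andP[kx xk]; apply/val_inj/eqP; rewrite eqn_leq.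
by apply/andP; split; rewrite leqNgt; apply/negP => /le_cdf; rewrite cdfS; lra.
Qed.

Let cdf_ex x : 0 <= x < 1 -> exists k : 'I_p.+1, cdf k <= x < cdf k + pi k.
Proof.
move=> /andP[x0 x1].
have ex : exists k, (k <= p.+1)%N && (x < cdf k) by exists p.+1; rewrite leqnn cdf1.
case: (ex_minnP ex) => -[|k] /andP[kp xk] mk; first by move: xk; rewrite cdf0; lra.
exists (Ordinal kp) => /=; rewrite -(cdfS (Ordinal kp)) xk andbT leNgt.
by apply/negP => xk'; have := mk k; rewrite xk' (ltnW kp) ltnn => /(_ isT).
Qed.

Let letter x : 'I_p.+1 :=
  if [pick k : 'I_p.+1 | cdf k <= x < cdf k + pi k] is Some k then k else ord0.

Let letterP x (k : 'I_p.+1) : cdf k <= x < cdf k + pi k -> letter x = k.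
Proof.
rewrite /letter; case: pickP => [j jx kx|/(_ k) -> //].
exact: cdf_uniq jx kx.
Qed.

Let letter_itv x : 0 <= x < 1 -> cdf (letter x) <= x < cdf (letter x) + pi (letter x).
Proof. by move=> /cdf_ex[k kx]; rewrite (letterP kx). Qed.

(** Maps the interval of the first digit affinely onto [[0, 1[]; its iterates produce the next
    digits, as [x -> q x mod 1] does for equal weights. *)
Let expand x : R := (x - cdf (letter x)) / pi (letter x).

Let expand_itv x : 0 <= x < 1 -> 0 <= expand x < 1.
Proof.
move=> /letter_itv; rewrite /expand ler_pdivlMr// ltr_pdivrMr//.
by rewrite mul0r mul1r; lra.
Qed.

Let digits x : Sigma R p := fun n => letter (iter n expand x).

(** The numbers whose digits start with [s] form the interval of length [len s] that starts at
    [left_end s]. *)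
Let left_end (s : seq 'I_p.+1) : R := foldr (fun (k : 'I_p.+1) (a : R) => cdf k + pi k * a) 0 s.

Let len (s : seq 'I_p.+1) : R := \prod_(k <- s) pi k.

Let len_gt0 s : 0 < len s.
Proof. by apply: prodr_gt0. Qed.

Let left_end_itv s : 0 <= left_end s /\ left_end s + len s <= 1.
Proof.
elim: s => [|k s [s0 s1]]; first by rewrite /len big_nil /=; lra.
rewrite /= /len big_cons -/(len s); split.
  by rewrite addr_ge0 ?mulr_ge0 ?(ltW (pi_gt0 _))// -cdf0 le_cdf.
rewrite -addrA -mulrDr -cdf1; apply: le_trans (le_cdf (ltn_ord k)).
by rewrite cdfS lerD2l ger_pMr.
Qed.

Let digitsP s x : 0 <= x < 1 ->
  ([seq digits x i | i <- iota 0 (size s)] == s) =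
  (left_end s <= x < left_end s + len s).
Proof.
elim: s x => [|k s IH] x x01; first by rewrite /= /len big_nil add0r x01 eqxx.
rewrite [size _]/= [iota _ _]/= map_cons eqseq_cons (iotaDl 1) -map_comp.
rewrite (eq_map (_ : _ =1 digits (expand x))); last first.
  by move=> i; rewrite /digits /= -iterS iterSr.
rewrite IH ?expand_itv// /= /len big_cons -/(len s).
have [s0 s1] := left_end_itv s; have l0 := len_gt0 s.
have [xk|xk] := eqVneq (digits x 0) k => /=.
  have := letter_itv x01; rewrite -/(digits x 0) xk => kx.
  rewrite /expand -/(digits x 0) xk.
  rewrite ler_pdivlMr// ltr_pdivrMr//.
  have := pi_gt0 k => pk.
  by congr andb; apply/idP/idP; lra.
apply/esym/negP => /andP[kx xk']; move/eqP : xk; apply; apply: letterP.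
have pk := pi_gt0 k.
have h1 : 0 <= pi k * left_end s by rewrite mulr_ge0// ltW.
have h2 : pi k * (left_end s + len s) <= pi k by rewrite ger_pMr.
by rewrite /=; apply/andP; split; lra.
Qed.

(** Makes the expansion total; the value outside [[0, 1[] is arbitrary, as the uniform law has no
    mass there. *)
Let clamp (x : R) : R := if 0 <= x < 1 then x else 0.

Let clamp_itv x : 0 <= clamp x < 1.
Proof. by rewrite /clamp; case: ifPn => // _; rewrite lexx ltr01. Qed.

Let wordseq n (w : {ffun 'I_n -> 'I_p.+1}) : seq 'I_p.+1 := [seq w i | i <- enum 'I_n].

Let size_wordseq n (w : {ffun 'I_n -> 'I_p.+1}) : size (wordseq w) = n.
Proof. by rewrite size_map size_enum_ord. Qed.

Let initial_word_seq n (w : {ffun 'I_n -> 'I_p.+1}) (x : Sigma R p) :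
  (initial_word x n == w) = ([seq x i | i <- iota 0 (size (wordseq w))] == wordseq w).
Proof.
rewrite size_wordseq -val_enum_ord -map_comp; apply/eqP/eqP => [<-|/eq_in_map xw].
  by apply: eq_map => i; rewrite ffunE.
by apply/ffunP => i; rewrite ffunE; apply: xw; rewrite mem_enum.
Qed.

Let len_wordseq n (w : {ffun 'I_n -> 'I_p.+1}) : len (wordseq w) = \prod_i pi (w i).
Proof. by rewrite /len big_map big_enum. Qed.

Lemma sum_prod_words n :
  \sum_(w : {ffun 'I_n -> 'I_p.+1}) \prod_i pi (w i) = 1.
Proof.
rewrite -(bigA_distr_bigA (fun (i : 'I_n) k => pi k)).
by rewrite big1 // => i _.
Qed.

Let X (x : R) : Sigma R p := digits (clamp x).

Let measurable_word n (w : {ffun 'I_n -> 'I_p.+1}) :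
  measurable [set x | initial_word (X x) n == w].
Proof.
rewrite (_ : [set _ | _] = clamp @^-1`
    [set` `[left_end (wordseq w), left_end (wordseq w) + len (wordseq w)[]); last first.
  by apply/seteqP; split=> x /=; rewrite in_itv/= initial_word_seq digitsP ?clamp_itv.
rewrite -[_ @^-1` _]setTI.
suff : measurable_fun setT clamp by apply => //; exact: measurable_itv.
apply: measurable_fun_ifT => //.
apply: measurable_and; last exact: measurable_fun_ltr.
exact: measurable_fun_ler.
Qed.

Let measurable_X : measurable_fun setT X.
Proof.
apply: (@measurability _ _ _ (Sigma R p) setT X (@open (Sigma R p))) => //.
move=> _ [U oU <-]; rewrite setTI (open_word_interior oU) preimage_bigcup.
apply: bigcupT_measurable => n.
rewrite word_interiorE.
apply: (finite_valued_fiber (fun w => @measurable_word n w)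
  (fun w => `[<exists2 y, initial_word y n = w & word_interior n U y>])).
Qed.

(** The law of the digits of a uniform random number. Only lower bounds for the cylinder masses are
    computed; they are equalities because both sides sum to 1 over the words of length [n]. *)
Lemma bernoulli_exists : exists P : probability (Sigma R p) R,
  forall n (w : {ffun 'I_n -> 'I_p.+1}), fdist P (initial_word ^~ n) w = \prod_i pi (w i).
Proof.
pose U := uniform_prob (@ltr01 R).
pose P : probability (Sigma R p) R :=
  distribution U (mfun_Sub (aT := measurableTypeR R) (mem_set measurable_X)).
exists P.
have P1 : P setT = 1%E by exact: probability_setT.
have ge n (w : {ffun 'I_n -> 'I_p.+1}) : \prod_i pi (w i) <= fdist P (initial_word ^~ n) w.
  rewrite -len_wordseq; set s := wordseq w.
  have [s0 s1] := left_end_itv s; have l0 := len_gt0 s.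
  pose I := [set` `[left_end s, left_end s + len s[] : set R.
  have mI : measurable I by exact: measurable_itv.
  have IE : I `<=` [set x | initial_word (X x) n == w].
    move=> x; rewrite /I /= in_itv /= => xI; rewrite initial_word_seq.
    have x01 : 0 <= x < 1 by move: xI => /andP[]; lra.
    by rewrite /X /clamp x01 digitsP.
  have UI : U I = (len s)%:E.
    rewrite /U /uniform_prob (eq_integral (cst 1%E)); last first.
      move=> x; rewrite inE /I /= in_itv /= /uniform_pdf => /andP[sx xs].
      by rewrite ifT ?subr0 ?invr1//; lra.
    rewrite integral_cst// mul1e /= lebesgue_measure_itv/= lte_fin ltrDl l0.
    by rewrite -EFinB addrAC subrr add0r.
  rewrite -lee_fin -UI /fdist fineK; last first.
    exact: unit_mass_fin_num (initial_word_finite_valued (pred1 w)).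
  rewrite /P /distribution /pushforward mfun_valP; apply: le_measure => //; rewrite ?inE//.
  exact: measurable_word.
move=> n w; apply/eqP; rewrite eq_le ge andbT.
have e1 := fdist_sum1 P1 (@initial_word_finite_valued R p n).
have e2 := sum_prod_words n.
rewrite (bigD1 w)//= in e1; rewrite (bigD1 w)//= in e2.
have : \sum_(v | v != w) \prod_i pi (v i) <=
       \sum_(v | v != w) fdist P (initial_word ^~ n) v.
  by apply: ler_sum.
by move: e1 e2; lra.
Qed.

End bernoulli_measure.

Section uniform_product.
Context {R : realType} {p : nat}.

Lemma rho_setE (A : set 'I_p.+1) :
  @rho R p A = (\sum_(k | k \in A) p.+1%:R^-1)%:E.
Proof.
transitivity ((p.+1%:R^-1)%:E *
    \sum_(k < p.+1) (\d_(inord k : 'I_p.+1) A : \bar R))%E; first by [].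
rewrite (eq_bigr (fun k : 'I_p.+1 => (k \in A)%:R%:E)); last first.
  by move=> k _; rewrite inord_val diracE.
rewrite sumEFin -EFinM mulr_sumr [in RHS]big_mkcond; congr (_%:E).
by apply: eq_bigr => k _; case: (_ \in _); rewrite ?mulr1 ?mulr0.
Qed.

Lemma fdist_product_rho n w :
  fdist (product_measure (@rho R p)) (initial_word ^~ n) w = p.+1%:R ^- n.
Proof.
have q0 : 0 < p.+1%:R^-1 :> R by rewrite invr_gt0.
have q1 : \sum_(k < p.+1) p.+1%:R^-1 = 1 :> R.
  by rewrite sumr_const card_ord -[LHS]mulr_natr mulVf// pnatr_eq0.
have [P PE] := bernoulli_exists (fun=> q0) q1.
(* [product_measure] is a choice among the measures with the product property, so one of them must
   be exhibited: the Bernoulli measure with equal weights. *)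
have : is_product_measure rho (product_measure (@rho R p)).
  apply: (getPex (P := is_product_measure rho)); exists P => m A.
  have P1 : P setT = 1%E by exact: probability_setT.
  have SE : [set x : Sigma R p | forall i : 'I_m, A i (x i)] =
      [set x : Sigma R p | [forall i : 'I_m, initial_word x m i \in A i]].
    apply/seteqP; split=> x /=.
      by move=> xA; apply/forallP => i; rewrite ffunE inE.
    by move=> /forallP xA i; have := xA i; rewrite ffunE inE.
  apply: etrans (congr1 P SE) _.
  have mw := @initial_word_finite_valued R p m.
  pose B (w : {ffun 'I_m -> 'I_p.+1}) := [forall i : 'I_m, w i \in A i].
  rewrite -[LHS]fineK ?(unit_mass_fin_num P1 (mw B))// (fdist_event P1 B mw).
  under eq_bigr do rewrite PE.
  under [in RHS]eq_bigr do rewrite rho_setE.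
  rewrite prodEFin bigA_distr_big_dep; congr (_%:E).
move=> /(_ n (fun i => [set w i])); rewrite /fdist => e.
have -> : [set x : Sigma R p | initial_word x n == w] =
    [set x : Sigma R p | forall i : 'I_n, [set w i] (x i)].
  apply/seteqP; split=> x /= => [/eqP <- i|xw]; first by rewrite ffunE.
  by apply/eqP/ffunP => i; rewrite ffunE xw.
transitivity (fine (\prod_(i < n) @rho R p [set w i])); first by congr fine.
rewrite (eq_bigr (fun=> (p.+1%:R^-1)%:E)); last first.
  by move=> i _; rewrite rho_setE (big_pred1 (w i))// => k; rewrite in_set1.
by rewrite prodEFin /= prodr_const card_ord exprVn.
Qed.

End uniform_product.

(** * Entropy of random variables with finitely many values *)

Section gibbs_inequality.
Context {R : realType}.

Lemma ln_le_subr1 (x : R) : 0 < x -> ln x <= x - 1.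
Proof. by move=> x0; rewrite -[x in ln x](addrNK 1) addrC le_ln1Dx; lra. Qed.

Lemma ln_lt_subr1 (x : R) : 0 < x -> x != 1 -> ln x < x - 1.
Proof.
move=> x0 x1; have : ln x != 0.
  by apply: contra x1 => /eqP lx; rewrite -[x]lnK// lx expR0.
by move=> /expR_gt1Dx; rewrite lnK//; lra.
Qed.

Variables (J : finType) (P Q : J -> R).
Hypotheses (P0 : forall u, 0 <= P u) (Q0 : forall u, 0 <= Q u).
Hypotheses (PQ : forall u, 0 < P u -> 0 < Q u).
Hypotheses (P1 : \sum_u P u = 1) (Q1 : \sum_u Q u <= 1).

(** The summand of the relative entropy of [P] with respect to [Q], made nonnegative termwise by
    adding [Q u - P u]; the added terms have a sum at most 0. *)
Let gap u : R := Q u - P u - (P u * ln (Q u) - P u * ln (P u)).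

Let gapE u : 0 < P u -> gap u = P u * (Q u / P u - 1 - ln (Q u / P u)).
Proof.
move=> Pu; have Qu := PQ Pu.
rewrite /gap ln_div ?posrE// !mulrBr mulr1 mulrCA divff ?gt_eqF// mulr1.
by rewrite -mulrBr.
Qed.

Let gap_ge0 u : 0 <= gap u.
Proof.
have := P0 u; rewrite le_eqVlt => /predU1P[Pu|Pu].
  by rewrite /gap -Pu !mul0r !subr0.
rewrite gapE// mulr_ge0// subr_ge0 ln_le_subr1// divr_gt0//; exact: PQ.
Qed.

Let sum_gap : \sum_u gap u =
  \sum_u Q u - 1 - (\sum_u P u * ln (Q u) - \sum_u P u * ln (P u)).
Proof. by rewrite /gap !big_split/= !sumrN !big_split/= sumrN P1. Qed.

Lemma gibbs_ineq : - (\sum_u P u * ln (P u)) <= - (\sum_u P u * ln (Q u)).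
Proof.
have : 0 <= \sum_u gap u by apply: sumr_ge0.
by rewrite sum_gap; move: Q1; lra.
Qed.

(** Equality forces each [gap u] to vanish. If [P u = 0] this gap is [Q u]; otherwise [ln x < x - 1]
    away from 1 gives [Q u / P u = 1]. *)
Lemma gibbs_ineq_eq :
  - (\sum_u P u * ln (Q u)) <= - (\sum_u P u * ln (P u)) -> P =1 Q.
Proof.
move=> h u; have : \sum_u gap u = 0.
  apply/eqP; rewrite eq_le sumr_ge0// andbT sum_gap.
  by move: h Q1; lra.
move=> /psumr_eq0P -/(_ (fun u _ => gap_ge0 u) u isT).
have := P0 u; rewrite le_eqVlt => /predU1P[Pu|Pu].
  by rewrite /gap -Pu !mul0r !subr0.
rewrite gapE// => /eqP; rewrite mulf_eq0 gt_eqF//= => /eqP e.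
have [|/ln_lt_subr1] := eqVneq (Q u / P u) 1.
  by move=> /(congr1 ( *%R^~ (P u))); rewrite mulfVK ?mul1r// gt_eqF.
by rewrite divr_gt0 ?PQ// => /(_ isT); lra.
Qed.

End gibbs_inequality.

(** * Subadditive sequences *)

Section fekete.
Context {R : realType} (a : nat -> R).
Hypotheses (a_ge0 : forall n, 0 <= a n).
Hypothesis (aD : forall m n, a (m + n)%N <= a m + a n).

Let aM q m : a (q * m)%N <= a 0%N + q%:R * a m.
Proof.
elim: q => [|q IH]; first by rewrite mul0n mul0r addr0.
by rewrite mulSn; apply: (le_trans (aD _ _)); rewrite -natr1; lra.
Qed.

(** The limit is the infimum of [a m / m]. For a nearly optimal [m], Euclidean division of [n] by
    [m] bounds [a n] by [n (a m / m)] plus the constant [M], which absorbs all possible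
    remainders. *)
Lemma fekete : exists l, (n%:R^-1 * a n @[n --> \oo] --> l) /\
  forall m, (0 < m)%N -> l <= m%:R^-1 * a m.
Proof.
pose E := [set x | exists2 m, (0 < m)%N & x = m%:R^-1 * a m].
have E0 : has_inf E.
  split; first by exists (1%:R^-1 * a 1%N), 1%N.
  by exists 0 => _ [m m0 ->]; rewrite mulr_ge0 ?invr_ge0.
have lE m : (0 < m)%N -> inf E <= m%:R^-1 * a m.
  by move=> m0; apply: ge_inf; [exact: E0.2|exists m].
exists (inf E); split => //.
apply/cvgrPdist_le => e e0.
have e20 : 0 < e / 2 by rewrite divr_gt0.
have [_ [m m0 ->] me] := inf_adherent e20 E0.
pose M := a 0%N + \sum_(r < m) a r.
have aM' n : a n <= n%:R * (m%:R^-1 * a m) + M.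
  rewrite {1}(divn_eq n m); apply: (le_trans (aD _ _)).
  have r_m := ltn_pmod n m0.
  have ar : a (n %% m)%N <= \sum_(r < m) a r.
    by rewrite (bigD1 (Ordinal r_m))//= lerDl sumr_ge0.
  have : (n %/ m)%:R * a m <= n%:R * (m%:R^-1 * a m) :> R.
    rewrite mulrA ler_wpM2r// ler_pdivlMr ?ltr0n// -natrM ler_nat.
    exact: leq_trunc_div.
  by have := aM (n %/ m) m; rewrite /M; lra.
have Me0 : 0 <= M / (e / 2) by apply: divr_ge0; [apply: addr_ge0 => //; apply: sumr_ge0|exact: ltW].
near=> n.
have n0 : (0 < n)%N by near: n; exact: nbhs_infty_gt.
have n0' : 0 < n%:R :> R by rewrite ltr0n.
have Mn : M <= n%:R * (e / 2).
  rewrite -ler_pdivrMr//; near: n.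
  exists (Num.bound (M / (e / 2))) => // n /= hn.
  by apply: le_trans (ltW (archi_boundP Me0)) _; rewrite ler_nat.
have lEn := lE _ n0; rewrite distrC ger0_norm ?subr_ge0//.
suff : n%:R^-1 * a n <= m%:R^-1 * a m + e / 2 by lra.
rewrite mulrC ler_pdivrMr//; have := aM' n; lra.
Unshelve. all: by end_near.
Qed.

End fekete.

Section entropy_of_finite_variables.
Context {R : realType} d {T : measurableType d}.
Variable mu : {measure set T -> \bar R}.
Hypothesis mu1 : mu [set: T] = 1%E.

Definition fentropy (J : finType) (X : T -> J) : R :=
  - \sum_u fdist mu X u * ln (fdist mu X u).

Lemma fdist_le1 (J : finType) (X : T -> J) u : finite_valued X -> fdist mu X u <= 1.
Proof.
move=> mX; rewrite -(fdist_sum1 mu1 mX) (bigD1 u)//= lerDl sumr_ge0// => v _.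
exact: fdist_ge0.
Qed.

Lemma fentropy_ge0 (J : finType) (X : T -> J) : finite_valued X -> 0 <= fentropy X.
Proof.
move=> mX; rewrite oppr_ge0; apply: sumr_le0 => u _.
by rewrite mulr_ge0_le0 ?fdist_ge0// ln_le0// fdist_le1.
Qed.

Lemma fdist_pair_le (J K : finType) (X : T -> J) (Y : T -> K) uv :
  finite_valued X -> finite_valued Y ->
  fdist mu (fun x => (X x, Y x)) uv <= fdist mu X uv.1.
Proof.
move=> mX mY.
rewrite (fdist_comp mu1 fst uv.1 (finite_valued_pair mX mY)).
by rewrite (bigD1 uv)//= lerDl sumr_ge0// => v _; exact: fdist_ge0.
Qed.

(** Through the joint entropy: it is at least that of [X], a joint mass being at most the marginal
    one, and at most the cross entropy by the Gibbs inequality. *)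
Lemma fentropy_le_cross (J K : finType) (X : T -> J) (Y : T -> K) (Q : J * K -> R) :
  finite_valued X -> finite_valued Y ->
  (forall uv, 0 <= Q uv) ->
  (forall uv, 0 < fdist mu (fun x => (X x, Y x)) uv -> 0 < Q uv) ->
  \sum_uv Q uv <= 1 ->
  fentropy X <= - \sum_uv fdist mu (fun x => (X x, Y x)) uv * ln (Q uv).
Proof.
move=> mX mY Q0 PQ Q1; have mXY := finite_valued_pair mX mY.
apply: le_trans (gibbs_ineq _ Q0 PQ (fdist_sum1 mu1 mXY) Q1); last first.
  by move=> u; exact: fdist_ge0.
rewrite /fentropy lerN2; under [leRHS]eq_bigr do rewrite mulrC.
rewrite (fdist_expect_comp mu1 fst (fun u => ln (fdist mu X u)) mXY).
apply: ler_sum => uv _; rewrite mulrC.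
have := fdist_ge0 mu (fun x => (X x, Y x)) uv.
rewrite le_eqVlt => /predU1P[<-|Puv]; first by rewrite !mulr0.
rewrite ler_wpM2r ?(ltW Puv)// ler_ln ?posrE//; first exact: fdist_pair_le.
exact: lt_le_trans Puv (fdist_pair_le _ mX mY).
Qed.

End entropy_of_finite_variables.

(** * Approximation of measurable sets by cylinders *)

Section cylinder_approximation.
Context {R : realType} {p : nat}.
Local Notation S := (Sigma R p).

Definition determined n (C : set S) :=
  forall x y, initial_word x n = initial_word y n -> C x -> C y.

Lemma determined_le m n (C : set S) : (m <= n)%N -> determined m C -> determined n C.
Proof. by move=> mn dC x y xy; apply: dC; exact: initial_word_le mn xy. Qed.

Lemma determinedE n (C : set S) : determined n C ->
  C = [set x | `[<exists2 y, initial_word y n = initial_word x n & C y>]].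
Proof.
move=> dC; apply/seteqP; split=> x /=; first by move=> Cx; apply/asboolP; exists x.
by move=> /asboolP[y yx]; exact: dC.
Qed.

Lemma determined_measurable n (C : set S) : determined n C -> measurable C.
Proof.
move=> /determinedE ->.
exact: (@initial_word_finite_valued R p n
  (fun w => `[<exists2 y, initial_word y n = w & C y>])).
Qed.

Lemma determined_word_interior n U : determined n (word_interior n U).
Proof. by move=> x y xy xU z yz; apply: xU; rewrite xy. Qed.

Lemma determinedI n (C D : set S) :
  determined n C -> determined n D -> determined n (C `&` D).
Proof. by move=> dC dD x y xy [/(dC _ _ xy) ? /(dD _ _ xy)]. Qed.

Lemma determinedU n (C D : set S) :
  determined n C -> determined n D -> determined n (C `|` D).
Proof. by move=> dC dD x y xy [/(dC _ _ xy)|/(dD _ _ xy)]; [left|right]. Qed.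

Lemma determinedC n (C : set S) : determined n C -> determined n (~` C).
Proof. by move=> dC x y xy; apply: contra_not; apply: dC. Qed.

Lemma preimage_shift_determined n (C : set S) :
  determined n C -> determined n.+1 (left_shift @^-1` C).
Proof.
move=> dC x y /initial_wordP xy; apply: dC; apply/initial_wordP => i ni.
exact: xy.
Qed.

Lemma measurable_left_shift : measurable_fun setT (@left_shift R p).
Proof.
apply: (@measurability _ _ S S setT _ (@open S)) => //.
move=> _ [U oU <-]; rewrite setTI (open_word_interior oU) preimage_bigcup.
apply: bigcupT_measurable => n.
apply: (@determined_measurable n.+1); apply: preimage_shift_determined.
exact: determined_word_interior.
Qed.

Variable mu : {measure set S -> \bar R}.
Hypothesis mu1 : mu setT = 1%E.

Let symdiff (A C : set S) := (A `\` C) `|` (C `\` A).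

Definition approximable (A : set S) := measurable A /\
  forall e : R, 0 < e ->
    exists n C, determined n C /\ (mu (symdiff A C) <= e%:E)%E.

Let determined_approximable n (C : set S) : determined n C -> approximable C.
Proof.
move=> dC; split=> [|e e0]; first exact: determined_measurable dC.
by exists n, C; split => //; rewrite /symdiff setDv setU0 measure0 lee_fin ltW.
Qed.

Let le_symdiff (A B C : set S) : measurable A -> measurable B -> measurable C ->
  A `<=` B `|` C -> (mu A <= mu B + mu C)%E.
Proof.
move=> mA mB mC ABC; apply: le_trans (_ : _ <= mu (B `|` C))%E _; last exact: measureU2.
by apply: le_measure; rewrite ?inE//; exact: measurableU.
Qed.

Let measurable_symdiff A C : measurable A -> measurable C -> measurable (symdiff A C).
Proof. by move=> mA mC; apply: measurableU; exact: measurableD. Qed.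

Let approximableC A : approximable A -> approximable (~` A).
Proof.
move=> [mA aA]; split=> [|e /aA[n [C [dC AC]]]]; first exact: measurableC.
exists n, (~` C); split; first exact: determinedC.
rewrite (_ : symdiff _ _ = symdiff A C)//; rewrite /symdiff; apply/seteqP.
split=> x /= [[xA xC]|[xC xA]].
- by right; split=> //; apply: contrapT.
- by left; split=> //; apply: contrapT.
- by right; split=> //; exact.
- by left; split=> //; exact.
Qed.

Let approximableU A B : approximable A -> approximable B -> approximable (A `|` B).
Proof.
move=> [mA aA] [mB aB]; split=> [|e e0]; first exact: measurableU.
have e20 : 0 < e / 2 by rewrite divr_gt0.
have [m [C [dC AC]]] := aA _ e20; have [n [D [dD BD]]] := aB _ e20.
exists (maxn m n), (C `|` D); split.
  apply: determinedU; [exact: determined_le (leq_maxl m n) dC|].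
  exact: determined_le (leq_maxr m n) dD.
have mC := determined_measurable dC; have mD := determined_measurable dD.
apply: (@le_trans _ _ (mu (symdiff A C) + mu (symdiff B D))%E); last first.
  by rewrite [e]splitr EFinD leeD.
apply: le_symdiff.
- by apply: measurable_symdiff; exact: measurableU.
- exact: measurable_symdiff.
- exact: measurable_symdiff.
- rewrite /symdiff => x /= [[[?|?] /not_orP[? ?]]|[[?|?] /not_orP[? ?]]].
  + by left; left.
  + by right; left.
  + by left; right.
  + by right; right.
Qed.

Let approximable_nondecreasing (F : (set S)^nat) :
  nondecreasing_seq F -> (forall n, approximable (F n)) ->
  approximable (\bigcup_n F n).
Proof.
move=> ndF aF; have mF n : measurable (F n) := (aF n).1.
have mU : measurable (\bigcup_n F n) by exact: bigcupT_measurable.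
split=> // e e0; have e20 : 0 < e / 2 by rewrite divr_gt0.
have fin A : measurable A -> mu A \is a fin_num by exact: unit_mass_fin_num.
have [N NP] : exists N, (mu (\bigcup_n F n `\` F N) <= (e / 2)%:E)%E.
  have /fine_cvgP[_ /cvgrPdist_le/(_ _ e20)[N _ /(_ N (leqnn N))]] :
      mu (F n) @[n --> \oo] --> (fine (mu (\bigcup_n F n)))%:E.
    by rewrite fineK ?fin//; exact: nondecreasing_cvg_mu.
  move=> /= /ler_normlW; rewrite -fineB ?fin// => h; exists N.
  rewrite measureD//; last by rewrite -ge0_fin_numE// fin.
  rewrite setIidr; last exact: bigcup_sup.
  by rewrite -[leLHS]fineK ?fin_numB ?fin// lee_fin.
have [n [C [dC FC]]] := (aF N).2 _ e20; exists n, C; split=> //.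
have mC := determined_measurable dC.
apply: (@le_trans _ _ (mu (\bigcup_n F n `\` F N) + mu (symdiff (F N) C))%E); last first.
  by rewrite [e]splitr EFinD leeD.
apply: le_symdiff.
- exact: measurable_symdiff.
- exact: measurableD.
- exact: measurable_symdiff.
- rewrite /symdiff => x /= [[Ux Cx]|[Cx Ux]]; have [Fx|Fx] := pselect (F N x).
  + by right; left.
  + by left.
  + by exfalso; apply: Ux; exists N.
  + by right; right.
Qed.

(** The approximable sets form a sigma-algebra, closed under countable unions because these are
    increasing limits of finite ones. It contains the open sets, which are increasing unions of
    [word_interior n U]. *)
Lemma measurable_approximable A : measurable A -> approximable A.
Proof.
have sa : sigma_algebra setT approximable.
  split.
  - by apply: (@determined_approximable 0).
  - by move=> B aB; rewrite setTD; exact: approximableC.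
  - move=> F aF.
    pose G n := \big[setU/set0]_(i < n) F i.
    have -> : \bigcup_n F n = \bigcup_n G n.
      apply/seteqP; split=> x [n _]; last first.
        by rewrite /G -bigcup_mkord => -[k _ xk]; exists k.
      by move=> xn; exists n.+1 => //; rewrite /G big_ord_recr; right.
    apply: approximable_nondecreasing.
      by move=> m n mn; apply/subsetPset; exact: subset_bigsetU.
    elim=> [|n IH]; first by rewrite /G big_ord0; apply: (@determined_approximable 0).
    by rewrite /G big_ord_recr /=; exact: approximableU.
move=> mA; suff : <<s (@open S) >> `<=` approximable by apply.
apply: smallest_sub => // U oU; rewrite (open_word_interior oU).
apply: approximable_nondecreasing; first exact: nondecreasing_word_interior.
move=> n; apply: (@determined_approximable n); exact: determined_word_interior.
Qed.

Lemma finite_valued_approx (J : finType) (g : S -> J) (e : R) :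
  finite_valued g -> 0 < e -> exists n (c : {ffun 'I_n -> 'I_p.+1} -> J),
    fine (mu [set x | c (initial_word x n) != g x]) <= e.
Proof.
move=> mg e0; pose j0 := g (fun=> ord0).
have q0 : 0 < #|J|%:R :> R by rewrite ltr0n; apply/card_gt0P; exists j0.
have d0 : 0 < e / #|J|%:R by rewrite divr_gt0.
have /choice[nC nCP] : forall j, exists nC : nat * set S, determined nC.1 nC.2 /\
    (mu (symdiff [set x | g x == j] nC.2) <= (e / #|J|%:R)%:E)%E.
  move=> j; have [n [C ?]] := (measurable_approximable (mg (pred1 j))).2 _ d0.
  by exists (n, C).
pose n := \max_j (nC j).1.
have dC j : determined n (nC j).2.
  exact: determined_le (leq_bigmax j) (nCP j).1.
(* Outside the symmetric differences exactly one approximating set contains [x], that of [g x], and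
   [c] finds it; hence [c] errs only on their union. *)
pose c (w : {ffun 'I_n -> 'I_p.+1}) : J :=
  odflt j0 [pick j | `[<exists2 y, initial_word y n = w & (nC j).2 y>]].
exists n, c.
have mb j : measurable (symdiff [set x | g x == j] (nC j).2).
  apply: measurable_symdiff; first exact: (mg (pred1 j)).
  exact: determined_measurable (dC j).
have mbad : measurable [set x | c (initial_word x n) != g x].
  exact: (finite_valued_comp (fun uv => c uv.1 != uv.2)
    (finite_valued_pair (@initial_word_finite_valued R p n) mg) id).
have sub : [set x | c (initial_word x n) != g x] `<=`
    \bigcup_(j in [set: J]) symdiff [set x | g x == j] (nC j).2.
  move=> x /=; apply: contraNP => nx; apply/eqP.
  have {}nx j : (g x == j) = `[< (nC j).2 x >].
    apply/idP/asboolP => [gx|Cx].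
      by apply: contrapT => Cx; apply: nx; exists j => //; left.
    by apply: contrapT => gx; apply: nx; exists j => //; right.
  rewrite /c; case: pickP => [j /asboolP[y yx Cy]|/(_ (g x))] /=.
    by apply/esym/eqP; rewrite nx; apply/asboolP; exact: dC yx Cy.
  move=> /asboolP; case; exists x => //; apply/asboolP.
  by rewrite -nx.
rewrite -lee_fin fineK ?(unit_mass_fin_num mu1 mbad)//.
have mbU : measurable (\bigcup_(j in [set: J]) symdiff [set x | g x == j] (nC j).2).
  by apply: fin_bigcup_measurable => // j _; exact: mb.
rewrite (_ : [set: J] = [set` enum J]) in sub; last first.
  by apply/seteqP; split=> j //= _; rewrite mem_enum.
apply: (le_trans (content_sub_fsum mu _ _ mbad sub)) => //.
rewrite -fsbig_seq ?enum_uniq// big_enum/=; apply: (@le_trans _ _ (\sum_(j : J) (e / #|J|%:R)%:E)%E).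
  by apply: lee_sum => j _; exact: (nCP j).2.
by rewrite sumEFin lee_fin sumr_const -[leLHS]mulr_natr mulfVK// gt_eqF.
Qed.

End cylinder_approximation.

(** * Kolmogorov-Sinai entropy *)

Lemma ln_prod {R : realType} (I : Type) (r : seq I) (P : pred I) (F : I -> R) :
  (forall i, 0 < F i) -> ln (\prod_(i <- r | P i) F i) = \sum_(i <- r | P i) ln (F i).
Proof.
move=> F0; suff [] : ln (\prod_(i <- r | P i) F i) = \sum_(i <- r | P i) ln (F i) /\
  0 < \prod_(i <- r | P i) F i by [].
elim/big_rec2 : _ => [|i x y _ [<- y0]]; first by rewrite ln1.
by rewrite lnM ?posrE// mulr_gt0.
Qed.

Lemma ler_sum_inj {R : realType} (I J : finType) (k : I -> J) (F : J -> R) :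
  injective k -> (forall v, 0 <= F v) -> \sum_u F (k u) <= \sum_v F v.
Proof.
move=> kI F0; rewrite -(big_imset F (h := k) (A := predT))/=; last first.
  by move=> u v _ _; exact: kI.
rewrite [leRHS](bigID (fun v => v \in imset k (mem predT)))/= lerDl.
by apply: sumr_ge0 => v _; exact: F0.
Qed.

Section entropy_of_invariant_measures.
Context {R : realType} {p : nat}.
Local Notation S := (Sigma R p).
Variable mu : probability S R.
Hypothesis inv : invariant_measure mu left_shift.

Let mu1 : mu setT = 1%E. Proof. exact: probability_setT. Qed.

Lemma iter_left_shift (x : S) i n : iter i left_shift x n = x (i + n)%N.
Proof. by elim: i n => // i IH n; rewrite iterS /left_shift IH addSnnS. Qed.

Lemma finite_valued_iter (J : finType) (X : S -> J) i : finite_valued X ->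
  finite_valued (fun x => X (iter i left_shift x)).
Proof.
elim: i => // i IH mX B; have := measurable_left_shift measurableT (IH mX B).
by rewrite setTI; congr measurable; apply/seteqP; split => x /=; rewrite -iterS iterSr.
Qed.

Lemma fdist_iter (J : finType) (X : S -> J) i u : finite_valued X ->
  fdist mu (fun x => X (iter i left_shift x)) u = fdist mu X u.
Proof.
elim: i => // i IH mX; rewrite -IH// /fdist; congr fine.
apply: etrans (inv (finite_valued_iter i mX (pred1 u))).
by congr (mu _); apply/seteqP; split => x /=; rewrite -iterS iterSr.
Qed.

Definition itinerary (J : finType) (g : S -> J) n (x : S) : {ffun 'I_n -> J} :=
  [ffun i : 'I_n => g (iter i left_shift x)].

Lemma finite_valued_itinerary (J : finType) (g : S -> J) n :
  finite_valued g -> finite_valued (itinerary g n).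
Proof.
move=> mg; apply: finite_valued_fiber => w.
rewrite (_ : [set _ | _] =
    \bigcap_(i in [set: 'I_n]) [set x | g (iter i left_shift x) == w i]); last first.
  apply/seteqP; split=> x /=; first by move=> /eqP <- i _; rewrite /= ffunE.
  by move=> xw; apply/eqP/ffunP => i; rewrite ffunE; apply/eqP/xw.
apply: fin_bigcap_measurable => [|i _]; first exact: finite_finset.
exact: (finite_valued_iter i mg (pred1 (w i))).
Qed.

Lemma initial_word_itinerary n :
  (fun x : S => initial_word x n) = itinerary (fun x : S => x 0) n.
Proof. by apply/funext => x; apply/ffunP => i; rewrite !ffunE iter_left_shift addn0. Qed.

Lemma finite_valued_letter : finite_valued (fun x : S => x 0).
Proof.
have := finite_valued_comp (fun w : {ffun 'I_1 -> _} => w ord0)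
  (@initial_word_finite_valued R p 1).
by congr finite_valued; apply/funext => x; rewrite ffunE.
Qed.

Lemma fdist_le_comp (J K : finType) (X : S -> J) (f : J -> K) u :
  finite_valued X -> fdist mu X u <= fdist mu (fun x => f (X x)) (f u).
Proof.
move=> mX; rewrite (fdist_comp mu1 f _ mX) (bigD1 u)//= lerDl sumr_ge0// => v _.
exact: fdist_ge0.
Qed.

Lemma mulr_lnM (P a b : R) : 0 <= P -> (0 < P -> 0 < a) -> (0 < P -> 0 < b) ->
  P * ln (a * b) = P * ln a + P * ln b.
Proof.
rewrite le_eqVlt => /predU1P[<-|P0 a0 b0]; first by rewrite !mul0r addr0.
by rewrite lnM ?posrE ?a0 ?b0// mulrDr.
Qed.

Let H (J : finType) (g : S -> J) n := fentropy mu (itinerary g n).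

(** The Gibbs inequality compares the law of the long itinerary with the product of the laws of its
    two halves; by invariance the second half has the law of an itinerary that starts at time 0. *)
Lemma fentropy_itineraryD (J : finType) (g : S -> J) m n : finite_valued g ->
  H g (m + n) <= H g m + H g n.
Proof.
move=> mg; have mI k : finite_valued (itinerary g k) by exact: finite_valued_itinerary.
pose f (u : {ffun 'I_(m + n) -> J}) := [ffun i => u (lshift n i)].
pose h (u : {ffun 'I_(m + n) -> J}) := [ffun i => u (rshift m i)].
have fE : (fun x => f (itinerary g (m + n) x)) = itinerary g m.
  by apply/funext => x; apply/ffunP => i; rewrite !ffunE.
have hE : (fun x => h (itinerary g (m + n) x)) =
    (fun x => itinerary g n (iter m left_shift x)).
  apply/funext => x; apply/ffunP => i; rewrite !ffunE /=.
  by rewrite addnC iterD.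
have hP u : fdist mu (fun x => h (itinerary g (m + n) x)) u = fdist mu (itinerary g n) u.
  by rewrite hE fdist_iter.
have P0 u : 0 <= fdist mu (itinerary g (m + n)) u by exact: fdist_ge0.
have Pf u : fdist mu (itinerary g (m + n)) u <= fdist mu (itinerary g m) (f u).
  by rewrite -fE; exact: fdist_le_comp.
have Ph u : fdist mu (itinerary g (m + n)) u <= fdist mu (itinerary g n) (h u).
  by rewrite -hP; exact: fdist_le_comp.
pose Q u := fdist mu (itinerary g m) (f u) * fdist mu (itinerary g n) (h u).
have Q0 u : 0 <= Q u by rewrite mulr_ge0// fdist_ge0.
have PQ u : 0 < fdist mu (itinerary g (m + n)) u -> 0 < Q u.
  by move=> u0; rewrite mulr_gt0// (lt_le_trans u0).
have Q1 : \sum_u Q u <= 1.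
  pose F (ab : {ffun 'I_m -> J} * {ffun 'I_n -> J}) :=
    fdist mu (itinerary g m) ab.1 * fdist mu (itinerary g n) ab.2.
  have inj : injective (fun u => (f u, h u)).
    move=> u v [fuv huv]; apply/ffunP => i; case: (split_ordP i) => j ->.
      by have /ffunP/(_ j) := fuv; rewrite !ffunE.
    by have /ffunP/(_ j) := huv; rewrite !ffunE.
  apply: (@le_trans _ _ (\sum_ab F ab)).
    by apply: (ler_sum_inj inj (F := F)) => ab; rewrite mulr_ge0// fdist_ge0.
  rewrite -(pair_bigA _ (fun a b =>
    fdist mu (itinerary g m) a * fdist mu (itinerary g n) b))/=.
  rewrite (eq_bigr (fun a => fdist mu (itinerary g m) a)); last first.
    by move=> a _; rewrite -mulr_sumr fdist_sum1// mulr1.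
  by rewrite fdist_sum1.
apply: le_trans (gibbs_ineq P0 Q0 PQ (fdist_sum1 mu1 (mI _)) Q1) _.
rewrite (eq_bigr (fun u => ln (fdist mu (itinerary g m) (f u)) *
    fdist mu (itinerary g (m + n)) u + ln (fdist mu (itinerary g n) (h u)) *
    fdist mu (itinerary g (m + n)) u)); last first.
  move=> u _; rewrite mulr_lnM//; last 2 first.
    by move=> u0; exact: lt_le_trans u0 (Pf u).
    by move=> u0; exact: lt_le_trans u0 (Ph u).
  by congr (_ + _); rewrite mulrC.
rewrite big_split/= opprD.
rewrite -(fdist_expect_comp mu1 f (fun a => ln (fdist mu (itinerary g m) a)) (mI _)).
rewrite -(fdist_expect_comp mu1 h (fun a => ln (fdist mu (itinerary g n) a)) (mI _)).
rewrite fE; under [in X in _ - X]eq_bigr do rewrite hP.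
by rewrite /H /fentropy; apply: lerD; rewrite lerN2;
  apply: ler_sum => u _; rewrite mulrC.
Qed.

Lemma fentropy_itinerary_rate (J : finType) (g : S -> J) : finite_valued g ->
  exists l, (n%:R^-1 * H g n @[n --> \oo] --> l) /\
    forall m, (0 < m)%N -> l <= m%:R^-1 * H g m.
Proof.
move=> mg; apply: fekete => [n|m n]; last exact: fentropy_itineraryD.
by apply: fentropy_ge0 => //; exact: finite_valued_itinerary.
Qed.

(* The Gibbs inequality is applied to the kernel that reads the guess [c] of
   [g] off the first [N] letters and is wrong with probability at most [delta]. *)
Lemma fentropy_itinerary_approx (J : finType) (g : S -> J) N
    (c : {ffun 'I_N -> 'I_p.+1} -> J) (delta : R) n :
  finite_valued g -> 0 < delta < 1 ->
  H g n <= H (fun x => x 0) (n + N) + n%:R * (- ln (1 - delta) -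
    fine (mu [set x | c (initial_word x N) != g x]) * ln (delta / #|J|%:R)).
Proof.
move=> mg /andP[d0 d1].
have J0 : 0 < #|J|%:R :> R by rewrite ltr0n; apply/card_gt0P; exists (g (fun=> ord0)).
pose K (vb : J * {ffun 'I_N -> 'I_p.+1}) : R :=
  if vb.1 == c vb.2 then 1 - delta else delta / #|J|%:R.
have K0 vb : 0 < K vb.
  by rewrite /K; case: ifP => _; [rewrite subr_gt0|rewrite divr_gt0].
have K1 b : \sum_v K (v, b) <= 1.
  rewrite (bigD1 (c b))//= {1}/K /= eqxx.
  rewrite (eq_bigr (fun=> delta / #|J|%:R)); last first.
    by move=> v /negbTE vc; rewrite /K /= vc.
  rewrite -lerBrDl; have -> : 1 - (1 - delta) = delta by ring.
  apply: (@le_trans _ _ (\sum_(v : J) delta / #|J|%:R)).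
    by rewrite [leRHS](bigD1 (c b))//= lerDr divr_ge0 ?ltW.
  by rewrite sumr_const -[leLHS]mulr_natr mulfVK ?gt_eqF.
have subp (i : 'I_n) (j : 'I_N) : (i + j < n + N)%N.
  by rewrite -addSn leq_add// ltnW.
pose sub (a : {ffun 'I_(n + N) -> 'I_p.+1}) (i : 'I_n) :=
  [ffun j : 'I_N => a (Ordinal (subp i j))].
pose X (x : S) := itinerary g n x; pose A (x : S) := initial_word x (n + N).
have mX : finite_valued X by exact: finite_valued_itinerary.
have mA : finite_valued A by exact: initial_word_finite_valued.
have mXA := finite_valued_pair mX mA.
pose Q (wa : {ffun 'I_n -> J} * {ffun 'I_(n + N) -> 'I_p.+1}) := fdist mu A wa.2 * \prod_(i < n) K (wa.1 i, sub wa.2 i).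
have Pi0 (wa : {ffun 'I_n -> J} * _) : 0 < \prod_(i < n) K (wa.1 i, sub wa.2 i).
  exact: prodr_gt0.
have Q0 wa : 0 <= Q wa by rewrite mulr_ge0 ?fdist_ge0// ltW.
have PA wa : fdist mu (fun x => (X x, A x)) wa <= fdist mu A wa.2.
  exact: (@fdist_le_comp _ _ _ snd).
have PQ wa : 0 < fdist mu (fun x => (X x, A x)) wa -> 0 < Q wa.
  by move=> wa0; rewrite mulr_gt0// (lt_le_trans wa0).
have Q1 : \sum_wa Q wa <= 1.
  rewrite -(pair_bigA _ (fun w a => Q (w, a))) exchange_big/= -(fdist_sum1 mu1 mA).
  apply: ler_sum => a _; rewrite /Q /= -mulr_sumr ler_piMr ?fdist_ge0//.
  rewrite -(bigA_distr_bigA (fun (i : 'I_n) v => K (v, sub a i))).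
  by apply: prodr_ile1 => i _; rewrite K1 andbT sumr_ge0// => v _; exact: ltW.
apply: le_trans (fentropy_le_cross mu1 mX mA Q0 PQ Q1) _.
rewrite (eq_bigr (fun wa => ln (fdist mu A wa.2) * fdist mu (fun x => (X x, A x)) wa +
    \sum_(i < n) ln (K (wa.1 i, sub wa.2 i)) * fdist mu (fun x => (X x, A x)) wa));
    last first.
  move=> wa _; rewrite mulr_lnM ?fdist_ge0//; last first.
    by move=> wa0; exact: lt_le_trans wa0 (PA wa).
  by rewrite ln_prod// mulr_sumr mulrC; congr (_ + _); apply: eq_bigr => i _; rewrite mulrC.
rewrite big_split/= opprD exchange_big/=.
rewrite -(fdist_expect_comp mu1 snd (fun a => ln (fdist mu A a)) mXA).
pose gN x := (g x, initial_word x N).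
have mgN : finite_valued gN.
  exact: finite_valued_pair mg (@initial_word_finite_valued R p N).
rewrite [X in _ - X](eq_bigr (fun=> \sum_vb ln (K vb) * fdist mu gN vb)); last first.
  move=> i _.
  rewrite -(fdist_expect_comp mu1 (fun wa : {ffun 'I_n -> J} * _ => (wa.1 i, sub wa.2 i))
    (fun vb => ln (K vb)) mXA)/=.
  apply: eq_bigr => vb _; rewrite -(fdist_iter i _ mgN); congr (_ * fdist mu _ _).
  apply/funext => x; rewrite /gN /X /A ffunE; congr pair.
  by apply/ffunP => j; rewrite !ffunE iter_left_shift.
rewrite sumr_const card_ord -[X in _ - X]mulr_natl lerD//.
  rewrite /H -initial_word_itinerary /fentropy lerN2.
  by apply: ler_sum => a _; rewrite mulrC.
rewrite -mulrN ler_wpM2l// (bigID (fun vb : J * _ => c vb.2 != vb.1))/=.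
rewrite (fdist_event mu1 (fun vb : J * _ => c vb.2 != vb.1) mgN).
rewrite opprD addrC lerD//.
  rewrite -[leRHS]mul1r mulrN lerN2.
  have l0 : ln (1 - delta) <= 0 by rewrite ln_le0// gerBl ltW.
  rewrite (eq_bigr (fun vb => fdist mu gN vb * ln (1 - delta))); last first.
    by move=> vb; rewrite negbK /K eq_sym => ->; rewrite mulrC.
  rewrite -mulr_suml ler_wnM2r//.
  rewrite -(fdist_sum1 mu1 mgN) [leRHS](bigID (fun vb : J * _ => c vb.2 != vb.1))/=.
  by rewrite lerDr sumr_ge0// => vb _; exact: fdist_ge0.
rewrite lerN2 mulr_suml; apply: ler_sum => vb /negbTE cv.
by rewrite /K eq_sym cv mulrC.
Qed.

(** No partition has a larger rate than the partition by the first letter, since it is nearly a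
    function of finitely many letters; and the rate of the latter is an infimum over [m]. *)
Lemma limn_itinerary_le (J : finType) (g : S -> J) m : finite_valued g -> (0 < m)%N ->
  limn (fun n => n%:R^-1 * H g n) <= m%:R^-1 * H (fun x => x 0) m.
Proof.
move=> mg m0; have [l [gl _]] := fentropy_itinerary_rate mg.
rewrite (cvg_lim _ gl)//.
have [a [la /(_ _ m0)]] := fentropy_itinerary_rate finite_valued_letter.
apply: le_trans; apply/ler_addgt0Pr => e e0.
have e30 : 0 < e / 3 by rewrite divr_gt0.
(* Chosen so that [- ln (1 - delta) = e / 3]. The two other thirds pay for the wrong guesses and for
   the [N] additional letters. *)
pose delta := 1 - expR (- (e / 3)).
have d01 : 0 < delta < 1.
  by rewrite /delta subr_gt0 expR_lt1 oppr_lt0 e30 gtrBl expR_gt0.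
have J0 : 0 < #|J|%:R :> R by rewrite ltr0n; apply/card_gt0P; exists (g (fun=> ord0)).
have J1 : 1 <= #|J|%:R :> R by rewrite ler1n -(ltr0n R).
set L := - ln (delta / #|J|%:R).
have L0 : 0 <= L.
  rewrite oppr_ge0 ln_le0// ler_pdivrMr// mul1r.
  by apply: le_trans J1; case/andP: d01 => _ /ltW.
(* [L + 1] rather than [L], which may be 0. *)
have bad0 : 0 < e / 3 / (L + 1) by rewrite divr_gt0// ltr_wpDl.
have [N [c cP]] := finite_valued_approx mu1 mg bad0.
have {}cP : fine (mu [set x | c (initial_word x N) != g x]) * L <= e / 3.
  apply: (@le_trans _ _ (e / 3 / (L + 1) * L)); first exact: ler_wpM2r.
  by rewrite -mulrA ger_pMr// mulrC ler_pdivrMr ?ltr_wpDl// mul1r lerDl.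
have {}la : n%:R^-1 * H (fun x => x 0) n + e @[n --> \oo] --> a + e.
  by apply: cvgD => //; exact: cvg_cst.
apply: (ler_cvg_to gl la).
have HN0 : 0 <= H (fun x => x 0) N.
  by apply: fentropy_ge0 => //; apply: finite_valued_itinerary; exact: finite_valued_letter.
near=> n.
have n0 : (0 < n)%N by near: n; exact: nbhs_infty_gt.
have n0' : 0 < n%:R :> R by rewrite ltr0n.
have Hn : H (fun x => x 0) N <= n%:R * (e / 3).
  rewrite -ler_pdivrMr//; near: n.
  exists (Num.bound (H (fun x => x 0) N / (e / 3))) => // n /= hn.
  apply: le_trans (ltW (archi_boundP _)) _; last by rewrite ler_nat.
  by rewrite divr_ge0// ltW.
rewrite ler_pdivrMl// mulrDr mulVKf ?gt_eqF//.
have h1 := fentropy_itinerary_approx c n mg d01.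
have h2 := fentropy_itineraryD n N finite_valued_letter.
have h3 : ln (1 - delta) = - (e / 3) by rewrite /delta subKr expRK.
have h4 : n%:R * (e / 3 + fine (mu [set x | c (initial_word x N) != g x]) * L) <=
    n%:R * (e / 3 + e / 3) by rewrite ler_wpM2l// ?lerD2l// ltW.
rewrite h3 opprK -mulrN in h1; move: h1 h2 h4 Hn; rewrite -/L; lra.
Unshelve. all: by end_near.
Qed.

Lemma entropy_rateE (J : finType) (g : S -> J) (xi : J -> set S) :
  (forall j, xi j = [set x | g x == j]) ->
  entropy_rate mu left_shift xi = limn (fun n => n%:R^-1 * H g n).
Proof.
move=> xiE; rewrite /entropy_rate; congr (limn _).
apply/funext => n; congr (_ * _).
rewrite /H /partition_entropy /fentropy; congr (- _).
apply: eq_bigr => w _; suff -> : dynamical_join left_shift xi w =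
  [set x | itinerary g n x == w] by [].
apply/seteqP; split=> x; rewrite /dynamical_join /=.
  by move=> xw; apply/eqP/ffunP => i; rewrite ffunE; have := xw i I; rewrite /= xiE => /eqP.
by move=> /eqP <- i _; rewrite /= xiE /= ffunE.
Qed.

(** A bound for each [m] and not only in the limit: [m = 1] bounds the pressure, and the other
    values of [m] identify an equilibrium state on the words of length [m]. *)
Lemma KS_entropy_le m : (0 < m)%N ->
  (KS_entropy mu left_shift <=
    (m%:R^-1 * fentropy mu (fun x => initial_word x m))%:E)%E.
Proof.
move=> m0; apply: ge_ereal_sup => _ [l [xi [mxi [xiT xitriv _] ->]]].
have /choice[g gP] : forall x, exists i, xi i x.
  by move=> x; have : [set: S] x by []; rewrite -xiT => -[i _ xix]; exists i.
have xiE j : xi j = [set x | g x == j].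
  apply/seteqP; split=> x /=; last by move=> /eqP <-.
  move=> xjx; apply/eqP; apply: (xitriv (g x) j) => //.
  by exists x; split.
have mg : finite_valued g.
  by apply: finite_valued_fiber => j; rewrite -xiE.
rewrite lee_fin (entropy_rateE xiE) initial_word_itinerary.
exact: limn_itinerary_le.
Qed.

Lemma KS_entropy_ge : ((limn (fun n => n%:R^-1 * fentropy mu (fun x => initial_word x n)))%:E
  <= KS_entropy mu left_shift)%E.
Proof.
apply: ereal_sup_ubound; exists p.+1, (fun k => [set x | x 0 == k]); split.
- by move=> k; exact: (finite_valued_letter (pred1 k)).
- split.
  + by apply/seteqP; split=> // x _; exists (x 0) => /=.
  + by move=> i j _ _ [x [/eqP <- /eqP <-]].
  + by move=> i _; exists (fun=> i) => /=; exact: eqxx.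
- rewrite (entropy_rateE (g := fun x => x 0))//; congr (limn _)%:E.
  by apply/funext => n; rewrite initial_word_itinerary.
Qed.

End entropy_of_invariant_measures.

(** * The dynamical Gibbs measures *)

Section word_cons.
Context {R : realType}.

Definition word_cons n (T : finType) (k : T) (w : {ffun 'I_n -> T}) : {ffun 'I_n.+1 -> T} :=
  [ffun i => oapp w k (unlift ord0 i)].

Lemma sum_words_recl n (T : finType) (F : {ffun 'I_n.+1 -> T} -> R) :
  \sum_w F w = \sum_k \sum_w F (word_cons k w).
Proof.
rewrite pair_bigA/= (reindex (fun kw : T * {ffun 'I_n -> T} => word_cons kw.1 kw.2))//.
exists (fun w : {ffun 'I_n.+1 -> T} => (w ord0, [ffun i : 'I_n => w (lift ord0 i)])) => [[k w] _ /=|w _ /=].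
  rewrite /word_cons ffunE unlift_none; congr pair; apply/ffunP => i.
  by rewrite !ffunE liftK.
apply/ffunP => i; rewrite !ffunE.
by case: unliftP => [j ->|->] //=; rewrite ffunE.
Qed.

End word_cons.

Section bernoulli_equilibrium.
Context {R : realType} {p : nat}.
Local Notation S := (Sigma R p).

(** The measure and its image under the shift agree on the sets determined by finitely many letters,
    where the weights of the deleted first letter sum to 1. These sets are stable under intersection
    and generate the sigma-algebra. *)
Lemma bernoulli_invariant (P : probability S R) (pi : 'I_p.+1 -> R) :
  \sum_k pi k = 1 ->
  (forall n (w : {ffun 'I_n -> 'I_p.+1}),
    fdist P (fun x => initial_word x n) w = \prod_i pi (w i)) ->
  invariant_measure P left_shift.
Proof.
move=> pi1 PE.
have P1 : P setT = 1%E by exact: probability_setT.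
pose sh : {mfun S >-> S} := mfun_Sub (mem_set measurable_left_shift).
pose G : set (set S) := [set C | exists n, determined n C].
have mG : @measurable _ S = <<s G >>.
  apply/seteqP; split; last first.
    apply: smallest_sub; first exact: sigma_algebra_measurable.
    by move=> C [n dC]; exact: determined_measurable dC.
  suff : <<s (@open S) >> `<=` <<s G >> by [].
  apply: smallest_sub; first exact: smallest_sigma_algebra.
  move=> U oU; rewrite (open_word_interior oU).
  have [_ _ h] := smallest_sigma_algebra setT G.
  apply: h => n; apply: sub_sigma_algebra; exists n.
  exact: determined_word_interior.
move=> A mA; have -> : P (left_shift @^-1` A) = distribution P sh A.
  by rewrite /distribution /pushforward mfun_valP.
apply: (@measure_unique _ R S G (fun=> setT)) mA => //.
- move=> C D [m dC] [n dD]; exists (maxn m n); apply: determinedI.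
    exact: determined_le (leq_maxl m n) dC.
  exact: determined_le (leq_maxr m n) dD.
- by move=> _; exists 0%N.
- by rewrite bigcup_const.
- move=> C [n dC].
  change (P (left_shift @^-1` C) = P C).
  have mC := determined_measurable dC.
  have mS := determined_measurable (preimage_shift_determined dC).
  rewrite -[LHS]fineK ?(unit_mass_fin_num P1 mS)//.
  rewrite -[RHS]fineK ?(unit_mass_fin_num P1 mC)//; congr (_%:E).
  pose B (w : {ffun 'I_n -> 'I_p.+1}) := `[<exists2 y, initial_word y n = w & C y>].
  have mw k := @initial_word_finite_valued R p k.
  pose tl (w : {ffun 'I_n.+1 -> 'I_p.+1}) := [ffun i : 'I_n => w (lift ord0 i)].
  have tlE x : tl (initial_word x n.+1) = initial_word (left_shift x) n.
    by apply/ffunP => i; rewrite !ffunE.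
  have -> : left_shift @^-1` C = [set x | B (tl (initial_word x n.+1))].
    by rewrite [in LHS](determinedE dC); apply/seteqP; split=> x /=; rewrite tlE.
  rewrite [in RHS](determinedE dC) (fdist_event P1 (fun w => B (tl w)) (mw n.+1)).
  rewrite (fdist_event P1 B (mw n)) big_mkcond sum_words_recl /=.
  rewrite -[RHS]mul1r -pi1 mulr_suml; apply: eq_bigr => k _.
  rewrite mulr_sumr [RHS]big_mkcond; apply: eq_bigr => w _.
  rewrite (_ : tl (word_cons k w) = w); last by apply/ffunP => i; rewrite !ffunE liftK.
  case: (B w) => //; rewrite !PE big_ord_recl ffunE unlift_none; congr (_ * _).
  by apply: eq_bigr => i _; rewrite ffunE liftK.
- by move=> _; apply: le_lt_trans (probability_le1 _ measurableT) (ltry 1).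
Qed.

(** Its logarithm is the potential up to the constant [ln Zb], which turns out to be the
    pressure. *)
Definition letter_weight (k : 'I_p.+1) (b : R) (j : 'I_p.+1) : R :=
  expR (b * (j == k)%:R) / \sum_(i < p.+1) expR (b * (i == k)%:R).

Variables (k : 'I_p.+1) (b : R).
Let Zb : R := \sum_(i < p.+1) expR (b * (i == k)%:R).

Let Zb_gt0 : 0 < Zb.
Proof.
by rewrite /Zb (bigD1 k)//= ltr_wpDr ?expR_gt0// sumr_ge0// => i _; exact: expR_ge0.
Qed.

Lemma letter_weight_gt0 j : 0 < letter_weight k b j.
Proof. by rewrite divr_gt0 ?expR_gt0. Qed.

Lemma letter_weight_sum1 : \sum_j letter_weight k b j = 1.
Proof. by rewrite -mulr_suml mulfV// gt_eqF. Qed.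

Let ln_letter_weight j : ln (letter_weight k b j) = b * (j == k)%:R - ln Zb.
Proof. by rewrite ln_div ?posrE ?expR_gt0// expRK. Qed.

Let letter_mass (mu : probability S R) : R := fdist mu (fun x => x 0) k.

Let integral_letter (mu : probability S R) :
  (\int[mu]_x (letter_potential k b x)%:E = (b * letter_mass mu)%:E)%E.
Proof.
have mu1 : mu setT = 1%E by exact: probability_setT.
transitivity (\sum_j (b * (j == k)%:R) * fdist mu (fun x : S => x 0) j)%:E.
  rewrite -(integral_fdist mu1 _ finite_valued_letter); apply: eq_integral => x _.
  by rewrite /letter_potential indicE /cylinder; congr (b * (nat_of_bool _)%:R)%:E;
    apply/idP/eqP; rewrite ?inE.
rewrite (bigD1 k)//= eqxx mulr1 big1 ?addr0// => j /negbTE ->.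
by rewrite mulr0 mul0r.
Qed.

(** As [ln (letter_weight k b j)] is affine in the indicator of [k], invariance makes the cross
    entropy depend on [mu] only through the mass of the letter [k], hence on the integral of the
    potential. *)
Let cross_entropy (mu : probability S R) n : invariant_measure mu left_shift ->
  - (\sum_w fdist mu (fun x => initial_word x n) w * ln (\prod_i letter_weight k b (w i)))
  = n%:R * (ln Zb - b * letter_mass mu).
Proof.
move=> inv; have mu1 : mu setT = 1%E by exact: probability_setT.
have mw := @initial_word_finite_valued R p n.
rewrite (eq_bigr (fun w : {ffun 'I_n -> 'I_p.+1} =>
    \sum_i fdist mu (fun x => initial_word x n) w * ln (letter_weight k b (w i))));
    last first.
  by move=> w _; rewrite ln_prod ?mulr_sumr// => i; exact: letter_weight_gt0.
rewrite exchange_big/= -sumrN.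
rewrite (eq_bigr (fun=> ln Zb - b * letter_mass mu)); last first.
  move=> i _; under eq_bigr do rewrite mulrC.
  rewrite -(fdist_expect_comp mu1 (fun w : {ffun 'I_n -> 'I_p.+1} => w i)
    (fun j => ln (letter_weight k b j)) mw).
  rewrite (eq_bigr (fun j => b * (j == k)%:R * fdist mu (fun x => x 0) j -
      ln Zb * fdist mu (fun x => x 0) j)); last first.
    move=> j _; rewrite ln_letter_weight mulrBl.
    have -> : fdist mu (fun x => initial_word x n i) j = fdist mu (fun x => x 0) j.
      rewrite -(fdist_iter inv i j finite_valued_letter); congr (fdist mu _ j).
      by apply/funext => x; rewrite ffunE iter_left_shift addn0.
    by [].
  rewrite sumrB -mulr_sumr (fdist_sum1 mu1 finite_valued_letter) mulr1 opprB; congr (_ - _).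
  rewrite (bigD1 k)//= eqxx mulr1 big1 ?addr0// => j /negbTE ->.
  by rewrite mulr0 mul0r.
by rewrite sumr_const card_ord -[LHS]mulr_natl.
Qed.

Let entropy_le (mu : probability S R) n : invariant_measure mu left_shift ->
  fentropy mu (fun x => initial_word x n) <= n%:R * (ln Zb - b * letter_mass mu) /\
  (n%:R * (ln Zb - b * letter_mass mu) <= fentropy mu (fun x => initial_word x n) ->
   forall w, fdist mu (fun x => initial_word x n) w = \prod_i letter_weight k b (w i)).
Proof.
move=> inv; have mu1 : mu setT = 1%E by exact: probability_setT.
have mw := @initial_word_finite_valued R p n.
rewrite -(cross_entropy n inv) /fentropy.
have P0 w : 0 <= fdist mu (fun x => initial_word x n) w by exact: fdist_ge0.
have Q0 (w : {ffun 'I_n -> 'I_p.+1}) : 0 < \prod_i letter_weight k b (w i).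
  by apply: prodr_gt0 => i _; exact: letter_weight_gt0.
have Q1 : \sum_(w : {ffun 'I_n -> 'I_p.+1}) \prod_i letter_weight k b (w i) <= 1.
  by rewrite sum_prod_words// letter_weight_sum1.
split.
  apply: gibbs_ineq => // [w|]; [exact: ltW|exact: fdist_sum1].
move=> h w; apply: (gibbs_ineq_eq P0 _ _ (fdist_sum1 mu1 mw) Q1 h) => // v.
exact: ltW.
Qed.

Let free_energy_le (mu : probability S R) : invariant_measure mu left_shift ->
  (free_energy (letter_potential k b) mu <= (ln Zb)%:E)%E.
Proof.
move=> inv; rewrite /free_energy integral_letter.
apply: (@le_trans _ _ ((ln Zb - b * letter_mass mu)%:E + (b * letter_mass mu)%:E)%E).
  apply: leeD => //; apply: le_trans (KS_entropy_le inv (m := 1) _) _ => //.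
  by rewrite lee_fin invr1 mul1r; have [] := entropy_le 1 inv; rewrite mul1r.
by rewrite -EFinD subrK.
Qed.

(** Attaining the bound forces the entropy of the words of length [n] to be at least the cross
    entropy with the product weights; this is the equality case of the Gibbs inequality, for each
    [n]. *)
Let equilibrium_cylinder (mu : probability S R) : invariant_measure mu left_shift ->
  ((ln Zb)%:E <= free_energy (letter_potential k b) mu)%E ->
  forall n w, fdist mu (fun x => initial_word x n) w = \prod_i letter_weight k b (w i).
Proof.
move=> inv; rewrite /free_energy integral_letter => h n w.
apply: (entropy_le n inv).2.
have [->|n0] := posnP n.
  rewrite mul0r; apply: fentropy_ge0; first exact: probability_setT.
  exact: initial_word_finite_valued.
rewrite -ler_pdivlMl ?ltr0n// -lee_fin; apply: le_trans (KS_entropy_le inv n0).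
by rewrite EFinB leeBlDr.
Qed.

Let free_energy_ge (P : probability S R) :
  (forall n w, fdist P (fun x => initial_word x n) w = \prod_i letter_weight k b (w i)) ->
  ((ln Zb)%:E <= free_energy (letter_potential k b) P)%E.
Proof.
move=> PE; have inv := bernoulli_invariant letter_weight_sum1 PE.
rewrite /free_energy integral_letter -leeBlDr//.
apply: le_trans (KS_entropy_ge P); rewrite lee_fin.
suff -> : limn (fun n => n%:R^-1 * fentropy P (fun x => initial_word x n)) =
  ln Zb - b * letter_mass P by [].
apply: cvg_lim => //; apply/cvgrPdist_le => e e0; near=> n.
have n0 : (0 < n)%N by near: n; exact: nbhs_infty_gt.
rewrite (_ : fentropy P _ = n%:R * (ln Zb - b * letter_mass P)).
  by rewrite mulKf ?subrr ?normr0 ?ltW// pnatr_eq0 -lt0n.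
rewrite -(cross_entropy n inv) /fentropy; congr (- _).
by apply: eq_bigr => w _; rewrite PE.
Unshelve. all: by end_near.
Qed.

Lemma dynamical_gibbs_cylinder n w :
  fdist (dynamical_gibbs (letter_potential k b)) (fun x : S => initial_word x n) w =
  \prod_i letter_weight k b (w i).
Proof.
have [P PE] := bernoulli_exists letter_weight_gt0 letter_weight_sum1.
have inv := bernoulli_invariant letter_weight_sum1 PE.
have pE : pressure (letter_potential k b) = (ln Zb)%:E.
  apply/eqP; rewrite eq_le; apply/andP; split.
    by apply: ge_ereal_sup => _ [mu imu <-]; exact: free_energy_le.
  apply: le_trans (free_energy_ge PE) _; apply: ereal_sup_ubound.
  by exists P.
(* The Bernoulli measure [P] shows that the choice made by [dynamical_gibbs] is among equilibrium
   states; all of these have the same cylinder masses. *)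
have : equilibrium_state (letter_potential k b) (dynamical_gibbs (letter_potential k b)).
  apply: (getPex (P := equilibrium_state (letter_potential k b))); exists P; split=> //.
  apply/eqP; rewrite eq_le pE free_energy_ge// andbT.
  exact: free_energy_le.
by case=> inv' e; apply: equilibrium_cylinder => //; rewrite e pE.
Qed.

End bernoulli_equilibrium.

(** * Weights of words *)

Section words.
Context {R : realType} {p : nat}.
Local Notation q := p.+1.
Local Notation word n := {ffun 'I_n -> 'I_p.+1}.
Local Notation occ := (@occ R p _).

Lemma sum_occ n (w : word n) (f : 'I_q -> R) : \sum_i f (w i) = \sum_k occ w k * f k.
Proof.
rewrite (eq_bigr (fun k => \sum_(i < n) (w i == k)%:R * f k)); last first.
  by move=> k _; rewrite /Defs.occ mulr_suml.
rewrite exchange_big/=; apply: eq_bigr => i _.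
rewrite (bigD1 (w i))//= eqxx mul1r big1 ?addr0// => k /negbTE.
by rewrite eq_sym => ->; rewrite mul0r.
Qed.

Lemma occ_total n (w : word n) : \sum_k occ w k = n%:R.
Proof.
have := sum_occ w (fun=> 1); rewrite sumr_const card_ord => ->.
by apply: eq_bigr => k _; rewrite mulr1.
Qed.

Lemma occ_ge0 n (w : word n) k : 0 <= occ w k.
Proof. by apply: sumr_ge0. Qed.

Lemma occ_nat n (w : word n) k : exists2 j : 'I_n.+1, occ w k = j%:R & True.
Proof.
have le : (\sum_(i < n) (w i == k) < n.+1)%N.
  rewrite ltnS -[leqRHS]card_ord -sum1_card; apply: leq_sum => i _.
  exact: leq_b1.
by exists (Ordinal le) => //=; rewrite /Defs.occ natr_sum.
Qed.

Lemma sum_words_expR n (x : 'I_q -> R) :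
  \sum_(w : word n) expR (\sum_k occ w k * x k) = (\sum_k expR (x k)) ^+ n.
Proof.
rewrite -[in RHS](card_ord n) -prodr_const.
rewrite (bigA_distr_bigA (fun (i : 'I_n) k => expR (x k))).
by apply: eq_bigr => w _; rewrite -sum_occ expR_sum.
Qed.

Definition cw_weight (t : R) n (w : word n) : R :=
  expR (t / (2 * n%:R) * \sum_k occ w k ^+ 2).

Definition freq n (w : word n) (k : 'I_q) : R := occ w k / n%:R.

Definition cw_free (t : R) (x : 'I_q -> R) : R :=
  t / 2 * (\sum_k x k ^+ 2) - ln (\sum_k expR (t * x k)).

Lemma sum_expR_gt0 (x : 'I_q -> R) : 0 < \sum_k expR (x k).
Proof.
by rewrite (bigD1 ord0)//= ltr_wpDr ?expR_gt0// sumr_ge0// => i _; exact: expR_ge0.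
Qed.

(** The exponent of [cw_weight] linearised at [n x]: a product weight over the letters, below
    [cw_weight] by convexity and equal to it at the frequencies of [w]. *)
Definition tilted (t : R) n (x : 'I_q -> R) (w : word n) : R :=
  expR (- (n%:R * t / 2 * \sum_k x k ^+ 2) + t * \sum_k occ w k * x k).

Lemma sum_tilted t n x :
  \sum_(w : word n) tilted t x w = expR (- n%:R * cw_free t x).
Proof.
rewrite (eq_bigr (fun w => expR (- (n%:R * t / 2 * \sum_k x k ^+ 2)) *
    expR (\sum_k occ w k * (t * x k)))); last first.
  move=> w _; rewrite /tilted -expRD [t * _]mulr_sumr; congr (expR (_ + _)).
  by apply: eq_bigr => k _; rewrite mulrCA.
rewrite -mulr_sumr sum_words_expR /cw_free mulrBr expRD.
congr (_ * _); first by congr expR; ring.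
by rewrite mulNr opprK expRM_natl lnK// posrE sum_expR_gt0.
Qed.

Lemma tilted_le t n x (w : word n) : 0 <= t -> (0 < n)%N -> tilted t x w <= cw_weight t w.
Proof.
move=> t0 n0; have n0' : n%:R != 0 :> R by rewrite pnatr_eq0 -lt0n.
have n1 : 0 < n%:R :> R by rewrite ltr0n.
rewrite ler_expR -subr_ge0 (_ : _ - _ =
  t / (2 * n%:R) * \sum_k (occ w k - n%:R * x k) ^+ 2).
  by rewrite mulr_ge0 ?divr_ge0 ?mulr_ge0 ?(ltW n1)// sumr_ge0// => k _; exact: sqr_ge0.
rewrite !mulr_sumr opprD opprK addrA -big_split -sumrB /=; apply: eq_bigr => k _.
by field.
Qed.

Lemma tilted_freq t n (w : word n) : (0 < n)%N -> tilted t (freq w) w = cw_weight t w.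
Proof.
move=> n0; have n0' : n%:R != 0 :> R by rewrite pnatr_eq0 -lt0n.
rewrite /tilted /cw_weight; congr expR.
rewrite !mulr_sumr -sumrN -big_split/=; apply: eq_bigr => k _.
by rewrite /freq; field.
Qed.

Lemma partition_ge t n x : 0 <= t -> (0 < n)%N ->
  expR (- n%:R * cw_free t x) <= \sum_(w : word n) cw_weight t w.
Proof.
move=> t0 n0; rewrite -sum_tilted; apply: ler_sum => w _; exact: tilted_le.
Qed.

(* Each weight is one of the [n.+1 ^ q] tilted product weights obtained from
   the points of the simplex with coordinates in [n^-1 Z]. *)
Lemma restricted_partition_le t n (B : pred (word n)) (g : R) : (0 < n)%N ->
  (forall w, B w -> g <= cw_free t (freq w)) ->
  \sum_(w | B w) cw_weight t w <= n.+1%:R ^+ q * expR (- n%:R * g).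
Proof.
move=> n0 Bg.
pose z (l : {ffun 'I_q -> 'I_n.+1}) k : R := (l k)%:R / n%:R.
apply: (@le_trans _ _ (\sum_(w : word n) \sum_(l | g <= cw_free t (z l)) tilted t (z l) w)).
  rewrite big_mkcond/=; apply: ler_sum => w _; case: ifPn => Bw; last first.
    by apply: sumr_ge0 => l _; exact: expR_ge0.
  pose l : {ffun 'I_q -> 'I_n.+1} := [ffun k => s2val (cid2 (occ_nat w k))].
  have zl : z l = freq w.
    by apply/funext => k; rewrite /z /freq ffunE; case: cid2 => j /= ->.
  rewrite (bigD1 l)/=; last by rewrite zl Bg.
  rewrite zl tilted_freq// lerDl sumr_ge0// => ? _; exact: expR_ge0.
rewrite exchange_big/=; apply: (@le_trans _ _
    (\sum_(l : {ffun 'I_q -> 'I_n.+1}) expR (- n%:R * g))); last first.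
  by rewrite sumr_const card_ffun !card_ord -[leLHS]mulr_natl natrX.
rewrite big_mkcond/=; apply: ler_sum => l _; case: ifPn => gl; last exact: expR_ge0.
by rewrite sum_tilted ler_expR !mulNr lerN2 ler_wpM2l.
Qed.

End words.

(** * Fluctuations of the chi-square statistic *)

(** The term of degree [m.+1] of the exponential series beats the polynomial; passing from [n] to
    [n.+1] in the exponent costs the factor [expR a] in [K]. *)
Lemma poly_expR_small {R : realType} (m : nat) (a theta : R) : 0 < a -> 0 < theta ->
  exists N, forall n, (N <= n)%N -> n.+1%:R ^+ m * expR (- (a * n%:R)) <= theta.
Proof.
move=> a0 th0.
pose K : R := (m.+1)`!%:R / a ^+ m.+1 * expR a.
have K0 : 0 < K by rewrite mulr_gt0 ?expR_gt0// divr_gt0 ?exprn_gt0// ltr0n fact_gt0.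
exists (Num.bound (K / theta)) => n nN.
have n1 : 0 < n.+1%:R :> R by [].
have h : a ^+ m.+1 * n.+1%:R ^+ m.+1 / (m.+1)`!%:R <= expR (a * n%:R) * expR a.
  rewrite -expRD -[X in _ + X]mulr1 -mulrDr natr1 -exprMn.
  apply: le_trans (expR_ge1Dxn m _); last by rewrite mulr_ge0 ?ltW.
  by rewrite lerDr.
rewrite expRN -/(_ / _) ler_pdivrMr ?expR_gt0//.
have hK : K <= theta * n.+1%:R.
  rewrite mulrC -ler_pdivrMr//; apply: le_trans (ltW (archi_boundP _)) _.
    by rewrite divr_ge0 ?ltW.
  by rewrite ler_nat; exact: leqW.
rewrite -(ler_pM2r n1) -exprSr.
have {}h : n.+1%:R ^+ m.+1 <= K * expR (a * n%:R).
  have c0 : 0 < a ^+ m.+1 / (m.+1)`!%:R by rewrite divr_gt0 ?exprn_gt0// ltr0n fact_gt0.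
  rewrite -(ler_pM2l c0) mulrAC; apply: le_trans h _.
  rewrite le_eqVlt; apply/orP; left; apply/eqP; rewrite /K; field.
  by rewrite !gt_eqF ?exprn_gt0// ltr0n fact_gt0.
by apply: le_trans h _; rewrite [leRHS]mulrAC ler_wpM2r// expR_ge0.
Qed.

Lemma expRN_taylor1 {R : realType} (u : R) :
  `|expR (- u) - 1 + u| <= u ^+ 2 * expR `|u|.
Proof.
have h1 := expR_ge1Dx (- u); have h2 := expR_ge1Dx u.
have e0 := expR_gt0 (- u); have ee : expR u * expR (- u) = 1 by rewrite -expRD subrr expR0.
have h3 : (1 + u) * expR (- u) <= 1.
  by rewrite -[leRHS]ee ler_wpM2r// ltW.
rewrite ger0_norm; last by lra.
apply: (@le_trans _ _ (u * (1 - expR (- u)))); first by lra.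
rewrite expr2 -mulrA; have [u0|u0] := leP 0 u.
  rewrite ler_wpM2l//; apply: (@le_trans _ _ u); first by lra.
  by rewrite ler_peMr// -expR0 ler_expR.
by rewrite ltr0_norm// ler_wnM2l ?(ltW u0)//; lra.
Qed.

Section fluctuations.
Context {R : realType} {p : nat}.
Local Notation q := p.+1.
Local Notation r := (p.+1%:R : R).
Local Notation word n := {ffun 'I_n -> 'I_p.+1}.
Local Notation occ := (@occ R p _).

Definition centered n (w : word n) (k : 'I_q) : R := occ w k - n%:R / r.

(** Pearson's statistic for equal letter probabilities, divided by [r]. *)
Definition chi2 n (w : word n) : R := (\sum_k centered w k ^+ 2) / n%:R.

Definition chi2_weight (t : R) n (w : word n) : R := expR (t / 2 * chi2 w).

Let r_gt0 : 0 < r. Proof. by []. Qed.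
Let r_neq0 : r != 0. Proof. by rewrite gt_eqF. Qed.
Let r1_neq0 : 1 + p%:R != 0 :> R. Proof. by rewrite nat1r. Qed.

Lemma centered_total n (w : word n) : \sum_k centered w k = 0.
Proof.
by rewrite sumrB occ_total sumr_const card_ord -[X in _ - X]mulr_natr divfK// subrr.
Qed.

Lemma chi2_ge0 n (w : word n) : 0 <= chi2 w.
Proof. by rewrite divr_ge0// sumr_ge0// => k _; exact: sqr_ge0. Qed.

Lemma chi2_weight_ge1 t n (w : word n) : 0 <= t -> 1 <= chi2_weight t w.
Proof. by move=> t0; rewrite -expR0 ler_expR mulr_ge0 ?chi2_ge0// divr_ge0. Qed.

Lemma cw_weight_chi2 t n (w : word n) : (0 < n)%N ->
  cw_weight t w = chi2_weight t w * expR (t * n%:R / (2 * r)).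
Proof.
move=> n0; have n0' : n%:R != 0 :> R by rewrite pnatr_eq0 -lt0n.
rewrite /cw_weight /chi2_weight -expRD; congr expR.
have -> : \sum_k occ w k ^+ 2 = \sum_k centered w k ^+ 2 + n%:R ^+ 2 / r.
  rewrite (eq_bigr (fun k => centered w k ^+ 2 + (2 * n%:R / r * centered w k +
      (n%:R / r) ^+ 2))); last by move=> k _; rewrite /centered; ring.
  rewrite !big_split/= -mulr_sumr centered_total mulr0 add0r; congr (_ + _).
  by rewrite sumr_const card_ord -[LHS]mulr_natr; field.
by rewrite /chi2; field; rewrite n0' r1_neq0.
Qed.

Definition resample n (w : word n) (i : 'I_n) (k : 'I_q) : word n :=
  [ffun j => if j == i then k else w j].

(** Exchanging the letter at [i] with the fresh letter [k] is an involution of the pairs, so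
    resampling preserves the uniform law on words. *)
Lemma sum_resample n (i : 'I_n) (h : word n -> R) :
  \sum_w \sum_k h (resample w i k) = r * \sum_w h w.
Proof.
pose s (wk : word n * 'I_q) := (resample wk.1 i wk.2, wk.1 i).
have sK : involutive s.
  move=> [w k]; rewrite /s /= ffunE eqxx; congr pair.
  by apply/ffunP => j; rewrite !ffunE; case: eqVneq => [->|].
rewrite pair_bigA/= (reindex_inj (inv_inj sK))/=.
rewrite (eq_bigr (fun wk => h wk.1)); last first.
  by move=> wk _; have := sK wk; rewrite /s /= => /(congr1 fst)/= ->.
rewrite -(pair_bigA _ (fun w k => h w))/= mulr_sumr; apply: eq_bigr => w _.
by rewrite sumr_const card_ord mulr_natl.
Qed.

(** The centering that makes the Stein sum vanish: [1 - c = r^-1] adds up to 1 over the letters and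
    cancels the sum [-1] of the [y_k]. It is also the mean of [chi2] over uniform words. *)
Let c : R := 1 - r^-1.

(* Given the other letters, the weights of the [q] choices of the letter at [i]
   are proportional to [exp (t y_k / n)], which the factor [exp (- t Y_k / n)]
   compensates since [Y_k = y_k + 1] for the chosen letter; the sum over [k] then
   vanishes as the [y_k] have sum [-1]. *)
Lemma stein_identity t n : (0 < n)%N ->
  \sum_(w : word n) chi2_weight t w *
    \sum_k occ w k * ((centered w k - c) * expR (- (t * (centered w k / n%:R)))) = 0.
Proof.
move=> n0; have n0' : n%:R != 0 :> R by rewrite pnatr_eq0 -lt0n.
under eq_bigr do rewrite -(sum_occ _ (fun k => (_ - _) * expR (- (t * (centered _ k / _))))) mulr_sumr.
rewrite exchange_big/= big1// => i _; apply/eqP.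
rewrite -(mulrI_eq0 _ (lregP r_neq0)) -(sum_resample i); apply/eqP/big1 => w _.
pose y l : R := \sum_(j < n | j != i) (w j == l)%:R - n%:R / r.
have yE k l : centered (resample w i k) l = y l + (k == l)%:R.
  rewrite /centered /Defs.occ (bigD1 i)//= ffunE eqxx -addrA [LHS]addrC.
  rewrite /y; congr (_ - _ + _); apply: eq_bigr => j /negbTE ji.
  by rewrite ffunE ji.
have y_total : \sum_l y l = -1.
  rewrite sumrB sumr_const card_ord -[X in _ - X]mulr_natr divfK// exchange_big/=.
  rewrite (eq_bigr (fun=> 1)); last first.
    move=> j _; rewrite (bigD1 (w j))//= eqxx big1 ?addr0// => l /negbTE.
    by rewrite eq_sym => ->.
  have := sumr_const 'I_n (1 : R); rewrite card_ord (bigD1 i)//= => <-.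
  by ring.
rewrite (eq_bigr (fun k => expR (t / (2 * n%:R) * (\sum_l y l ^+ 2 - 1)) *
    (y k + 1 - c))); last first.
  move=> k _; rewrite ffunE eqxx yE eqxx mulrCA mulrC /=; congr (_ * _).
  rewrite /chi2_weight -expRD; congr expR; rewrite /chi2.
  have -> : \sum_l centered (resample w i k) l ^+ 2 = \sum_l y l ^+ 2 + (2 * y k + 1).
    rewrite (eq_bigr (fun l => y l ^+ 2 + (k == l)%:R * (2 * y l + 1))); last first.
      by move=> l _; rewrite yE; case: (k == l) => /=; ring.
    rewrite big_split/= [X in _ + X](bigD1 k)//= eqxx mul1r [X in _ + (_ + X)]big1 ?addr0//.
    by move=> l /negbTE; rewrite eq_sym => ->; rewrite mul0r.
  by rewrite /=; field.
have e0 : \sum_k (y k + 1 - c) = 0.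
  rewrite (eq_bigr (fun k => y k + (1 - c))); last by move=> k _; rewrite addrA.
  rewrite big_split y_total sumr_const card_ord -[_ *+ _]mulr_natr /c subKr.
  by rewrite mulVf// -[LHS]/(-1 + 1) addNr.
by rewrite -mulr_sumr e0 mulr0.
Qed.

(** With [e = centered / n], the exponential is expanded to first order. Terms linear in [e] sum to
    0, the main terms give [(1 - t / r) chi2 - c], and what remains is of order [n |e|^3] or [e^2],
    hence at most a multiple of [eta (chi2 + 1)]. *)
Lemma stein_error t T n (w : word n) eta : (0 < n)%N -> 0 <= t <= T -> 0 <= eta <= 1 ->
  (forall k, `|centered w k| <= eta * n%:R) ->
  `|n%:R^-1 * (\sum_k occ w k *
      ((centered w k - c) * expR (- (t * (centered w k / n%:R)))))
    - ((1 - t / r) * chi2 w - c)| <= (T + T ^+ 2 * expR T) * r * eta * (chi2 w + 1).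
Proof.
move=> n0 /andP[t0 tT] /andP[eta0 eta1] wn.
have n1 : 0 < n%:R :> R by rewrite ltr0n.
have n0' : n%:R != 0 :> R by rewrite gt_eqF.
pose e k : R := centered w k / n%:R.
have eE k : centered w k = n%:R * e k by rewrite /e mulrC divfK.
have oE k : occ w k = n%:R * (r^-1 + e k).
  by rewrite /e /centered; field; rewrite r1_neq0 n0'.
have e_total : \sum_k e k = 0 by rewrite -mulr_suml centered_total mul0r.
have chi2E : chi2 w = \sum_k n%:R * e k ^+ 2.
  by rewrite /chi2 mulr_suml; apply: eq_bigr => k _; rewrite eE; field.
pose rho k := expR (- (t * e k)) - 1 + t * e k.
have -> : n%:R^-1 * (\sum_k occ w k *
      ((centered w k - c) * expR (- (t * (centered w k / n%:R)))))
    - ((1 - t / r) * chi2 w - c) =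
    \sum_k (- t * (n%:R * e k ^+ 3 - c * e k ^+ 2) +
      (r^-1 + e k) * (n%:R * e k - c) * rho k).
  have cE : c = \sum_(k < q) c / r.
    by rewrite sumr_const card_ord -[RHS]mulr_natr divfK.
  (* A multiple of the null sum of the [e k] is added so that the identity holds summand by
     summand. *)
  have -> : (1 - t / r) * chi2 w = (1 - t / r) * chi2 w +
     (n%:R / r - c + t * c / r) * \sum_k e k by rewrite e_total mulr0 addr0.
  rewrite [X in _ - (_ - X)]cE.
  rewrite chi2E !mulr_sumr -big_split/= -sumrB -sumrB; apply: eq_bigr => k _.
  rewrite -/(e k) oE eE /rho.
  set E := expR _; rewrite /c; field.
  by rewrite n0' r1_neq0.
have eb k : `|e k| <= eta by rewrite /e normrM normfV (gtr0_norm n1) ler_pdivrMr.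
have c01 : 0 <= c <= 1.
  have ri0 : 0 < r^-1 by rewrite invr_gt0.
  have ri1 : r^-1 <= 1 by rewrite invf_le1// ler1n.
  by rewrite /c subr_ge0 ri1 gerBl ltW.
have T0 : 0 <= T := le_trans t0 tT.
have o01 k : 0 <= r^-1 + e k <= 1.
  have -> : r^-1 + e k = occ w k / n%:R by rewrite oE mulrC mulKf.
  rewrite divr_ge0 ?occ_ge0 ?(ltW n1)//= ler_pdivrMr// mul1r -(occ_total w).
  by rewrite (bigD1 k)//= lerDl sumr_ge0// => l _; exact: occ_ge0.
have rb k : `|rho k| <= T ^+ 2 * expR T * e k ^+ 2.
  apply: le_trans (expRN_taylor1 _) _; rewrite exprMn mulrAC ler_wpM2r ?sqr_ge0//.
  rewrite ler_pM ?sqr_ge0 ?expR_ge0// ?lerXn2r ?nnegrE//.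
  rewrite ler_expR normrM (ger0_norm t0) -[leRHS]mulr1 ler_pM//.
  exact: le_trans (eb k) eta1.
pose D := T + T ^+ 2 * expR T.
have D0 : 0 <= D by rewrite addr_ge0// mulr_ge0 ?sqr_ge0 ?expR_ge0.
apply: (@le_trans _ _ (\sum_k D * (eta * (n%:R * e k ^+ 2) + eta))).
  apply: le_trans (ler_norm_sum _ _ _) _; apply: ler_sum => k _.
  have e2 : e k ^+ 2 <= eta.
    rewrite -real_normK ?num_real// expr2 -[leRHS]mulr1 ler_pM//.
    exact: le_trans (eb k) eta1.
  have ne2 : 0 <= n%:R * e k ^+ 2 by rewrite mulr_ge0 ?sqr_ge0 ?ltW.
  have ne3 : `|n%:R * e k ^+ 3| <= eta * (n%:R * e k ^+ 2).
    by rewrite exprS mulrCA normrM (ger0_norm ne2) ler_wpM2r.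
  apply: le_trans (ler_normD _ _) _; rewrite /D [leRHS]mulrDl; apply: lerD.
    rewrite normrM normrN (ger0_norm t0) ler_pM//.
    apply: le_trans (ler_normB _ _) _; apply: lerD => //.
    case/andP: c01 => c0 c1.
    rewrite normrM (ger0_norm c0) ger0_norm ?sqr_ge0//; apply: le_trans e2.
    by rewrite ler_piMl ?sqr_ge0.
  rewrite mulrAC normrM.
  apply: (@le_trans _ _ (T ^+ 2 * expR T * e k ^+ 2 * (n%:R * `|e k| + 1))).
    case/andP: (o01 k) => o0 o1.
    apply: ler_pM => //.
      rewrite normrM (ger0_norm o0); apply: le_trans (rb k).
      by rewrite ler_piMl.
    apply: le_trans (ler_normB _ _) _; rewrite normrM (gtr0_norm n1) lerD2l.
    by case/andP: c01 => c0 c1; rewrite ger0_norm.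
  rewrite -mulrA ler_wpM2l ?mulr_ge0 ?sqr_ge0 ?expR_ge0// mulrDr mulr1 lerD//.
  rewrite (_ : e k ^+ 2 * (n%:R * `|e k|) = `|e k| * (n%:R * e k ^+ 2)); last by ring.
  by rewrite ler_wpM2r.
rewrite -mulr_sumr big_split/= -mulr_sumr -chi2E sumr_const card_ord -[X in _ + X]mulr_natr.
apply: (@le_trans _ _ (D * (eta * r * (chi2 w + 1)))); last first.
  by rewrite (mulrC eta) !mulrA.
rewrite ler_wpM2l// mulrDr mulr1 lerD2r -mulrA ler_wpM2l//.
by rewrite ler_peMl ?chi2_ge0// ler1n.
Qed.

End fluctuations.

Lemma MVT_is_derive {R : realType} (f df : R -> R) (a b : R) : a < b ->
  (forall x, a <= x <= b -> is_derive x 1 f (df x)) ->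
  exists2 c, a < c < b & f b - f a = df c * (b - a).
Proof.
move=> ab fdf.
have [||c cab fE] := @MVT R f df a b ab.
- by move=> x; rewrite in_itv /= => /andP[ax xb]; apply: fdf; rewrite !ltW.
- apply: derivable_within_continuous => x; rewrite in_itv /= => /fdf h.
  exact: ex_derive.
- by exists c => //; move: cab; rewrite in_itv.
Qed.

Lemma is_derive_expR_scale {R : realType} (a t : R) :
  is_derive t 1 (fun s : R => expR (s * a)) (expR (t * a) * a).
Proof.
have h : is_derive t 1 (fun s : R => s * a) a.
  by apply: is_derive_eq; rewrite scaler0 add0r [LHS]mulr1.
exact: (@is_derive1_comp _ expR).
Qed.

Lemma is_derive_sum_finType {R : realType} (I : finType) (f df : I -> R -> R) (t : R) :
  (forall i, is_derive t 1 (f i) (df i t)) ->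
  is_derive t 1 (fun s => \sum_i f i s) (\sum_i df i t).
Proof.
move=> fdf; have -> : (fun s => \sum_i f i s) = \sum_i f i.
  by apply/funext => s; rewrite fct_sumE.
by elim/big_ind2 : _ => // [|] *; [exact: is_derive_cst|exact: is_deriveD].
Qed.

(** * Asymptotics of the exponential moments of the chi-square statistic *)

Section log_chi2_sum.
Context {R : realType} {p : nat}.
Local Notation q := p.+1.
Local Notation r := (@GRing.natmul R 1 p.+1).
Local Notation word n := {ffun 'I_n -> 'I_p.+1}.

Variable T0 : R.
Hypotheses (T0_ge0 : 0 <= T0) (T0_lt : T0 < r).
(** Equal frequencies minimise [cw_free T0] strictly and with a gap; this keeps atypical words
    negligible up to slightly beyond [T0]. It is established for the critical model by
    [critical_gap]. *)
Hypothesis free_gap : forall delta : R, 0 < delta -> exists2 g : R, 0 < g &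
  forall x : 'I_q -> R, (forall k, 0 <= x k) -> \sum_k x k = 1 ->
  (exists k, delta < `|x k - r^-1|) -> cw_free T0 (fun _ : 'I_q => r^-1) + g <= cw_free T0 x.

Definition chi2_sum n (t : R) : R := \sum_(w : word n) chi2_weight t w.

Let r_gt0 : 0 < r. Proof. by []. Qed.
Let r_ge1 : 1 <= r. Proof. by rewrite ler1n. Qed.

Let card_word n : #|{: word n}|%:R = r ^+ n.
Proof. by rewrite card_ffun !card_ord natrX. Qed.

Lemma chi2_sum_ge n t : 0 <= t -> r ^+ n <= chi2_sum n t.
Proof.
move=> t0; rewrite -card_word -sum1_card natr_sum; apply: ler_sum => w _.
exact: chi2_weight_ge1.
Qed.

Let chi2_sum_gt0 n t : 0 < chi2_sum n t.
Proof.
rewrite /chi2_sum (bigD1 [ffun=> ord0])//= ltr_wpDr ?expR_gt0//.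
by apply: sumr_ge0 => w _; exact: expR_ge0.
Qed.

Let centered_le n (w : word n) k : `|centered w k| <= n%:R :> R.
Proof.
have o0 := @occ_ge0 R p n w k; have on : occ w k <= n%:R :> R.
  by rewrite -(occ_total w) (bigD1 k)//= lerDl sumr_ge0// => l _; exact: occ_ge0.
have n0 : 0 <= n%:R / r by rewrite divr_ge0.
have nr : n%:R / r <= n%:R by rewrite ler_pdivrMr// ler_peMr.
rewrite ler_norml /centered; move: (n%:R / r) n0 nr => a a0 an.
by apply/andP; split; lra.
Qed.

Let chi2_le n (w : word n) : (0 < n)%N -> chi2 w <= n%:R * r.
Proof.
move=> n0; have n1 : 0 < n%:R :> R by rewrite ltr0n.
rewrite /chi2 ler_pdivrMr//; apply: (@le_trans _ _ (\sum_(k < q) n%:R ^+ 2)).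
  apply: ler_sum => k _; rewrite -real_normK ?num_real//.
  by rewrite lerXn2r ?nnegrE.
by rewrite sumr_const card_ord -[leLHS]mulr_natr expr2 mulrAC.
Qed.

Definition spread (delta : R) n (w : word n) : bool :=
  [exists k, delta * n%:R < `|centered w k|].

(** The factor [n.+1] anticipates the Stein error on a spread word, which is only bounded by a
    multiple of [n.+1]. *)
Lemma spread_small delta theta : 0 < delta -> 0 < theta ->
  exists2 e1, 0 < e1 & exists N, forall n t, (N <= n)%N -> 0 <= t <= T0 + e1 ->
  n.+1%:R * \sum_(w : word n | spread delta w) chi2_weight t w <= theta * chi2_sum n t.
Proof.
move=> d0 th0; have [g g0 gP] := free_gap d0.
(* As [chi2 w <= n r], exceeding [T0] by [g / r] adds at most [g n / 2] to the exponent, half of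
   what the gap provides. *)
exists (g / r); first by rewrite divr_gt0.
have g20 : 0 < g / 2 by rewrite divr_gt0.
have [N NP] := poly_expR_small q.+1 g20 th0.
exists N.+1 => n t Nn /andP[t0 tT].
have n0 : (0 < n)%N by exact: leq_trans Nn.
have n1 : 0 < n%:R :> R by rewrite ltr0n.
have uE : cw_free T0 (fun _ : 'I_q => r^-1) = - T0 / (2 * r) - ln r.
  rewrite /cw_free !sumr_const card_ord -[_ ^+ 2 *+ _]mulr_natr.
  rewrite -[expR _ *+ _]mulr_natr lnM ?posrE ?expR_gt0// expRK opprD addrA.
  by congr (_ - _); field; rewrite nat1r.
have bad : \sum_(w : word n | spread delta w) cw_weight T0 w <=
    n.+1%:R ^+ q * expR (- n%:R * (cw_free T0 (fun _ : 'I_q => r^-1) + g)).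
  apply: restricted_partition_le => // w /existsP[k wk]; apply: gP.
  - by move=> l; rewrite divr_ge0 ?occ_ge0.
  - by rewrite -mulr_suml occ_total divff// gt_eqF.
  - exists k; rewrite /freq (_ : _ - _ = centered w k / n%:R).
      by rewrite normrM normfV (gtr0_norm n1) ltr_pdivlMr.
    by rewrite /centered; field; rewrite nat1r gt_eqF// gt_eqF.
have {}bad : \sum_(w : word n | spread delta w) chi2_weight T0 w <=
    n.+1%:R ^+ q * expR (- (g * n%:R)) * r ^+ n.
  rewrite -(ler_pM2r (expR_gt0 (T0 * n%:R / (2 * r)))) mulr_suml.
  under eq_bigr do rewrite -cw_weight_chi2//.
  apply: le_trans bad _; rewrite uE -!mulrA ler_wpM2l ?exprn_ge0//.
  have -> : r ^+ n = expR (n%:R * ln r) by rewrite expRM_natl lnK.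
  rewrite -!expRD ler_expR.
  rewrite le_eqVlt; apply/orP; left; apply/eqP; field.
  by rewrite nat1r.
have weight_le (w : word n) : chi2_weight t w <= chi2_weight T0 w * expR (g / 2 * n%:R).
  rewrite -expRD ler_expR.
  have h1 : t / 2 * chi2 w <= (T0 + g / r) / 2 * chi2 w.
    by rewrite ler_wpM2r ?chi2_ge0// ler_pdivrMr// divfK.
  apply: le_trans h1 _; rewrite mulrDl mulrDl lerD2l.
  have h2 : g / r / 2 * chi2 w <= g / r / 2 * (n%:R * r).
    by rewrite ler_wpM2l ?chi2_le// !divr_ge0// ltW.
  apply: le_trans h2 _; rewrite le_eqVlt; apply/orP; left; apply/eqP; field.
  by rewrite nat1r.
apply: (@le_trans _ _ (theta * r ^+ n)); last first.
  by rewrite ler_wpM2l ?chi2_sum_ge// ltW.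
apply: (@le_trans _ _ (n.+1%:R * (n.+1%:R ^+ q * expR (- (g * n%:R)) * r ^+ n *
    expR (g / 2 * n%:R)))).
  rewrite ler_wpM2l//; apply: (@le_trans _ _
    ((\sum_(w : word n | spread delta w) chi2_weight T0 w) * expR (g / 2 * n%:R))).
    by rewrite mulr_suml; apply: ler_sum.
  by rewrite ler_wpM2r ?expR_ge0.
have -> : n.+1%:R * (n.+1%:R ^+ q * expR (- (g * n%:R)) * r ^+ n * expR (g / 2 * n%:R)) =
    n.+1%:R ^+ q.+1 * expR (- (g / 2 * n%:R)) * r ^+ n.
  have -> : - (g / 2 * n%:R) = - (g * n%:R) + g / 2 * n%:R by field.
  rewrite expRD [in RHS]exprS; ring.
by rewrite ler_wpM2r ?exprn_ge0// NP// ltnW.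
Qed.

Let c : R := 1 - r^-1.

(** Averaging [stein_error] against the weights, where the Stein identity removes the main sum,
    leaves [(1 - t / r) E - c] small for the mean [E] of [chi2]: words that are not spread give an
    error [k' (E + 1)], the spread ones [k']. *)
Lemma chi2_mean_lim eps : 0 < eps ->
  exists2 e1, 0 < e1 & exists N, forall n t, (N <= n)%N -> 0 <= t <= T0 + e1 ->
  t < r /\
  `|\sum_(w : word n) chi2 w * chi2_weight t w - c / (1 - t / r) * chi2_sum n t| <=
    eps * chi2_sum n t.
Proof.
move=> eps0; have [T0r T00] := (T0_lt, T0_ge0); pose T := (T0 + r) / 2.
have Tr : T < r by rewrite /T; lra.
have T0T : T0 < T by rewrite /T; lra.
have Tge0 : 0 <= T by rewrite /T; lra.
pose kappa := 1 - T / r.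
have k0 : 0 < kappa by rewrite subr_gt0 ltr_pdivrMr// mul1r.
have k1 : kappa <= 1 by rewrite gerBl divr_ge0.
pose C := (T + T ^+ 2 * expR T) * r + 1.
have C1 : 1 <= C.
  by rewrite lerDr mulr_ge0// addr_ge0// mulr_ge0 ?sqr_ge0 ?expR_ge0.
have C0 : 0 < C by lra.
(* The first bound lets the term [k' E] be absorbed to control [E]; the second makes the final
   error, at most [k' (6 / kappa)], smaller than [eps kappa]. *)
pose k' := Num.min (kappa / 2) (kappa ^+ 2 * eps / 6).
have k'0 : 0 < k'.
  by rewrite lt_min; apply/andP; split; rewrite divr_gt0// mulr_gt0// exprn_gt0.
have k'1 : k' <= kappa / 2 by rewrite ge_min lexx.
have k'2 : k' <= kappa ^+ 2 * eps / 6 by rewrite ge_min lexx orbT.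
pose delta := k' / C.
have d0 : 0 < delta by rewrite divr_gt0.
have d1 : delta <= 1 by rewrite ler_pdivrMr// mul1r; lra.
pose theta := k' / (C * r).
have th0 : 0 < theta by rewrite divr_gt0// mulr_gt0.
have [e1 e10 [N NP]] := spread_small d0 th0.
exists (Num.min e1 (T - T0)); first by rewrite lt_min e10 subr_gt0.
exists N.+1 => n t Nn /andP[t0 tm].
have te1 : t <= T0 + e1 by apply: le_trans tm _; rewrite lerD2l ge_min lexx.
have tT : t <= T.
  by apply: le_trans tm _; rewrite -lerBrDl ge_min lexx orbT.
split; first exact: le_lt_trans tT Tr.
have n0 : (0 < n)%N by exact: leq_trans Nn.
have n1 : 0 < n%:R :> R by rewrite ltr0n.
set F := chi2_sum n t; have F0 : 0 < F := chi2_sum_gt0 n t.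
pose E := (\sum_(w : word n) chi2 w * chi2_weight t w) / F.
have E0 : 0 <= E.
  by rewrite divr_ge0 ?(ltW F0)// sumr_ge0// => w _; rewrite mulr_ge0 ?chi2_ge0 ?expR_ge0.
have EF : \sum_(w : word n) chi2 w * chi2_weight t w = E * F by rewrite /E divfK// gt_eqF.
have t01 : kappa <= 1 - t / r by rewrite lerD2l lerN2 ler_pM2r ?invr_gt0.
pose st (w : word n) : R := n%:R^-1 * \sum_k occ w k *
  ((centered w k - c) * expR (- (t * (centered w k / n%:R)))).
have st0 : \sum_(w : word n) chi2_weight t w * st w = 0.
  have := stein_identity (R := R) (p := p) t n0.
  move=> /(congr1 ( *%R n%:R^-1)); rewrite mulr0 mulr_sumr; apply: etrans.
  by apply: eq_bigr => w _; rewrite /st mulrCA.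
have main : `|((1 - t / r) * E - c) * F| <= (k' * (E + 1) + k') * F.
  have -> : ((1 - t / r) * E - c) * F =
      - \sum_(w : word n) chi2_weight t w * (st w - ((1 - t / r) * chi2 w - c)).
    under eq_bigr do rewrite mulrBr.
    rewrite sumrB st0 sub0r opprK mulrBl -mulrA -EF mulr_sumr [c * _]mulr_sumr -sumrB.
    by apply: eq_bigr => w _; ring.
  rewrite normrN; apply: le_trans (ler_norm_sum _ _ _) _.
  have errn (w : word n) eta : 0 <= eta <= 1 -> (forall k, `|centered w k| <= eta * n%:R) ->
      `|st w - ((1 - t / r) * chi2 w - c)| <= C * eta * (chi2 w + 1).
    move=> eta01 wn; have tT' : 0 <= t <= T by rewrite t0.
    apply: le_trans (stein_error n0 tT' eta01 wn) _.
    have [eta0 _] := andP eta01.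
    rewrite ler_wpM2r ?addr_ge0 ?chi2_ge0// ler_wpM2r// lerDl//.
  apply: (@le_trans _ _ (\sum_(w : word n) (chi2_weight t w * (k' * (chi2 w + 1)) +
      (if spread delta w then C * r * n.+1%:R * chi2_weight t w else 0)))).
    apply: ler_sum => w _; have w0 := expR_ge0 (t / 2 * chi2 w).
    rewrite normrM (ger0_norm w0); case: ifPn => wd; last first.
      rewrite addr0 ler_wpM2l//.
      apply: le_trans (errn w delta _ _) _; first by rewrite (ltW d0).
        move=> k; rewrite leNgt; apply: contra wd => wk.
        by apply/existsP; exists k.
      by rewrite /delta mulrCA divff ?mulr1// gt_eqF.
    apply: (@le_trans _ _ (chi2_weight t w * (C * r * n.+1%:R))); last first.
      by rewrite [leRHS]addrC [C * r * _ * _]mulrC lerDl !mulr_ge0 ?addr_ge0 ?chi2_ge0// ltW.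
    rewrite ler_wpM2l//; apply: le_trans (errn w 1 _ _) _.
    - by rewrite ler01 lexx.
    - by move=> k; rewrite mul1r.
    - rewrite mulr1 -mulrA ler_wpM2l ?(ltW C0)//.
      have := chi2_le w n0; rewrite -natr1 mulrDr mulr1 [r * _]mulrC => h.
      exact: lerD.
  rewrite big_split/= -big_mkcond/= -mulr_sumr [leRHS]mulrDl; apply: lerD.
    rewrite (eq_bigr (fun w => k' * (chi2 w * chi2_weight t w + chi2_weight t w))); last first.
      by move=> w _; ring.
    by rewrite -mulr_sumr big_split/= EF -/(chi2_sum n t) -/F -mulrA mulrDl mul1r.
  rewrite -mulrA; have h := NP n t (ltnW Nn) _.
  apply: le_trans (ler_wpM2l _ (h _)) _; first by rewrite mulr_ge0// ltW.
    by rewrite t0.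
  by rewrite /theta mulrA [_ * (k' / _)]mulrCA divff ?mulr1// gt_eqF// mulr_gt0.
rewrite normrM (gtr0_norm F0) ler_pM2r// in main.
have c1 : c <= 1 by rewrite gerBl invr_ge0 ltW.
(* A priori bound: [kappa E <= 1 + k' (E + 2)] with [k' <= kappa / 2] and [kappa <= 1]. *)
have E4 : E <= 4 / kappa.
  rewrite ler_pdivlMr//.
  have h1 : kappa * E <= (1 - t / r) * E by rewrite ler_wpM2r.
  have h2 : k' * E <= kappa / 2 * E by rewrite ler_wpM2r.
  have main3 : (1 - t / r) * E <= c + (k' * (E + 1) + k').
    by rewrite -lerBlDl; apply: le_trans main; exact: ler_norm.
  have main4 : kappa * E <= 1 + (k' * (E + 1) + k').
    by apply: le_trans h1 (le_trans main3 _); rewrite lerD2r.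
  have aux (a b e : R) : b * e <= a / 2 * e -> a * e <= 1 + (b * (e + 1) + b) ->
    a <= 1 -> b <= a / 2 -> e * a <= 4 by lra.
  exact: (aux _ _ _ h2 main4 k1 k'1).
have k'E : k' * (E + 1) + k' <= k' * (6 / kappa).
  rewrite -[X in _ + X]mulr1 -mulrDr ler_wpM2l ?(ltW k'0)//.
  have : 1 <= kappa^-1 by rewrite invf_ge1.
  by move: E4; move: (kappa^-1) => a; lra.
have t0r : 0 < 1 - t / r by exact: lt_le_trans t01.
rewrite EF -mulrBl normrM (gtr0_norm F0) ler_pM2r//.
have -> : E - c / (1 - t / r) = ((1 - t / r) * E - c) / (1 - t / r).
  have aux (a b d : R) : d != 0 -> a - b / d = (d * a - b) / d by move=> ?; field.
  by apply: aux; rewrite gt_eqF.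
rewrite normrM normfV (gtr0_norm t0r) ler_pdivrMr//.
apply: le_trans main _; apply: le_trans k'E _.
apply: (@le_trans _ _ (eps * kappa)); last by rewrite ler_wpM2l ?(ltW eps0).
rewrite mulrA ler_pdivrMr//; move: k'2; rewrite expr2; lra.
Qed.

Lemma is_derive_chi2_sum n (t : R) : is_derive t 1 (chi2_sum n)
  ((\sum_(w : word n) chi2 w * chi2_weight t w) / 2).
Proof.
have -> : chi2_sum n = (fun s => \sum_(w : word n) expR (s * (chi2 w / 2))).
  apply/funext => s; apply: eq_bigr => w _.
  by rewrite /chi2_weight mulrA mulrAC.
have h := @is_derive_sum_finType R (word n) (fun w s => expR (s * (chi2 w / 2)))
  (fun w s => expR (s * (chi2 w / 2)) * (chi2 w / 2)) t
  (fun w => is_derive_expR_scale (chi2 w / 2) t).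
apply: (is_derive_eq h); rewrite mulr_suml; apply: eq_bigr => w _.
by rewrite /chi2_weight (_ : t / 2 * chi2 w = t * (chi2 w / 2)); ring.
Qed.

(** The quantity is [f t - f 0], and [f'] is half the difference between the mean of [chi2] and its
    limit [c / (1 - t / r)], which is small uniformly on the interval; at 0 all the weights are
    1. *)
Lemma ln_chi2_sum_lim eps : 0 < eps ->
  exists2 e1, 0 < e1 & exists N, forall n t, (N <= n)%N -> 0 <= t <= T0 + e1 ->
  t < r /\ `|ln (chi2_sum n t / r ^+ n) + (r - 1) / 2 * ln (1 - t / r)| <= eps.
Proof.
move=> eps0; have er0 : 0 < eps / r by rewrite divr_gt0.
have [e1 e10 [N NP]] := chi2_mean_lim er0; exists e1 => //; exists N => n t Nn t01.
have [tr _] := NP n t Nn t01; split=> //.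
pose f s := ln (chi2_sum n s) + (r - 1) / 2 * ln (1 - s / r).
pose df s := (\sum_(w : word n) chi2 w * chi2_weight s w) / 2 / chi2_sum n s -
  (r - 1) / 2 * (r^-1 / (1 - s / r)).
have fdf s : s < r -> is_derive s 1 f (df s).
  move=> sr; have s0 : 0 < 1 - s / r by rewrite subr_gt0 ltr_pdivrMr// mul1r.
  have h1 : is_derive s 1 (fun u => ln (chi2_sum n u))
      ((chi2_sum n s)^-1 * ((\sum_(w : word n) chi2 w * chi2_weight s w) / 2)).
    have d1 := is_derive1_ln (chi2_sum_gt0 n s).
    have d2 := is_derive_chi2_sum n s.
    exact: (@is_derive1_comp _ (@ln R)).
  have h2 : is_derive s 1 (fun u : R => 1 - u / r) (- r^-1).
    by apply: is_derive_eq; rewrite /GRing.scale /=; ring.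
  have h3 : is_derive s 1 (fun u => ln (1 - u / r)) ((1 - s / r)^-1 * - r^-1).
    have d1 := is_derive1_ln s0.
    exact: (@is_derive1_comp _ (@ln R) (fun u => 1 - u / r)).
  apply: is_derive_eq; rewrite /df /GRing.scale /=; ring.
have f0 : f 0 = ln (r ^+ n).
  rewrite /f mul0r subr0 ln1 mulr0 addr0; congr ln.
  rewrite /chi2_sum -card_word -sum1_card natr_sum; apply: eq_bigr => w _.
  by rewrite /chi2_weight !mul0r expR0.
have -> : ln (chi2_sum n t / r ^+ n) + (r - 1) / 2 * ln (1 - t / r) = f t - f 0.
  by rewrite f0 ln_div ?posrE ?exprn_gt0// /f addrAC.
have [t0 tT] := andP t01.
have [<-|t_neq0] := eqVneq 0 t; first by rewrite subrr normr0 ltW.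
have tgt0 : 0 < t by rewrite lt_neqAle t_neq0.
have [|s /andP[s0 st] ->] := @MVT_is_derive R f df 0 t tgt0.
  by move=> s /andP[s0 st]; apply: fdf; exact: le_lt_trans st tr.
have sr : s < r by exact: lt_trans st tr.
have [|_ sP] := NP n s Nn; first by rewrite (ltW s0) (ltW (lt_le_trans st tT)).
rewrite subr0 normrM (gtr0_norm tgt0).
have dfs : `|df s| <= eps / r / 2.
  have -> : df s = (\sum_(w : word n) chi2 w * chi2_weight s w -
      c / (1 - s / r) * chi2_sum n s) / (2 * chi2_sum n s).
    have aux (a F d x : R) : F != 0 -> d != 0 -> x != 0 ->
      a / 2 / F - (x - 1) / 2 * (x^-1 / d) = (a - (1 - x^-1) / d * F) / (2 * F).
      by move=> F0 d0 x0; field; rewrite F0 d0 x0.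
    by apply: aux; rewrite ?gt_eqF// subr_gt0 ltr_pdivrMr// mul1r.
  rewrite normrM normfV [`|2 * _|]gtr0_norm ?mulr_gt0// ler_pdivrMr ?mulr_gt0//.
  by apply: le_trans sP _; rewrite mulrA divfK.
apply: (@le_trans _ _ (eps / r / 2 * t)); first by rewrite ler_wpM2r.
apply: (@le_trans _ _ (eps / r / 2 * r)).
  by apply: ler_wpM2l; [rewrite !divr_ge0// ltW|exact: ltW].
have -> : eps / r / 2 * r = eps / 2 by field; rewrite nat1r.
by lra.
Qed.

End log_chi2_sum.

(** * Minimisers of the free energy *)

Section free_energy_minimisers.
Context {R : realType} {p : nat}.
Local Notation q := p.+1.
Local Notation r := (@GRing.natmul R 1 p.+1).
Implicit Types (x y z : 'I_q -> R) (b : R).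

Definition simplex x := (forall k, 0 <= x k) /\ \sum_k x k = 1.

Definition sqdist x y : R := \sum_k (x k - y k) ^+ 2.

Lemma sqdist_ge0 x y : 0 <= sqdist x y.
Proof. by apply: sumr_ge0 => k _; exact: sqr_ge0. Qed.

Lemma sqdist_eq0 x y : sqdist x y = 0 -> x = y.
Proof.
move=> /psumr_eq0P h; apply/funext => k; apply/eqP; rewrite -subr_eq0 -sqrf_eq0.
by apply/eqP/h => // j _; exact: sqr_ge0.
Qed.

(** The large deviation functional, negative entropy plus energy. Unlike [cw_free] it is affine in
    [b], and its values on spikes are explicit. *)
Definition cw_entropic (b : R) x : R := \sum_k x k * ln (x k) - b / 2 * \sum_k x k ^+ 2.

Definition softmax (b : R) x (k : 'I_q) : R := expR (b * x k) / \sum_l expR (b * x l).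

Lemma softmax_gt0 b x k : 0 < softmax b x k.
Proof. by rewrite divr_gt0 ?expR_gt0 ?sum_expR_gt0. Qed.

Lemma softmax_sum1 b x : \sum_k softmax b x k = 1.
Proof. by rewrite -mulr_suml mulfV// gt_eqF// sum_expR_gt0. Qed.

Lemma ln_softmax b x k : ln (softmax b x k) = b * x k - ln (\sum_l expR (b * x l)).
Proof. by rewrite ln_div ?posrE ?expR_gt0 ?sum_expR_gt0// expRK. Qed.

Lemma simplex_softmax b x : simplex (softmax b x).
Proof. by split=> [k|]; [exact/ltW/softmax_gt0|exact: softmax_sum1]. Qed.

(** Together with [free_le_entropic] this shows that [softmax] lowers [cw_free] by at least [b / 2]
    times the squared displacement, so a minimiser does not move. *)
Lemma entropic_softmax b x :
  cw_entropic b (softmax b x) = cw_free b x - b / 2 * sqdist x (softmax b x).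
Proof.
rewrite /cw_entropic /cw_free; set y := softmax b x; set L := ln _.
rewrite (eq_bigr (fun k => b * x k * y k - L * y k)); last first.
  by move=> k _; rewrite ln_softmax mulrC mulrBl.
rewrite sumrB -[\sum_k L * y k]mulr_sumr softmax_sum1 mulr1.
rewrite [RHS]addrAC [LHS]addrAC; congr (_ - _).
rewrite /sqdist !mulr_sumr -!sumrB; apply: eq_bigr => k _.
by rewrite -/y; field.
Qed.

(** The Gibbs inequality between [y] and [softmax b y]. *)
Lemma free_le_entropic b y : simplex y -> cw_free b y <= cw_entropic b y.
Proof.
move=> [y0 y1].
have := gibbs_ineq y0 (fun k => ltW (softmax_gt0 b y k))
  (fun k _ => softmax_gt0 b y k) y1.
rewrite softmax_sum1 lexx => /(_ isT); rewrite lerN2.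
rewrite [leLHS](eq_bigr (fun k => b * y k ^+ 2 - ln (\sum_l expR (b * y l)) * y k)); last first.
  by move=> k _; rewrite ln_softmax; ring.
rewrite sumrB -!mulr_sumr y1 mulr1 /cw_entropic /cw_free; lra.
Qed.

Definition minimiser b x := simplex x /\ forall y, simplex y -> cw_free b x <= cw_free b y.

(** Row vectors carry the topology in which the simplex is compact. *)
Let rv (v : 'rV[R]_q) : 'I_q -> R := fun k => v ord0 k.

Let rvK x : rv (\row_k x k) = x.
Proof. by apply/funext => k; rewrite /rv mxE. Qed.

Let continuous_sum (T : topologicalType) (f : 'I_q -> T -> R) :
  (forall k, continuous (f k)) -> continuous (fun v => \sum_k f k v).
Proof.
by move=> cf v; apply: cvg_big => [|k _]; [exact: add_continuous|exact: cf].
Qed.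

Let continuous_coord k : continuous (fun v : 'rV[R]_q => rv v k).
Proof. exact: coord_continuous. Qed.

Let continuous_sqr (T : topologicalType) (f : T -> R) :
  continuous f -> continuous (fun v => f v ^+ 2).
Proof.
move=> cf v; have -> : (fun v => f v ^+ 2) = (fun v => f v * f v).
  by apply/funext => u; rewrite expr2.
exact: (cvgM (cf v) (cf v)).
Qed.

Let continuous_free b : continuous (fun v : 'rV[R]_q => cw_free b (rv v)).
Proof.
move=> v.
have h0 : {for v, continuous (fun v : 'rV[R]_q => \sum_k rv v k ^+ 2)}.
  apply: (continuous_sum (f := fun k (v : 'rV[R]_q) => rv v k ^+ 2)) => k.
  exact: (continuous_sqr (@continuous_coord k)).
have h1 : {for v, continuous (fun v : 'rV[R]_q => b / 2 * \sum_k rv v k ^+ 2)}.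
  exact: (cvgM (cvg_cst (b / 2)) h0).
have h2 : {for v, continuous (fun v : 'rV[R]_q => \sum_k expR (b * rv v k))}.
  apply: (continuous_sum (f := fun k (v : 'rV[R]_q) => expR (b * rv v k))) => k u.
  apply: (@continuous_comp _ _ _ (fun v : 'rV[R]_q => b * rv v k) expR); last exact: continuous_expR.
  exact: (cvgM (cvg_cst b) (@continuous_coord k u)).
have h3 : {for v, continuous (fun v : 'rV[R]_q => ln (\sum_k expR (b * rv v k)))}.
  apply: (@continuous_comp _ _ _ (fun v : 'rV[R]_q => \sum_k expR (b * rv v k)) (@ln R)) => //.
  exact/continuous_ln/sum_expR_gt0.
exact: (cvgB h1 h3).
Qed.

Let closed_simplex : closed [set v : 'rV[R]_q | simplex (rv v)].
Proof.
rewrite (_ : [set _ | _] = (\bigcap_(k in [set: 'I_q]) [set v : 'rV[R]_q | 0 <= rv v k]) `&`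
    [set v | \sum_k rv v k = 1]); last first.
  by apply/seteqP; split=> v /= [v0 v1]; split=> // k; [move=> _|]; exact: v0.
apply: closedI; first apply: closed_bigI => k _.
  apply: (preimage_closed (f := fun v : 'rV[R]_q => rv v k)) (@closed_ge R 0).
  by move=> v _; exact: continuous_coord.
apply: (preimage_closed (f := fun v : 'rV[R]_q => \sum_k rv v k)) (@closed_eq R 1).
by move=> v _; apply: continuous_sum => k; exact: continuous_coord.
Qed.

Let closed_min (A : set 'rV[R]_q) b : A !=set0 -> closed A ->
  A `<=` [set v | simplex (rv v)] ->
  exists2 v, A v & forall w, A w -> cw_free b (rv v) <= cw_free b (rv w).
Proof.
move=> A0 cA As.
have [|||v vA vP] := @EVT_min_rV R q (fun v => cw_free b (rv v)) A => //.
- have cI : compact [set v : 'rV[R]_q | forall i, v ord0 i \in `[(0 : R), 1]].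
    apply: (@rV_compact _ _ (fun=> `[(0 : R), 1]%classic)) => _.
    exact: segment_compact.
  apply: (subclosed_compact cA cI) => v Av /= k; have [v0 v1] := As _ Av.
  rewrite in_itv /= [0 <= _]v0 -v1 (bigD1 k)//= lerDl.
  by apply: sumr_ge0 => l _; exact: v0.
- by apply: continuous_subspaceT; exact: continuous_free.
- by exists v; [rewrite inE in vA|move=> w Aw; apply: vP; rewrite inE].
Qed.

Definition barycentre : 'I_q -> R := fun=> r^-1.

Lemma simplex_barycentre : simplex barycentre.
Proof.
split=> [k|]; first by rewrite /barycentre invr_ge0.
by rewrite sumr_const card_ord -[LHS]mulr_natr mulVf.
Qed.

Lemma minimiser_exists b : exists x, minimiser b x.
Proof.
have [|||v vs vP] := @closed_min [set v | simplex (rv v)] b => //.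
  by exists (\row_k barycentre k); rewrite /= rvK; exact: simplex_barycentre.
by exists (rv v); split=> // y sy; rewrite -(rvK y); apply: vP; rewrite /= rvK.
Qed.

(** On the closed part of the simplex away from the points [z i], the continuous [cw_free] attains
    its minimum, which exceeds [m] because no minimiser lies there; if that part is empty any gap
    will do. *)
Lemma free_gap b (J : finType) (z : J -> 'I_q -> R) m eta : 0 < eta ->
  (forall x, simplex x -> m <= cw_free b x) ->
  (forall x, simplex x -> cw_free b x = m -> exists i, x = z i) ->
  exists2 g, 0 < g & forall x, simplex x -> (forall i, eta <= sqdist x (z i)) ->
    m + g <= cw_free b x.
Proof.
move=> eta0 mP zP.
pose A := [set v | simplex (rv v)] `&`
  \bigcap_(i in [set: J]) [set v : 'rV[R]_q | eta <= sqdist (rv v) (z i)].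
have cA : closed A.
  apply: closedI => //; apply: closed_bigI => i _.
  apply: (preimage_closed (f := fun v : 'rV[R]_q => sqdist (rv v) (z i))) (@closed_ge R eta).
  move=> v _.
  apply: (continuous_sum (f := fun k (v : 'rV[R]_q) => (rv v k - z i k) ^+ 2)) => k.
  apply: (continuous_sqr (f := fun v : 'rV[R]_q => rv v k - z i k)) => {}v.
  exact: (cvgB (@continuous_coord k v) (cvg_cst (z i k))).
have [A0|/nonemptyPn A0] := pselect (A !=set0); last first.
  exists 1 => // x sx xz; have : A (\row_k x k) by split=> [|i _]; rewrite /= rvK.
  by rewrite A0.
have [v Av vP] := closed_min b A0 cA (@subIsetl _ _ _).
have [sv vz] := Av; exists (cw_free b (rv v) - m).
  rewrite subr_gt0 lt_neqAle mP// andbT; apply/negP => /eqP/esym/(zP _ sv)[i vi].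
  have := vz i I; rewrite /= vi /sqdist big1 ?leNgt ?eta0// => k _.
  by rewrite subrr expr0n.
move=> x sx xz; rewrite addrC subrK -(rvK x); apply: vP.
by split=> [|i _]; rewrite /= rvK.
Qed.

(** Minimality extends to all of [R^q], since [softmax] brings any point into the simplex without
    raising [cw_free]. Test points may thus have negative coordinates. *)
Lemma minimiser_le b x z : 0 < b -> minimiser b x -> cw_free b x <= cw_free b z.
Proof.
move=> b0 [_ xP]; apply: le_trans (xP _ (simplex_softmax b z)) _.
apply: le_trans (free_le_entropic b (simplex_softmax b z)) _.
by rewrite entropic_softmax gerBl mulr_ge0 ?sqdist_ge0// divr_ge0// ltW.
Qed.

Lemma minimiser_softmax b x : 0 < b -> minimiser b x -> x = softmax b x.
Proof.
move=> b0 [sx xP]; apply: sqdist_eq0.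
have h := le_trans (xP _ (simplex_softmax b x)) (free_le_entropic b (simplex_softmax b x)).
rewrite entropic_softmax in h; have := sqdist_ge0 x (softmax b x).
rewrite le_eqVlt => /predU1P[//|d0].
by move: h; rewrite leNgt gtrBl mulr_gt0// divr_gt0.
Qed.

Lemma minimiser_entropic b x : 0 < b -> minimiser b x -> cw_entropic b x = cw_free b x.
Proof.
move=> b0 mx; have e := minimiser_softmax b0 mx.
rewrite {1}e entropic_softmax -e /sqdist big1 ?mulr0 ?subr0// => k _.
by rewrite subrr expr0n.
Qed.

Lemma minimiser_gt0 b x k : 0 < b -> minimiser b x -> 0 < x k.
Proof. by move=> b0 /(minimiser_softmax b0) ->; exact: softmax_gt0. Qed.

Lemma minimiser_ln b x i j : 0 < b -> minimiser b x ->
  ln (x i) - ln (x j) = b * (x i - x j).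
Proof.
move=> b0 mx; rewrite {1 2}(minimiser_softmax b0 mx) !ln_softmax; ring.
Qed.

(* [ln t - b t] takes the same value at all coordinates, so that two different
   coordinates lie on both sides of its maximum [b^-1]. *)
Lemma minimiser_lt b x i j : 0 < b -> minimiser b x -> x i < x j ->
  b * x i < 1 < b * x j.
Proof.
move=> b0 mx xij.
have aux k l : x k != x l -> b * (x l - x k) < (x l - x k) / x k.
  move=> kl; have xk := minimiser_gt0 k b0 mx; have xl := minimiser_gt0 l b0 mx.
  rewrite -(minimiser_ln l k b0 mx) -ln_div ?posrE// mulrBl divff ?gt_eqF//.
  apply: ln_lt_subr1; rewrite ?divr_gt0//; apply: contra kl => /eqP e.
  by rewrite -[x l](divfK (lt0r_neq0 xk)) e mul1r.
have xi := minimiser_gt0 i b0 mx; have xj := minimiser_gt0 j b0 mx.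
have d0 : 0 < x j - x i by rewrite subr_gt0.
have := aux i j; have := aux j i; rewrite gt_eqF// lt_eqF//.
move=> /(_ isT) h1 /(_ isT) h2; apply/andP; split.
  by move: h2; rewrite ltr_pdivlMr// mulrAC -[ltRHS]mul1r ltr_pM2r.
move: h1; rewrite -[x i - x j]opprB mulrN mulNr ltrN2 ltr_pdivrMr//.
by rewrite mulrAC -[ltLHS]mul1r ltr_pM2r.
Qed.

Lemma expR_cosh (v : R) :
  expR v + expR (- v) - 2 = (expR (v / 2) - expR (- (v / 2))) ^+ 2.
Proof.
have e1 : expR v = expR (v / 2) ^+ 2 by rewrite -expRM_natl mulrC divfK.
have e2 : expR (- v) = expR (- (v / 2)) ^+ 2 by rewrite -expRM_natl mulrN mulrC divfK.
have e3 : expR (v / 2) * expR (- (v / 2)) = 1 by rewrite -expRD subrr expR0.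
by rewrite e1 e2 sqrrB e3; ring.
Qed.

Lemma expR_sub_gt (v : R) : 0 < v -> 2 * v < expR v - expR (- v).
Proof.
move=> v0.
pose f (u : R) := expR u - expR (- u) - 2 * u.
pose df (u : R) := expR u + expR (- u) - 2.
have fdf (u : R) : is_derive u 1 f (df u).
  have h : is_derive u 1 (fun u : R => expR (- u)) (- expR (- u)).
    have d1 := is_derive_expR (- u).
    have d2 : is_derive u 1 (fun u : R => - u) (-1).
      by apply: is_derive_eq.
    have := @is_derive1_comp _ expR (fun u => - u) u _ _ d1 d2.
    by rewrite mulrN1.
  by apply: is_derive_eq; rewrite /df /GRing.scale /=; ring.
have [c /andP[c0 _]] := @MVT_is_derive R f df 0 v v0 (fun u _ => fdf u).
rewrite {1}/f {1}/f oppr0 subrr mulr0 !subr0 => fE.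
rewrite -subr_gt0 fE mulr_gt0 ?addr0// /df.
by rewrite expR_cosh exprn_gt0// subr_gt0 ltr_expR; lra.
Qed.

Lemma expR_cosh_ge (v : R) : 0 <= v -> v ^+ 2 <= expR v + expR (- v) - 2.
Proof.
move=> v0; have v20 : 0 <= v / 2 by rewrite divr_ge0.
have h : 2 * (v / 2) <= expR (v / 2) - expR (- (v / 2)).
  have := v20; rewrite le_eqVlt => /predU1P[<-|/expR_sub_gt/ltW//].
  by rewrite oppr0 subrr mulr0.
rewrite expR_cosh.
by rewrite lerXn2r ?nnegrE//; move: h; lra.
Qed.

(** If two equal coordinates exceeded [b^-1], moving them apart by [tau] would lower [cw_free]: the
    quadratic term gains [u], the logarithm gains more. *)
Lemma minimiser_uniq b x i j : 0 < b -> minimiser b x -> i != j -> x i = x j ->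
  b * x i <= 1.
Proof.
move=> b0 mx ij xij; rewrite leNgt; apply/negP => ba.
set a := x i in xij ba; have a0 : 0 < a := minimiser_gt0 i b0 mx.
have ab0 : 0 < b * a by exact: mulr_gt0.
(* The gain suffices if [expR u < 1 + a b u]. As [expR u <= (1 - u)^-1], this follows from
   [a b u < a b - 1]; [u] is half of the largest such value. *)
pose u := (b * a - 1) / (2 * (b * a)).
have u0 : 0 < u by rewrite divr_gt0 ?subr_gt0// mulr_gt0.
have u2 : 2 * (b * a) * u = b * a - 1 by rewrite /u mulrC divfK// gt_eqF// mulr_gt0.
have u1 : u < 1.
  by rewrite ltr_pdivrMr ?mulr_gt0// mul1r; lra.
pose tau := Num.sqrt (u / b).
have tau2 : tau ^+ 2 = u / b by rewrite sqr_sqrtr// divr_ge0// ltW.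
pose z k := x k + (k == i)%:R * tau - (k == j)%:R * tau.
have ji : j != i by rewrite eq_sym.
have zi : z i = a + tau by rewrite /z eqxx (negbTE ij) mul1r mul0r subr0.
have zj : z j = a - tau by rewrite /z eqxx (negbTE ji) mul1r mul0r addr0 -xij.
have zk k : k != i -> k != j -> z k = x k.
  by move=> /negbTE ki /negbTE kj; rewrite /z ki kj !mul0r addr0 subr0.
have split2 (F : 'I_q -> R) : \sum_k F k = F i + (F j + \sum_(k | (k != i) && (k != j)) F k).
  by rewrite (bigD1 i)//= (bigD1 j)//=.
have := minimiser_le z b0 mx; apply/negP; rewrite -ltNge.
have S0 := sum_expR_gt0 (fun k => b * x k); have Sz := sum_expR_gt0 (fun k => b * z k).
set S := \sum_k expR (b * x k) in S0.
have aE : expR (b * a) = a * S.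
  have -> : a * S = softmax b x i * S by rewrite -(minimiser_softmax b0 mx).
  by rewrite /softmax divfK// gt_eqF.
have SzE : \sum_k expR (b * z k) = S * (1 + a * (expR (b * tau) + expR (- (b * tau)) - 2)).
  rewrite split2 zi zj mulrDr mulrBr !expRD aE.
  rewrite (eq_bigr (fun k => expR (b * x k))); last first.
    by move=> k /andP[ki kj]; rewrite zk.
  have := split2 (fun k => expR (b * x k)); rewrite -/S -/a -xij aE => SE.
  move: SE; set W := \sum_(k | _) _ => SE.
  have -> : W = S - a * S - a * S by rewrite {1}SE; ring.
  by ring.
have QE : \sum_k z k ^+ 2 = \sum_k x k ^+ 2 + 2 * (u / b).
  rewrite split2 [in RHS]split2 zi zj (eq_bigr (fun k => x k ^+ 2)); last first.
    by move=> k /andP[ki kj]; rewrite zk.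
  by rewrite -/a -xij -tau2; ring.
have cosh : u * b <= expR (b * tau) + expR (- (b * tau)) - 2.
  have -> : u * b = (b * tau) ^+ 2.
    by rewrite exprMn tau2; field; rewrite gt_eqF.
  by apply: expR_cosh_ge; rewrite mulr_ge0 ?sqrtr_ge0// ltW.
have pos : 0 < 1 + a * (expR (b * tau) + expR (- (b * tau)) - 2).
  by rewrite ltr_pwDl// mulr_ge0 ?(ltW a0)//; apply: le_trans cosh; rewrite mulr_ge0 ?(ltW u0) ?(ltW b0).
rewrite /cw_free QE SzE lnM ?posrE//.
rewrite -/S mulrDr (_ : b / 2 * (2 * (u / b)) = u); last by field; rewrite gt_eqF.
suff : u < ln (1 + a * (expR (b * tau) + expR (- (b * tau)) - 2)) by lra.
rewrite -ltr_expR lnK ?posrE//.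
apply: (@lt_le_trans _ _ (1 + a * (u * b))); last by rewrite lerD2l ler_wpM2l// ltW.
have e1 := expR_ge1Dx (- u); have e2 : expR u * expR (- u) = 1 by rewrite -expRD subrr expR0.
have h1 : expR u * (1 - u) <= 1 by rewrite -[leRHS]e2 ler_wpM2l ?expR_ge0.
have h2 : 1 < (1 + a * (u * b)) * (1 - u).
  rewrite (_ : _ * _ = 1 + u * (b * a - 1 - b * a * u)); last by ring.
  by rewrite ltrDl mulr_gt0//; move: u2 ba; move: (b * a * u) (b * a) => ? ?; lra.
rewrite -(ltr_pM2r (_ : 0 < 1 - u)) ?subr_gt0//.
exact: le_lt_trans h1 h2.
Qed.

End free_energy_minimisers.

(** * Spikes, their energy, and the equation for the height *)

Section spikes.
Context {R : realType} {p : nat}.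
Hypothesis p_gt1 : (1 < p)%N.
Local Notation q := p.+1.
Local Notation P := (@GRing.natmul R 1 p).
Implicit Types (x : 'I_q -> R) (a b m s : R).

Let P_gt1 : 1 < P. Proof. by rewrite ltr1n. Qed.
Let P_gt0 : 0 < P. Proof. exact: lt_trans ltr01 P_gt1. Qed.
Let P_neq0 : P != 0. Proof. by rewrite gt_eqF. Qed.

Definition spike (i : 'I_q) a (k : 'I_q) : R := if k == i then a else (1 - a) / P.

Lemma sum_spike (F : R -> R) i a :
  \sum_k F (spike i a k) = F a + P * F ((1 - a) / P).
Proof.
rewrite (bigD1 i)//= /spike eqxx; congr (_ + _).
rewrite (eq_bigr (fun=> F ((1 - a) / P))); last by move=> k /negbTE ->.
rewrite sumr_const (_ : #|_| = p) -?[LHS]mulr_natl//.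
by have := cardC1 i; rewrite card_ord.
Qed.

Lemma simplex_spike i a : 0 <= a <= 1 -> simplex (spike i a).
Proof.
move=> /andP[a0 a1]; split=> [k|].
  by rewrite /spike; case: ifP => // _; rewrite divr_ge0 ?subr_ge0// ltW.
by rewrite (sum_spike id) mulrC divfK// addrC subrK.
Qed.

(** Take [i] of maximal coordinate. If two other coordinates differed, the larger would exceed
    [b^-1]; it would then contradict [minimiser_uniq] if it equals the maximum, and [minimiser_lt]
    if it is below. *)
Lemma minimiser_spike b x : 0 < b -> minimiser b x ->
  exists i, x = spike i (x i) /\ forall k, x k <= x i.
Proof.
move=> b0 mx.
have [i xi] : exists i, forall k, x k <= x i.
  case: (@arg_maxP _ _ _ ord0 predT x isT) => i _ xi.
  by exists i => k; exact: xi.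
exists i; split=> //.
have xlt k l : k != i -> l != i -> ~ x k < x l.
  move=> ki li kl; have /andP[_ l1] := minimiser_lt b0 mx kl.
  have := xi l; rewrite le_eqVlt => /predU1P[li'|lti].
    by have := minimiser_uniq b0 mx li li'; rewrite leNgt l1.
  by have /andP[+ _] := minimiser_lt b0 mx lti; rewrite ltNge (ltW l1).
have xeq k l : k != i -> l != i -> x k = x l.
  by move=> ki li; case: (ltgtP (x k) (x l)) => // h; exfalso;
    [exact: (xlt k l)|exact: (xlt l k)].
apply/funext => k; rewrite /spike; case: eqVneq => [->//|ki].
have [_ x1] := mx.1; rewrite (bigD1 i)//= (eq_bigr (fun=> x k)) in x1; last first.
  by move=> l li; exact: xeq.
have -> : 1 - x i = x k *+ p.
  rewrite -[X in X - _]x1 addrAC subrr add0r sumr_const; congr (_ *+ _).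
  by have := cardC1 i; rewrite card_ord.
by rewrite -[_ *+ _]mulr_natr mulfK.
Qed.

Definition spike_energy b a : R :=
  a * ln a + (1 - a) * (ln (1 - a) - ln P) - b / 2 * (a ^+ 2 + (1 - a) ^+ 2 / P).

Lemma entropic_spike b i a : 0 <= a < 1 ->
  cw_entropic b (spike i a) = spike_energy b a.
Proof.
move=> /andP[a0 a1]; rewrite /cw_entropic (sum_spike (fun u => u * ln u)).
rewrite (sum_spike (fun u => u ^+ 2)) ln_div ?posrE ?subr_gt0// /spike_energy.
by field.
Qed.

Lemma barycentreE i : barycentre = spike i (q%:R^-1).
Proof.
apply/funext => k; rewrite /spike /barycentre; case: ifP => // _.
by rewrite -[q%:R]natr1; field; rewrite P_neq0 natr1 pnatr_eq0.
Qed.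

Let bc : R := beta_c q.
Let L : R := ln P.

Let L_gt0 : 0 < L. Proof. exact: ln_gt0. Qed.

Let bcE : bc = 2 * P * L / (P - 1).
Proof.
have e1 : q%:R - 1 = P by rewrite -[q%:R]natr1 addrK.
have e2 : q%:R - 2 = P - 1 by rewrite -[q%:R]natr1; ring.
by rewrite /bc /beta_c e1 e2.
Qed.

Lemma beta_c_gt0 : 0 < bc.
Proof. by rewrite bcE divr_gt0 ?subr_gt0// !mulr_gt0. Qed.

(** Equivalent to [2 v < expR v - expR (- v)] at [v = ln P]. *)
Lemma beta_c_lt : bc < q%:R.
Proof.
have := expR_sub_gt L_gt0; rewrite expRN /L lnK ?posrE// -/L => h.
rewrite bcE ltr_pdivrMr ?subr_gt0// -[q%:R]natr1.
have -> : (P + 1) * (P - 1) = P * (P - P^-1) by field.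
by rewrite [2 * _]mulrC -mulrA ltr_pM2l.
Qed.

(** Measures the failure of the symmetry [a -> 1 - a] of the spike energy; its zero is [bc]. *)
Let drift b : R := (P - 1) / (2 * P) * (bc - b).

Let driftE b : drift b = L - b * (P - 1) / (2 * P).
Proof. by rewrite /drift bcE; field; rewrite P_neq0 subr_eq0 gt_eqF. Qed.

Lemma spike_energy_reflect b a :
  spike_energy b (1 - a) - spike_energy b a = (1 - 2 * a) * drift b.
Proof. by rewrite driftE /spike_energy subKr /L; field. Qed.

(** This is [2 artanh m]. With [m = 2 a - 1], stationarity of the spike of height [a] reads
    [logit m = slope b * m - drift b]. *)
Let logit m : R := ln (1 + m) - ln (1 - m).
Let slope b : R := b * (P + 1) / (2 * P).

Let is_derive_ln1D m : 0 < 1 + m -> is_derive m 1 (fun u : R => ln (1 + u)) (1 + m)^-1.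
Proof.
move=> mp; have d1 := is_derive1_ln mp.
have d2 : is_derive m 1 (fun u : R => 1 + u) 1.
  by apply: is_derive_eq; rewrite /GRing.scale /=; ring.
by have := @is_derive1_comp _ (@ln R) (fun u => 1 + u) m _ _ d1 d2; rewrite mulr1.
Qed.

Let is_derive_ln1B m : 0 < 1 - m -> is_derive m 1 (fun u : R => ln (1 - u)) (- (1 - m)^-1).
Proof.
move=> mn; have d1 := is_derive1_ln mn.
have d2 : is_derive m 1 (fun u : R => 1 - u) (-1).
  by apply: is_derive_eq; rewrite /GRing.scale /=; ring.
by have := @is_derive1_comp _ (@ln R) (fun u => 1 - u) m _ _ d1 d2; rewrite mulrN1.
Qed.

Let is_derive_logit m : -1 < m < 1 -> is_derive m 1 logit ((1 + m)^-1 + (1 - m)^-1).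
Proof.
move=> /andP[m0 m1]; have mp : 0 < 1 + m by lra.
have mn : 0 < 1 - m by lra.
have h1 := is_derive_ln1D mp; have h2 := is_derive_ln1B mn.
by apply: is_derive_eq; rewrite opprK.
Qed.

(** [logit] is strictly convex on [[0, 1[] and vanishes at 0, so its chords from the origin
    steepen. *)
Lemma logit_slope_lt m1 m2 : 0 < m1 -> m1 < m2 -> m2 < 1 ->
  logit m1 / m1 < logit m2 / m2.
Proof.
move=> m10 m12 m21.
have dl u : 0 <= u <= m2 -> is_derive u 1 logit ((1 + u)^-1 + (1 - u)^-1).
  by move=> /andP[u0 u1]; apply: is_derive_logit; apply/andP; split; lra.
have [c1 /andP[c10 c11] e1] := @MVT_is_derive R logit _ 0 m1 m10
  (fun u h => dl u (introT andP (conj (proj1 (andP h)) (le_trans (proj2 (andP h)) (ltW m12))))).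
have [c2 /andP[c20 c21] e2] := @MVT_is_derive R logit _ m1 m2 m12
  (fun u h => dl u (introT andP (conj (le_trans (ltW m10) (proj1 (andP h))) (proj2 (andP h))))).
have l0 : logit 0 = 0 by rewrite /logit addr0 subr0 subrr.
have inv c : 0 < c -> c < m2 -> (1 + c)^-1 + (1 - c)^-1 = 2 / (1 - c ^+ 2).
  by move=> c0 cm; field; rewrite !gt_eqF//; nra.
rewrite inv// in e2; last exact: lt_trans m10 c20.
rewrite inv// in e1; last exact: lt_trans m12.
rewrite l0 !subr0 in e1.
have lt : 2 / (1 - c1 ^+ 2) < 2 / (1 - c2 ^+ 2).
  by rewrite ltr_pM2l// ltf_pV2 ?posrE; nra.
have m20 : 0 < m2 by exact: lt_trans m12.
rewrite ltr_pdivlMr// e1 mulfK ?gt_eqF//.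
have -> : logit m2 = 2 / (1 - c2 ^+ 2) * (m2 - m1) + 2 / (1 - c1 ^+ 2) * m1.
  by rewrite -e2 -e1 subrK.
by move: lt; move: (2 / _) (2 / _) => u v uv; nra.
Qed.

(** Dividing by [m], the left side [logit m / m] increases strictly while [slope b - drift b / m]
    does not increase, as [drift b <= 0]. *)
Lemma spike_solution_uniq b m1 m2 : bc <= b -> 0 < m1 < 1 -> 0 < m2 < 1 ->
  logit m1 = slope b * m1 - drift b -> logit m2 = slope b * m2 - drift b -> m1 = m2.
Proof.
move=> bcb; have d0 : drift b <= 0.
  rewrite /drift mulr_ge0_le0 ?subr_le0//.
  by rewrite divr_ge0 ?subr_ge0 ?mulr_ge0// ltW.
wlog m12 : m1 m2 / m1 < m2.
  move=> wl h1 h2 e1 e2; case: (ltgtP m1 m2) => // h; first exact: wl.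
  by apply/esym/wl.
move=> /andP[m10 m11] /andP[m20 m21] e1 e2; exfalso.
have := logit_slope_lt m10 m12 m21; rewrite e1 e2 !mulrBl !mulfK ?gt_eqF//.
rewrite ltrD2l ltrN2 ltr_nM2l; last first.
  rewrite lt_neqAle d0 andbT; apply/negP => /eqP d00.
  move: (logit_slope_lt m10 m12 m21); rewrite e1 e2 d00 !subr0 !mulfK ?gt_eqF//.
  by rewrite ltxx.
by rewrite ltf_pV2 ?posrE// ltNge (ltW m12).
Qed.

Let spike_solution b a := 0 < a < 1 /\ ln a - ln ((1 - a) / P) = b * (a - (1 - a) / P).

Let spike_solution_logit b a : spike_solution b a ->
  logit (2 * a - 1) = slope b * (2 * a - 1) - drift b.
Proof.
move=> [/andP[a0 a1]]; rewrite ln_div ?posrE ?subr_gt0// -/L => e.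
rewrite /logit driftE /slope.
have -> : 1 + (2 * a - 1) = 2 * a by ring.
have -> : 1 - (2 * a - 1) = 2 * (1 - a) by ring.
rewrite !lnM ?posrE ?subr_gt0//.
have -> : ln a = b * (a - (1 - a) / P) + (ln (1 - a) - L) by rewrite -e; ring.
by field.
Qed.

Let minimiser_solution b i a : 0 < b -> minimiser b (spike i a) -> spike_solution b a.
Proof.
move=> b0 mx; have [j ji] : exists j : 'I_q, j != i.
  have [->|i0] := eqVneq i ord0; first by exists (Ordinal (leqW p_gt1)).
  by exists ord0; rewrite eq_sym.
have a0 := minimiser_gt0 i b0 mx; have a1 := minimiser_gt0 j b0 mx.
have := minimiser_ln i j b0 mx; move: a0 a1; rewrite /spike eqxx (negbTE ji) => a0 a1 e.
split=> //; rewrite a0 /=; move: a1.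
by rewrite pmulr_lgt0 ?invr_gt0// subr_gt0.
Qed.

(** [(1 + P s) / (P + 1)] inverts [a -> a - (1 - a) / P], which turns positive solutions of the
    equation for [s] into stationary heights. *)
Let solution_s b s : 0 < s -> s_solutions q b s ->
  spike_solution b ((1 + P * s) / (P + 1)).
Proof.
move=> s0; rewrite /s_solutions /= => e; set E := expR (b * s) in e.
have E0 : 0 < E := expR_gt0 _.
have EP : 0 < E + P by rewrite addr_gt0.
have qE : E + q%:R - 1 = E + P by rewrite -[q%:R]natr1; ring.
rewrite qE in e.
have e1 : s * (E + P) = E - 1 by rewrite [s in LHS]e divfK// gt_eqF.
have s1 : s < 1.
  by rewrite e ltr_pdivrMr// mul1r; move: P_gt0; lra.
have P1 : 0 < P + 1 by rewrite addr_gt0.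
have a1E : 1 - (1 + P * s) / (P + 1) = P * (1 - s) / (P + 1) by field; rewrite gt_eqF.
have a1E' : P * (1 - s) / (P + 1) / P = (1 - s) / (P + 1).
  by field; rewrite P_neq0 gt_eqF.
have Ps : 0 < 1 + P * s by rewrite addr_gt0// mulr_gt0.
have s1' : 0 < 1 - s by rewrite subr_gt0.
split.
  by rewrite divr_gt0//= -subr_gt0 a1E divr_gt0// mulr_gt0.
rewrite a1E a1E' !ln_div ?posrE//.
have ES : 1 + P * s = E * (1 - s) by move: e1; lra.
have -> : (1 + P * s) / (P + 1) - (1 - s) / (P + 1) = s by field; rewrite gt_eqF.
by rewrite ES lnM ?posrE// /E expRK; ring.
Qed.

Let spike_s a : R := a - (1 - a) / P.

Let spike_s_inj a1 a2 : spike_s a1 = spike_s a2 -> a1 = a2.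
Proof.
rewrite /spike_s => e; have P1 : P + 1 != 0 by rewrite gt_eqF// addr_gt0.
have aE a : a = (P * (a - (1 - a) / P) + 1) / (P + 1).
  by field; rewrite P_neq0 P1.
by rewrite (aE a1) (aE a2) e.
Qed.

Let minimiser_s b i a : 0 < b -> minimiser b (spike i a) ->
  s_solutions q b (spike_s a) /\ letter_weight i (b * spike_s a) = spike i a.
Proof.
move=> b0 /(minimiser_solution b0) [/andP[a0 a1] e].
have c0 : 0 < (1 - a) / P by rewrite divr_gt0 ?subr_gt0.
rewrite -/(spike_s a) in e.
have EE : expR (b * spike_s a) = a / ((1 - a) / P).
  by rewrite -e expRD expRN !lnK ?posrE.
have ac : a + P * ((1 - a) / P) = 1 by rewrite mulrC divfK// addrC subrK.
have EP : a / ((1 - a) / P) + P = ((1 - a) / P)^-1.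
  by field; rewrite P_neq0 subr_eq0 gt_eqF.
split.
  rewrite /s_solutions /= EE.
  have -> : a / ((1 - a) / P) + q%:R - 1 = a / ((1 - a) / P) + P.
    by rewrite -[q%:R]natr1; ring.
  rewrite EP invrK /spike_s; field.
  by rewrite P_neq0 subr_eq0 gt_eqF.
have ZE : \sum_(l < q) expR (b * spike_s a * (l == i)%:R) = ((1 - a) / P)^-1.
  rewrite (bigD1 i)//= eqxx mulr1 EE (eq_bigr (fun=> 1)); last first.
    by move=> l /negbTE ->; rewrite mulr0 expR0.
  rewrite sumr_const (_ : #|_| = p); last by have := cardC1 i; rewrite card_ord.
  exact: EP.
apply/funext => j; rewrite /letter_weight ZE invrK /spike.
case: eqVneq => [_|_]; last by rewrite mulr0 expR0 mul1r.
by rewrite mulr1 EE divfK// gt_eqF.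
Qed.

Let half_lt_logit a : 2^-1 < a < 1 -> 0 < 2 * a - 1 < 1.
Proof. by move=> /andP[a0 a1]; apply/andP; split; lra. Qed.

(** A larger solution would correspond to a stationary height above [a], itself above [1/2], against
    the uniqueness of such heights. *)
Lemma s_maximal b i a : bc <= b -> 2^-1 < a < 1 -> minimiser b (spike i a) ->
  s_ q b = spike_s a.
Proof.
move=> bcb a01 mx; have b0 : 0 < b by exact: lt_le_trans beta_c_gt0 bcb.
have [sa _] := minimiser_s b0 mx; have sol := minimiser_solution b0 mx.
have [a0 a1] := andP a01.
have sa0 : 0 < spike_s a.
  rewrite /spike_s subr_gt0 ltr_pdivrMr//; have := P_gt1; nra.
have ub : ubound (s_solutions q b) (spike_s a).
  move=> t ts; rewrite leNgt; apply/negP => st.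
  have P1 : 0 < P + 1 by rewrite addr_gt0.
  have solt := solution_s (lt_trans sa0 st) ts.
  set at_ := (1 + P * t) / (P + 1) in solt.
  have aat : a < at_.
    rewrite ltr_pdivlMr//; move: st; rewrite /spike_s -(ltr_pM2l P_gt0).
    by rewrite mulrBr [P * (_ / P)]mulrC divfK//; move: P_gt0; lra.
  have [/andP[_ at1] _] := solt.
  have := spike_solution_uniq bcb (half_lt_logit a01)
    (half_lt_logit (introT andP (conj (lt_trans a0 aat) at1)))
    (spike_solution_logit sol) (spike_solution_logit solt).
  by move: aat; lra.
rewrite /s_ ltNge bcb /=.
have [gs gub] : (s_solutions q b `&` ubound (s_solutions q b))
    (get (s_solutions q b `&` ubound (s_solutions q b))).
  by apply: getPex; exists (spike_s a).
by apply/eqP; rewrite eq_le ub// gub.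
Qed.

Let minimiser_range b i a : 0 < b -> minimiser b (spike i a) -> 0 <= a < 1.
Proof. by move=> b0 /(minimiser_solution b0)[/andP[/ltW -> ->]]. Qed.

Let minimiser_energy b i a x : 0 < b -> minimiser b (spike i a) -> simplex x ->
  spike_energy b a <= cw_entropic b x.
Proof.
move=> b0 mx sx; rewrite -(entropic_spike b i (minimiser_range b0 mx)).
rewrite (minimiser_entropic b0 mx).
exact: le_trans (mx.2 _ sx) (free_le_entropic b sx).
Qed.

(** Since [cw_free] is below [cw_entropic] and both agree at a minimiser, comparing spike energies
    suffices to recognise other minimisers. *)
Let energy_minimiser b i a j a' : 0 < b -> minimiser b (spike i a) -> 0 <= a' < 1 ->
  spike_energy b a' <= spike_energy b a -> minimiser b (spike j a').
Proof.
move=> b0 mx a'01 le; have sa' : simplex (spike j a').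
  by apply: simplex_spike; case/andP: a'01 => -> /ltW.
split=> // y sy; apply: le_trans (mx.2 _ sy).
rewrite -(minimiser_entropic b0 mx) (entropic_spike b i (minimiser_range b0 mx)).
by apply: le_trans le; rewrite -(entropic_spike b j a'01); exact: free_le_entropic.
Qed.

Let drift_bc : drift bc = 0. Proof. by rewrite /drift subrr mulr0. Qed.

(** The reflection [1 - q^-1] of the height of the barycentre. *)
Definition crit_height : R := P / (P + 1).

Let P1_gt0 : 0 < P + 1. Proof. by rewrite addr_gt0. Qed.

Lemma crit_height_itv : 2^-1 < crit_height < 1.
Proof.
have P1 := P_gt1; rewrite /crit_height ltr_pdivlMr// ltr_pdivrMr//.
by apply/andP; split; lra.
Qed.

Let crit_m : R := 2 * crit_height - 1.

Let crit_mE : crit_m = (P - 1) / (P + 1).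
Proof. by rewrite /crit_m /crit_height; field; rewrite gt_eqF. Qed.

Let crit_m_logit : logit crit_m = slope bc * crit_m.
Proof.
have PB : 0 < P - 1 by rewrite subr_gt0.
rewrite crit_mE /logit (_ : 1 + _ = P * (2 / (P + 1))); last by field; rewrite gt_eqF.
rewrite [1 - _](_ : _ = 2 / (P + 1)); last by field; rewrite gt_eqF.
rewrite lnM ?posrE ?divr_gt0// addrK -/L /slope bcE; field.
by rewrite P_neq0 !gt_eqF.
Qed.

(* For [m = 2 a - 1] the energy along a spike at the critical temperature is
   that of a two-letter Curie-Weiss model, up to a constant. *)
Let crit_energy_half : spike_energy bc crit_height < spike_energy bc 2^-1.
Proof.
pose psi (m : R) := (1 + m) / 2 * ln (1 + m) + (1 - m) / 2 * ln (1 - m) - slope bc / 4 * m ^+ 2.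
pose dpsi (m : R) := 2^-1 * (logit m - slope bc * m).
have psiE m : -1 < m < 1 -> spike_energy bc ((1 + m) / 2) =
    psi m + (- ln 2 - L / 2 - bc / 8 * (1 + P^-1)).
  move=> /andP[m0 m1]; have mp : 0 < 1 + m by lra.
  have mn : 0 < 1 - m by lra.
  rewrite /spike_energy /psi (_ : 1 - (1 + m) / 2 = (1 - m) / 2); last by field.
  rewrite !ln_div ?posrE// -/L /slope.
  have -> : bc = 2 * P * L / (P - 1) by exact: bcE.
  by field; rewrite P_neq0 subr_eq0 gt_eqF.
have /andP[c0 c1] := crit_height_itv.
have m0 : 0 < crit_m by rewrite /crit_m; lra.
have m1 : crit_m < 1 by rewrite /crit_m; lra.
have chE : crit_height = (1 + crit_m) / 2 by rewrite /crit_m; field.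
have hE : 2^-1 = (1 + 0) / 2 :> R by rewrite addr0 mul1r.
rewrite chE [X in _ < spike_energy _ X]hE !psiE ?ltrN10 ?ltr01//; last first.
  by rewrite m1 andbT; lra.
rewrite ltrD2r -subr_lt0.
have dpsiP (m : R) : 0 <= m <= crit_m -> is_derive m 1 psi (dpsi m).
  move=> /andP[h0 h1]; have mp : 0 < 1 + m by lra.
  have mn : 0 < 1 - m by lra.
  have d1 := is_derive_ln1D mp; have d2 := is_derive_ln1B mn.
  apply: is_derive_eq; rewrite /dpsi /logit /GRing.scale /=.
  by field; rewrite !gt_eqF.
have [c /andP[c0' c1'] ->] := MVT_is_derive m0 dpsiP.
rewrite subr0 pmulr_llt0// /dpsi pmulr_rlt0 ?invr_gt0// subr_lt0.
have := logit_slope_lt c0' c1' m1; rewrite crit_m_logit mulfK ?gt_eqF//.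
by rewrite ltr_pdivrMr.
Qed.

Let crit_big i a : 2^-1 < a -> minimiser bc (spike i a) -> a = crit_height.
Proof.
move=> a0 mx; have sol := minimiser_solution beta_c_gt0 mx.
have [/andP[_ a1] _] := sol.
have := spike_solution_uniq (lexx bc) (half_lt_logit (introT andP (conj a0 a1)))
  (half_lt_logit crit_height_itv) (spike_solution_logit sol) _.
by rewrite drift_bc subr0 crit_m_logit => /(_ erefl); lra.
Qed.

Let crit_reflect : spike_energy bc (q%:R^-1) = spike_energy bc crit_height.
Proof.
have := spike_energy_reflect bc crit_height; rewrite drift_bc mulr0.
rewrite (_ : 1 - crit_height = q%:R^-1); first by move/eqP; rewrite subr_eq0 => /eqP.
by rewrite /crit_height -[q%:R]natr1; field; rewrite gt_eqF.
Qed.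

(** Height [1/2] has too much energy, and above [1/2] the stationary height is unique. A height
    below [1/2] is brought above it by [a -> 1 - a], which preserves the energy at [bc]. *)
Let crit_cases i a : minimiser bc (spike i a) -> a = q%:R^-1 \/ a = crit_height.
Proof.
move=> mx; have [/andP[a0 a1] _] := minimiser_solution beta_c_gt0 mx.
case: (ltgtP a 2^-1) => ha; last first.
- exfalso; have /andP[h0 h1] := crit_height_itv.
  have sx : simplex (spike i crit_height) by apply: simplex_spike; apply/andP; split; lra.
  have := minimiser_energy beta_c_gt0 mx sx.
  rewrite entropic_spike; last by apply/andP; split; lra.
  by rewrite leNgt ha crit_energy_half.
- by right; exact: crit_big ha mx.
- left; have mx' : minimiser bc (spike i (1 - a)).
    apply: (energy_minimiser i beta_c_gt0 mx); first by apply/andP; split; lra.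
    have := spike_energy_reflect bc a; rewrite drift_bc mulr0 => /eqP.
    by rewrite subr_eq0 => /eqP ->.
  have : 1 - a = crit_height by apply: crit_big mx'; lra.
  move=> /(congr1 (fun u => 1 - u)); rewrite subKr => ->.
  by rewrite /crit_height -[q%:R]natr1; field; rewrite gt_eqF.
Qed.

Let crit_energy i a : minimiser bc (spike i a) ->
  spike_energy bc a = spike_energy bc crit_height.
Proof. by move=> /crit_cases[->|->//]; exact: crit_reflect. Qed.

Lemma critical_spike_minimiser i : minimiser bc (spike i crit_height).
Proof.
have [x mx] := @minimiser_exists R p bc.
have [j [e _]] := minimiser_spike beta_c_gt0 mx; rewrite e in mx.
apply: (energy_minimiser i beta_c_gt0 mx); last by rewrite (crit_energy mx).
by have /andP[? ?] := crit_height_itv; apply/andP; split; lra.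
Qed.

Lemma critical_barycentre_minimiser : minimiser bc (@barycentre R p).
Proof.
rewrite (barycentreE ord0).
apply: (energy_minimiser _ beta_c_gt0 (critical_spike_minimiser ord0)).
  by rewrite invr_ge0 ler0n/= invf_lt1// ltr1n ltnS ltnW.
by rewrite crit_reflect.
Qed.

Lemma critical_minimisers x : minimiser bc x ->
  x = barycentre \/ exists i, x = spike i crit_height.
Proof.
move=> mx; have [i [e _]] := minimiser_spike beta_c_gt0 mx; rewrite e in mx.
have [a0|a0] := crit_cases mx; last by right; exists i; rewrite e a0.
by left; rewrite e a0 -barycentreE.
Qed.

Lemma critical_spike_weight i : letter_weight i (bc * s_ q bc) = spike i crit_height.
Proof.
have mx := critical_spike_minimiser i.
by rewrite (s_maximal (lexx _) crit_height_itv mx); exact: (minimiser_s beta_c_gt0 mx).2.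
Qed.

(** For [b < bc] the entropic functional is the critical one plus a positive multiple of the squared
    norm. The barycentre minimises the first term, and the second strictly, so no analysis of the
    stationarity equation is made below [bc]. *)
Lemma subcritical_minimisers b x : 0 < b -> b < bc -> minimiser b x -> x = barycentre.
Proof.
move=> b0 bbc mx; apply: sqdist_eq0; apply/eqP; rewrite eq_le sqdist_ge0 andbT.
have JE y : cw_entropic b y = cw_entropic bc y + (bc - b) / 2 * \sum_k y k ^+ 2.
  by rewrite /cw_entropic; ring.
have sb := @simplex_barycentre R p.
have h1 : cw_entropic b x <= cw_entropic b (@barycentre R p).
  rewrite (minimiser_entropic b0 mx).
  exact: (le_trans (mx.2 _ sb) (free_le_entropic _ sb)).
have h2 : cw_entropic bc (@barycentre R p) <= cw_entropic bc x.
  have mb := critical_barycentre_minimiser.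
  rewrite (minimiser_entropic beta_c_gt0 mb).
  exact: (le_trans (mb.2 _ mx.1) (free_le_entropic _ mx.1)).
have h3 : \sum_k x k ^+ 2 <= \sum_k @barycentre R p k ^+ 2.
  have d0 : 0 < (bc - b) / 2 by rewrite divr_gt0// subr_gt0.
  rewrite -(ler_pM2l d0); move: h1 h2; rewrite !JE; lra.
have -> : sqdist x barycentre = \sum_k x k ^+ 2 - \sum_k @barycentre R p k ^+ 2.
  rewrite /sqdist /barycentre (eq_bigr (fun k => x k ^+ 2 +
    (q%:R^-1 ^+ 2 - 2 / q%:R * x k))); last by move=> k _; ring.
  have e : \sum_(k < q) 2 / q%:R * x k = 2 / q%:R by rewrite -mulr_sumr mx.1.2 mulr1.
  have e2 : \sum_(k < q) q%:R^-1 ^+ 2 = q%:R^-1 :> R.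
    by rewrite sumr_const card_ord -[LHS]mulr_natr expr2 mulfVK// pnatr_eq0.
  by rewrite big_split/= sumrB e e2; congr (_ + _); ring.
by rewrite subr_le0.
Qed.

(** Here [drift b < 0]: a spike lower than [1/2] loses to its reflection and height [1/2] is not
    stationary, so every minimiser is higher and its height is read off [s_]. *)
Lemma supercritical_minimisers b : bc < b -> exists2 a : R, 2^-1 < a < 1 &
  [/\ forall i, minimiser b (spike i a),
      forall x, minimiser b x -> exists i, x = spike i a &
      forall i, letter_weight i (b * s_ q b) = spike i a].
Proof.
move=> bcb; have b0 : 0 < b by exact: lt_trans beta_c_gt0 bcb.
have d0 : drift b < 0.
  rewrite /drift pmulr_rlt0 ?subr_lt0//.
  by rewrite divr_gt0 ?subr_gt0// mulr_gt0.
have big i a : minimiser b (spike i a) -> 2^-1 < a < 1.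
  move=> mx; have sol := minimiser_solution b0 mx; have [/andP[a0 a1] _] := sol.
  rewrite a1 andbT; case: (ltgtP a 2^-1) => // ha; exfalso; last first.
    have := spike_solution_logit sol.
    have -> : 2 * a - 1 = 0 by rewrite ha; field.
    by rewrite mulr0 sub0r /logit addr0 subr0 subrr => /eqP; rewrite eq_sym oppr_eq0 lt_eqF.
  have a'01 : 0 <= 1 - a < 1 by apply/andP; split; lra.
  have sx : simplex (spike i (1 - a)).
    by apply: simplex_spike; case/andP: a'01 => -> /ltW.
  have := minimiser_energy b0 mx sx; rewrite entropic_spike// -subr_ge0.
  by rewrite spike_energy_reflect leNgt pmulr_rlt0 ?d0//; lra.
have [x mx] := @minimiser_exists R p b.
have [i [e _]] := minimiser_spike b0 mx; rewrite e in mx.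
set a := x i in mx; have sE := s_maximal (ltW bcb) (big _ _ mx) mx.
exists a; first exact: big mx.
have all j : minimiser b (spike j a).
  by apply: (energy_minimiser j b0 mx) => //; exact: minimiser_range mx.
split=> // [y my|j]; last by rewrite sE; exact: (minimiser_s b0 (all j)).2.
have [j [ey _]] := minimiser_spike b0 my; exists j; rewrite ey; congr (spike j _).
apply: spike_s_inj; rewrite -sE; rewrite ey in my.
exact/esym/(s_maximal (ltW bcb) (big _ _ my) my).
Qed.

Lemma letter_weight0 (k : 'I_q) : @letter_weight R p k 0 = @barycentre R p.
Proof.
apply/funext => j; rewrite /letter_weight mul0r expR0.
rewrite (eq_bigr (fun=> 1 : R)); last by move=> l _; rewrite mul0r expR0.
by rewrite sumr_const card_ord mul1r.
Qed.

End spikes.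

(** * Exchangeability *)

Section gibbs_cylinders.
Context {R : realType} {p : nat}.
Local Notation q := p.+1.
Local Notation word n := {ffun 'I_n -> 'I_p.+1}.
Implicit Types (b : R).

Definition cw_partition b n : R := \sum_(w : word n) cw_weight b w.

Definition cw_mean b n (f : word n -> R) : R :=
  (\sum_w f w * cw_weight b w) / cw_partition b n.

Lemma cw_partition_gt0 b n : 0 < cw_partition b n.
Proof.
rewrite /cw_partition (bigD1 [ffun=> ord0])//= ltr_wpDr ?expR_gt0//.
by apply: sumr_ge0 => w _; exact: expR_ge0.
Qed.

Lemma cw_mean_le b n (f g : word n -> R) :
  (forall w, f w <= g w) -> cw_mean b f <= cw_mean b g.
Proof.
move=> fg; rewrite ler_pM2r ?invr_gt0 ?cw_partition_gt0//.
by apply: ler_sum => w _; rewrite ler_wpM2r ?expR_ge0.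
Qed.

Lemma cw_mean_cst b n c : cw_mean b (fun _ : word n => c) = c.
Proof. by rewrite /cw_mean -mulr_sumr mulfK// gt_eqF// cw_partition_gt0. Qed.

Lemma cw_meanD b n (f g : word n -> R) :
  cw_mean b (fun w => f w + g w) = cw_mean b f + cw_mean b g.
Proof.
rewrite /cw_mean -mulrDl -big_split/=; congr (_ / _).
by apply: eq_bigr => w _; rewrite mulrDl.
Qed.

Lemma cw_meanZl b n a (f : word n -> R) : cw_mean b (fun w => a * f w) = a * cw_mean b f.
Proof.
by rewrite /cw_mean mulrA mulr_sumr; congr (_ / _); apply: eq_bigr => w _; rewrite mulrA.
Qed.

Lemma cw_mean_sum (I : finType) b n (F : I -> word n -> R) :
  cw_mean b (fun w => \sum_i F i w) = \sum_i cw_mean b (F i).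
Proof.
rewrite /cw_mean -mulr_suml exchange_big/=; congr (_ / _).
by apply: eq_bigr => w _; rewrite mulr_suml.
Qed.

Lemma cw_mean_norm b n (f g : word n -> R) :
  (forall w, `|f w| <= g w) -> `|cw_mean b f| <= cw_mean b g.
Proof.
move=> fg; rewrite ler_norml -[X in X <= _]mulN1r -cw_meanZl.
apply/andP; split; apply: cw_mean_le => w; last exact: le_trans (ler_norm _) (fg w).
by rewrite mulN1r; have := fg w; rewrite ler_norml => /andP[].
Qed.

Lemma occ_permute n (s : {perm 'I_n}) (w : word n) :
  @occ R p n [ffun i => w (s i)] = occ w.
Proof.
apply/funext => k; rewrite /occ [RHS](reindex_inj (@perm_inj _ s)).
by apply: eq_bigr => i _; rewrite ffunE.
Qed.

Lemma occ_relabel n (s : {perm 'I_q}) (w : word n) k :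
  @occ R p n [ffun i => s (w i)] (s k) = occ w k.
Proof. by apply: eq_bigr => i _; rewrite ffunE (inj_eq perm_inj). Qed.

Lemma cw_mean_permute b n (s : {perm 'I_n}) (f : word n -> R) :
  cw_mean b (fun w : word n => f [ffun i => w (s i)]) = cw_mean b f.
Proof.
rewrite /cw_mean; congr (_ / _).
have hinj : injective (fun w : word n => [ffun i => w (s i)] : word n).
  move=> v w /ffunP vw; apply/ffunP => i.
  by have := vw ((s^-1)%g i); rewrite !ffunE permKV.
rewrite [RHS](reindex_inj hinj); apply: eq_bigr => w _.
by rewrite /cw_weight occ_permute.
Qed.

Lemma cw_mean_relabel b n (s : {perm 'I_q}) (f : word n -> R) :
  cw_mean b (fun w : word n => f [ffun i => s (w i)]) = cw_mean b f.
Proof.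
rewrite /cw_mean; congr (_ / _).
have hinj : injective (fun w : word n => [ffun i => s (w i)] : word n).
  move=> v w /ffunP vw; apply/ffunP => i.
  by have := vw i; rewrite !ffunE => /perm_inj.
rewrite [RHS](reindex_inj hinj); apply: eq_bigr => w _.
rewrite /cw_weight; congr (_ * expR (_ * _)).
rewrite [RHS](reindex_inj (@perm_inj _ s)); apply: eq_bigr => k _.
by rewrite occ_relabel.
Qed.

Lemma gibbs_energy b n (w : word n) : expR (- b * hamiltonian w) = cw_weight b w.
Proof.
have -> : hamiltonian w = - ((2 * n%:R)^-1 * \sum_k @occ R p n w k ^+ 2).
  rewrite /hamiltonian; congr (- (_ * _)).
  rewrite (eq_bigr (fun i => occ w (w i))) // (sum_occ w (fun k => occ w k)).
  by apply: eq_bigr => k _; rewrite expr2.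
by rewrite /cw_weight mulrNN mulrA.
Qed.

Lemma gibbs_densityE b n (x : Sigma R p) :
  gibbs_density n b x = q%:R ^+ n * (cw_weight b (initial_word x n) / cw_partition b n).
Proof.
by rewrite /gibbs_density gibbs_energy /partition_function invfM invrK mulrCA.
Qed.

Lemma prob_gibbs_word b n (w : word n) :
  fdist (@prob_gibbs R p n b) (initial_word ^~ n) w = cw_weight b w / cw_partition b n.
Proof.
have P1 : (product_measure (@rho R p)) setT = 1%E by exact: probability_setT.
have mw : measurable [set x : Sigma R p | initial_word x n == w].
  exact: (@initial_word_finite_valued R p n (pred1 w)).
rewrite /fdist /= /prob_gibbs.
rewrite (eq_integral (fun=> (q%:R ^+ n * (cw_weight b w / cw_partition b n))%:E)).
  rewrite integral_cst// fineM ?unit_mass_fin_num//=.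
  have := fdist_product_rho (R := R) w; rewrite /fdist => ->.
  by rewrite mulrAC mulfV ?mul1r// expf_neq0// pnatr_eq0.
by move=> x; rewrite inE /= => /eqP xw; rewrite gibbs_densityE xw.
Qed.

Lemma prob_gibbs_total b n : @prob_gibbs R p n b setT = 1%E.
Proof.
have P1 : (product_measure (@rho R p)) setT = 1%E by exact: probability_setT.
rewrite /prob_gibbs.
rewrite (eq_integral (fun x => (q%:R ^+ n *
    (cw_weight b (initial_word x n) / cw_partition b n))%:E)); last first.
  by move=> x _; rewrite gibbs_densityE.
rewrite (integral_fdist P1 (fun w => q%:R ^+ n * (cw_weight b w / cw_partition b n)));
  last exact: initial_word_finite_valued.
congr (_%:E); rewrite -[RHS](divff (lt0r_neq0 (cw_partition_gt0 b n))).
rewrite {1 2}/cw_partition mulr_suml; apply: eq_bigr => w _.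
by rewrite fdist_product_rho mulrAC mulfV ?mul1r// expf_neq0// pnatr_eq0.
Qed.

Definition prefix_match m n (mn : (m <= n)%N) (v : word m) (w : word n) : R :=
  \prod_(i < m) (w (widen_ord mn i) == v i)%:R.

Lemma prob_gibbs_prefix b m n (mn : (m <= n)%N) (v : word m) :
  fdist (@prob_gibbs R p n b) (initial_word ^~ m) v = cw_mean b (prefix_match mn v).
Proof.
pose f (w : word n) : word m := [ffun i => w (widen_ord mn i)].
have -> : (initial_word ^~ m : Sigma R p -> word m) = (fun x => f (initial_word x n)).
  by apply/funext => x; apply/ffunP => i; rewrite !ffunE.
rewrite (fdist_comp (prob_gibbs_total b n) f); last exact: initial_word_finite_valued.
rewrite /cw_mean mulr_suml [LHS]big_mkcond; apply: eq_bigr => w _.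
rewrite prob_gibbs_word; case: ifPn => [/eqP <-|].
  by rewrite /prefix_match big1 ?mul1r// => i _; rewrite ffunE eqxx.
move=> fwv; suff -> : prefix_match mn v w = 0 by rewrite !mul0r.
have /existsP[i wi] : [exists i, w (widen_ord mn i) != v i].
  rewrite -negb_forall; apply: contra fwv => /forallP fv.
  by apply/eqP/ffunP => i; rewrite ffunE; exact/eqP.
by rewrite /prefix_match (bigD1 i)//= (negbTE wi) mul0r.
Qed.

Lemma perm_extends m n (mn : (m <= n)%N) (f : 'I_m -> 'I_n) : injective f ->
  exists s : {perm 'I_n}, forall i, s (widen_ord mn i) = f i.
Proof.
case: n mn f => [|n] mn f f_inj.
  by exists 1%g => i; case: (f i).
(* The values of [f] in order, followed by the letters that it misses; the permutation reads off
   this list. *)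
pose t := codom f ++ [seq j <- enum 'I_n.+1 | j \notin codom f].
have tP : perm_eq t (enum 'I_n.+1).
  apply: uniq_perm; rewrite ?enum_uniq//.
    rewrite cat_uniq filter_uniq ?enum_uniq ?andbT//; apply/andP; split.
      exact/injectiveP.
    by apply/hasPn => j; rewrite mem_filter => /andP[].
  by move=> j; rewrite mem_cat mem_filter mem_enum; case: (j \in codom f).
have st : size t = n.+1 by rewrite (perm_size tP) size_enum_ord.
have ut : uniq t by rewrite (perm_uniq tP) enum_uniq.
have g_inj : injective (fun j : 'I_n.+1 => nth ord0 t j).
  move=> i j /eqP; rewrite nth_uniq ?st//.
  by move=> /eqP ij; exact: val_inj.
exists (perm g_inj) => i; rewrite permE /= nth_cat size_codom card_ord ltn_ord.
by rewrite codomE (nth_map i) ?size_enum_ord// nth_ord_enum.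
Qed.

(* Expanding the product of the frequencies gives the average, over all maps
   ['I_m -> 'I_n], of the probability of reading [v] along the map; this
   probability is the same for all injective maps. *)
Lemma prefix_freq b m n (mn : (m <= n)%N) (v : word m) : (0 < n)%N ->
  `|cw_mean b (prefix_match mn v) - cw_mean b (fun w : word n => \prod_i freq w (v i))| <=
    1 - (n ^_ m)%:R / n%:R ^+ m.
Proof.
move=> n0; have n1 : 0 < n%:R :> R by rewrite ltr0n.
pose M (f : 'I_m -> 'I_n) := cw_mean b (fun w : word n => \prod_i (w (f i) == v i)%:R : R).
have M01 f : 0 <= M f <= 1.
  rewrite -[X in X <= _ <= _](@cw_mean_cst b n) -[X in _ <= _ <= X](@cw_mean_cst b n 1).
  apply/andP; split; apply: cw_mean_le => w; first by apply: prodr_ge0.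
  by apply: prodr_ile1 => i _; rewrite ler0n lern1 leq_b1.
have M_inj f : injective f -> M f = cw_mean b (prefix_match mn v).
  move=> /(perm_extends mn)[s sE].
  rewrite -(cw_mean_permute b s); congr (cw_mean b _); apply/funext => w.
  by apply: eq_bigr => i _; rewrite ffunE sE.
have -> : cw_mean b (fun w : word n => \prod_i freq w (v i)) = n%:R ^- m * \sum_(f : {ffun 'I_m -> 'I_n}) M f.
  rewrite -cw_mean_sum -cw_meanZl; congr (cw_mean b _); apply/funext => w.
  rewrite /freq big_split/= prodr_const card_ord exprVn mulrC; congr (_ * _).
  exact: (bigA_distr_bigA (fun (i : 'I_m) (j : 'I_n) => (w j == v i)%:R : R)).
have -> : cw_mean b (prefix_match mn v) =
    n%:R ^- m * \sum_(f : {ffun 'I_m -> 'I_n}) cw_mean b (prefix_match mn v).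
  rewrite sumr_const card_ffun !card_ord -[X in _ = _ * X]mulr_natl natrX mulrA mulVf ?mul1r//.
  by rewrite expf_neq0// gt_eqF.
rewrite -mulrBr -sumrB normrM ger0_norm ?invr_ge0 ?exprn_ge0//.
have -> : 1 - (n ^_ m)%:R / n%:R ^+ m =
    n%:R ^- m * \sum_(f : {ffun 'I_m -> 'I_n} | ~~ injectiveb f) 1 :> R.
  rewrite sumr_const; have := cardC (fun f : {ffun 'I_m -> 'I_n} => injectiveb f).
  have -> : #|(fun f : {ffun 'I_m -> 'I_n} => injectiveb f)| = (n ^_ m)%N.
    by have := card_inj_ffuns 'I_m 'I_n; rewrite !card_ord => <-; apply: eq_card => f; rewrite inE.
  rewrite card_ffun !card_ord => /(congr1 (fun k => k%:R : R)).
  rewrite natrD natrX => e; rewrite (_ : #|_|%:R = n%:R ^+ m - (n ^_ m)%:R).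
    by rewrite mulrBr mulVf 1?mulrC// expf_neq0// gt_eqF.
  by rewrite -e addrAC subrr add0r; congr (_%:R).
apply: ler_wpM2l; first by rewrite invr_ge0 exprn_ge0.
apply: le_trans (ler_norm_sum _ _ _) _; rewrite [leRHS]big_mkcond; apply: ler_sum => f _.
case: ifPn => [_|/negPn/injectiveP/M_inj ->]; last by rewrite subrr normr0.
have /andP[f0 f1] := M01 f; have /andP[w0 w1] := M01 (widen_ord mn).
rewrite -/(M (widen_ord mn)) ler_norml; move: (M f) (M _) f0 f1 w0 w1 => x y.
by move=> *; apply/andP; split; lra.
Qed.

Lemma ffact_ratio_cvg m : ((n ^_ m)%:R / n%:R ^+ m : R) @[n --> \oo] --> (1 : R).
Proof.
elim: m => [|m IH].
  rewrite (_ : (fun _ => _) = cst 1); first exact: cvg_cst.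
  by apply/funext => n; rewrite ffactn0 expr0 divr1.
have h : (1 - m%:R * n%:R^-1 : R) @[n --> \oo] --> (1 : R).
  have h0 : (n%:R^-1 : R) @[n --> \oo] --> (0 : R).
    apply/(gtr0_cvgV0 (f := fun n : nat => n%:R : R)); last exact: cvgr_idn.
    by exists 1%N => // n /= n0; rewrite ltr0n.
  rewrite -[X in _ --> X]subr0 -[X in _ --> _ - X](mulr0 m%:R).
  by apply: cvgB; [exact: cvg_cst|apply: cvgM; [exact: cvg_cst|exact: h0]].
rewrite -[X in _ --> X]mulr1; apply: cvg_trans (cvgM IH h); apply: near_eq_cvg.
exists m.+1 => // n /= mn; rewrite ffactnSr natrM natrB ?(ltnW mn)// exprSr.
have n0 : n%:R != 0 :> R by rewrite pnatr_eq0; case: n mn.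
by field; rewrite ?n0 ?expf_neq0.
Qed.

Lemma prefix_freq_cvg b m (v : word m) :
  fdist (@prob_gibbs R p n b) (initial_word ^~ m) v -
    cw_mean b (fun w : word n => \prod_i freq w (v i)) @[n --> \oo] --> (0 : R).
Proof.
have h : (1 - (n ^_ m)%:R / n%:R ^+ m : R) @[n --> \oo] --> (0 : R).
  rewrite -(subrr 1); apply: cvgB; [exact: cvg_cst|exact: ffact_ratio_cvg].
have hN : (- (1 - (n ^_ m)%:R / n%:R ^+ m) : R) @[n --> \oo] --> (0 : R).
  by rewrite -oppr0; exact: cvgN.
apply: squeeze_cvgr hN h; exists (maxn m 1) => // n /=; rewrite geq_max => /andP[mn n0].
by rewrite (prob_gibbs_prefix b mn) -ler_norml; exact: prefix_freq.
Qed.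

End gibbs_cylinders.

(** * Concentration at the minimisers *)

Section simplex_products.
Context {R : realType} {p : nat}.
Local Notation q := p.+1.
Implicit Types x y : 'I_q -> R.

Lemma simplex_le1 x k : simplex x -> 0 <= x k <= 1.
Proof. by move=> [x0 x1]; rewrite x0 -x1 (bigD1 k)//= lerDl sumr_ge0. Qed.

Lemma sqdist_coord x y d k : 0 <= d -> sqdist x y <= d ^+ 2 -> `|x k - y k| <= d.
Proof.
move=> d0 xy; rewrite -(@ler_pXn2r _ 2) ?nnegrE// real_normK ?num_real//.
apply: le_trans xy; rewrite /sqdist (bigD1 k)//= lerDl.
by apply: sumr_ge0 => i _; exact: sqr_ge0.
Qed.

Variables (m : nat) (v : {ffun 'I_m -> 'I_q}).

Lemma simplex_prod01 x : simplex x -> 0 <= \prod_j x (v j) <= 1.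
Proof.
move=> sx; rewrite prodr_ile1 ?andbT => [|i _]; last exact: simplex_le1.
by apply: prodr_ge0 => i _; case/andP: (simplex_le1 (v i) sx).
Qed.

Lemma simplex_prod_dist x y : simplex x -> simplex y ->
  `|\prod_j x (v j) - \prod_j y (v j)| <= \sum_j `|x (v j) - y (v j)|.
Proof.
move=> sx sy; suff [] : 0 <= \prod_j y (v j) <= 1 /\
    `|\prod_j x (v j) - \prod_j y (v j)| <= \sum_j `|x (v j) - y (v j)| by [].
elim/big_rec3 : _ => [|j c a a' _ [a'01 ac]].
  by rewrite ler01 lexx subrr normr0.
have /andP[x0 x1] := simplex_le1 (v j) sx; have /andP[y0 y1] := simplex_le1 (v j) sy.
have /andP[a'0 a'1] := a'01; split; first by rewrite mulr_ge0//= mulr_ile1.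
rewrite (_ : _ - _ = (x (v j) - y (v j)) * a' + x (v j) * (a - a')); last by ring.
apply: le_trans (ler_normD _ _) _; rewrite !normrM; apply: lerD.
  by rewrite ler_piMr// ger0_norm.
by rewrite (ger0_norm x0); apply: le_trans ac; rewrite ler_piMl.
Qed.

End simplex_products.

Section localisation.
Context {R : realType} {p : nat}.
Local Notation q := p.+1.
Local Notation word n := {ffun 'I_n -> 'I_p.+1}.
Variable b : R.
Hypothesis b_gt0 : 0 < b.
Variables (J : finType) (z : J -> 'I_q -> R).
Hypothesis z_minimisers : forall x, minimiser b x -> exists i, x = z i.

Lemma simplex_freq n (w : word n) : (0 < n)%N -> simplex (freq w : 'I_q -> R).
Proof.
move=> n0; split=> [k|]; first by rewrite divr_ge0 ?occ_ge0.
by rewrite -mulr_suml occ_total divff// pnatr_eq0 -lt0n.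
Qed.

Definition far (eta : R) (x : 'I_q -> R) : bool := [forall i, eta <= sqdist x (z i)].

(** The gap makes the weight of the far words exponentially smaller than the lower bound of the
    partition function given by a minimiser [x0]; the polynomial number of types does not matter. *)
Lemma far_cvg0 eta : 0 < eta ->
  cw_mean b (fun w : word n => (far eta (freq w))%:R) @[n --> \oo] --> (0 : R).
Proof.
move=> eta0; have [x0 mx0] := @minimiser_exists R p b.
have [||g g0 gP] := @free_gap R p b J z (cw_free b x0) eta eta0.
- by move=> x sx; exact: mx0.2.
- by move=> x sx xm; apply: z_minimisers; split=> // y sy; rewrite xm; exact: mx0.2.
apply/cvgr0Pnorm_le => eps eps0.
have [N NP] := poly_expR_small q g0 eps0.
exists N.+1 => // n /= Nn; have n0 : (0 < n)%N by exact: leq_trans Nn.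
rewrite ger0_norm; last first.
  by rewrite -[X in X <= _](@cw_mean_cst R p b n); apply: cw_mean_le => w; rewrite ler0n.
apply: le_trans (NP n (ltnW Nn)); rewrite /cw_mean ler_pdivrMr ?cw_partition_gt0//.
have /= h := @restricted_partition_le R p b n (fun w => far eta (freq w)) (cw_free b x0 + g) n0.
apply: (@le_trans _ _ (\sum_(w : word n | far eta (freq w)) cw_weight b w)).
  rewrite [leRHS]big_mkcond; apply: ler_sum => w _.
  by case: ifP => _; rewrite ?mul1r ?mul0r.
apply: (le_trans (h _)).
  by move=> w /forallP wf; apply: gP => //; exact: simplex_freq.
have -> : - n%:R * (cw_free b x0 + g) = - (g * n%:R) + - n%:R * cw_free b x0 by ring.
rewrite expRD mulrA; apply: ler_wpM2l; last exact: (partition_ge x0 (ltW b_gt0) n0).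
by rewrite mulr_ge0 ?exprn_ge0 ?expR_ge0.
Qed.

(** The regions are constrained only near the points [z j]. They can therefore be read on a single
    coordinate, as required by the splitting along the occurrences of one letter. *)
Variables (E : J -> ('I_q -> R) -> bool) (eta0 : R).
Hypothesis eta0_gt0 : 0 < eta0.
Hypothesis E_local : forall i j x, sqdist x (z j) < eta0 -> E i x = (i == j).

(** Far frequencies have vanishing mass; at the others exactly one [E i] holds and [G] is close to
    [G (z i)]. It is applied to a constant, to products of frequencies, and to the indicators of
    other regions. *)
Lemma cw_mean_localise (G : ('I_q -> R) -> R) (M : R) :
  (forall x, simplex x -> `|G x| <= M) -> (forall i, `|G (z i)| <= M) ->
  (forall eps, 0 < eps -> exists2 eta, 0 < eta & forall j x, simplex x ->
    sqdist x (z j) < eta -> `|G x - G (z j)| <= eps) ->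
  cw_mean b (fun w : word n => G (freq w)) -
    \sum_i cw_mean b (fun w : word n => (E i (freq w))%:R) * G (z i) @[n --> \oo] --> (0 : R).
Proof.
move=> GM GzM Gcont; apply/cvgr0Pnorm_le => eps eps0.
have e20 : 0 < eps / 2 by rewrite divr_gt0.
have [eta1 eta10 eta1P] := Gcont _ e20.
pose eta := Num.min eta0 eta1.
have eta_gt0 : 0 < eta by rewrite lt_min eta0_gt0.
have M0 : 0 <= M.
  by have [x [sx _]] := @minimiser_exists R p b; exact: le_trans (GM x sx).
(* Bounds the integrand on far words, where several regions may hold at once; the added 1 makes it
   positive. *)
pose C := M + #|J|%:R * M + 1.
have C0 : 0 < C by rewrite ltr_wpDl// addr_ge0 ?mulr_ge0.
have d0 : 0 < eps / 2 / C by rewrite divr_gt0.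
have /cvgr0Pnorm_le/(_ _ d0)[N _ NP] := far_cvg0 eta_gt0.
exists N.+1 => // n /= Nn; have n0 : (0 < n)%N by exact: leq_trans Nn.
have {NP}/= NP := NP n (ltnW Nn).
have -> : cw_mean b (fun w : word n => G (freq w)) -
    \sum_i cw_mean b (fun w : word n => (E i (freq w))%:R) * G (z i) =
  cw_mean b (fun w : word n => G (freq w) + -1 * \sum_i G (z i) * (E i (freq w))%:R).
  rewrite cw_meanD cw_meanZl cw_mean_sum mulN1r; congr (_ - _).
  by apply: eq_bigr => i _; rewrite cw_meanZl mulrC.
apply: (@le_trans _ _ (cw_mean b
    (fun w : word n => eps / 2 + C * (far eta (freq w))%:R))); last first.
  rewrite cw_meanD cw_meanZl cw_mean_cst.
  have h : C * cw_mean b (fun w : word n => (far eta (freq w))%:R) <= eps / 2.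
    by rewrite mulrC -ler_pdivlMr//; apply: le_trans (ler_norm _) NP.
  lra.
apply: cw_mean_norm => w; rewrite mulN1r; set x := freq w.
have sx : simplex x by exact: simplex_freq.
case: (boolP (far eta x)) => [_|/forallPn[j]].
  rewrite mulr1; apply: le_trans (ler_normB _ _) _.
  have h : `|\sum_i G (z i) * (E i x)%:R| <= #|J|%:R * M.
    apply: le_trans (ler_norm_sum _ _ _) _.
    rewrite mulr_natl -sumr_const; apply: ler_sum => i _.
    by case: (E i x); rewrite ?mulr1 ?mulr0 ?normr0.
  have := GM x sx; rewrite /C; lra.
rewrite -ltNge lt_min => /andP[xj0 xj1]; rewrite mulr0 addr0.
rewrite (bigD1 j)//= (E_local j xj0) eqxx mulr1 big1 ?addr0; first exact: eta1P.
by move=> i /negbTE ij; rewrite (E_local i xj0) ij mulr0.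
Qed.

Lemma cw_prob_total :
  \sum_i cw_mean b (fun w : word n => (E i (freq w))%:R) @[n --> \oo] --> (1 : R).
Proof.
have h := @cw_mean_localise (fun=> 1) 1.
rewrite -[X in _ --> X]subr0.
apply: cvg_trans (cvgB (cvg_cst (1 : R)) (h _ _ _)).
- apply: near_eq_cvg; apply: nearW => n; rewrite !fctE cw_mean_cst opprB addrC subrK.
  by apply: eq_bigr => i _; rewrite mulr1.
- by move=> x _; rewrite normr1.
- by move=> i; rewrite normr1.
- by move=> eps eps0; exists 1 => // j x _ _; rewrite subrr normr0 ltW.
Qed.

Lemma gibbs_cylinder_localise m (v : word m) (z_simplex : forall i, simplex (z i)) :
  fdist (@prob_gibbs R p n b) (initial_word ^~ m) v -
    \sum_i cw_mean b (fun w : word n => (E i (freq w))%:R) * \prod_j z i (v j)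
    @[n --> \oo] --> (0 : R).
Proof.
have h := @cw_mean_localise (fun x : 'I_q -> R => \prod_j x (v j)) 1.
rewrite -[X in _ --> X]addr0; apply: cvg_trans (cvgD (prefix_freq_cvg b v) (h _ _ _)).
- by apply: near_eq_cvg; apply: nearW => n; rewrite !fctE subrKA.
- by move=> x sx; have /andP[x0 x1] := simplex_prod01 v sx; rewrite ger0_norm.
- by move=> i; have /andP[x0 x1] := simplex_prod01 v (z_simplex i); rewrite ger0_norm.
move=> eps eps0; pose d := eps / m.+1%:R.
have d0 : 0 < d by rewrite divr_gt0.
exists (d ^+ 2); first by rewrite exprn_gt0.
move=> j x sx xd; apply: le_trans (simplex_prod_dist v sx (z_simplex j)) _.
apply: (@le_trans _ _ (\sum_(i < m) d)).
  by apply: ler_sum => i _; apply: sqdist_coord (ltW d0) (ltW xd).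
rewrite sumr_const card_ord -[leLHS]mulr_natr /d mulrAC ler_pdivrMr// ler_pM2l//.
by rewrite ler_nat.
Qed.

End localisation.

(** * The masses of the minimisers at the critical temperature *)

Section word_splitting.
Context {R : realType}.

Definition add_letter (m : nat) (k : 'I_m) (x : 'I_m -> R) : 'I_m -> R :=
  fun j => (k == j)%:R + x j.

Lemma occ_word_cons (p n : nat) (k : 'I_p.+1) (w : {ffun 'I_n -> 'I_p.+1}) :
  occ (word_cons k w) = add_letter k (occ w).
Proof.
apply/funext => l; rewrite /occ big_ord_recl ffunE unlift_none; congr (_ + _).
by apply: eq_bigr => i _; rewrite ffunE liftK.
Qed.

Lemma sum_binomial_recl n (a : nat -> nat -> R) :
  \sum_(l < n.+2) 'C(n.+1, l)%:R * a l (n.+1 - l)%N =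
  \sum_(l < n.+1) 'C(n, l)%:R * (a l.+1 (n - l)%N + a l (n - l).+1).
Proof.
under [RHS]eq_bigr do rewrite mulrDr; rewrite big_split/= [RHS]addrC.
rewrite [LHS]big_ord_recl /= bin0 [in RHS]big_ord_recl /= bin0 !subn0 -addrA; congr (_ + _).
under [LHS]eq_bigr => l _ do rewrite /bump /= add1n subSS binS natrD mulrDl.
rewrite big_split/= [X in X + _ = _]big_ord_recr /= bin_small// mul0r addr0; congr (_ + _).
by apply: eq_bigr => l _; rewrite /bump /= add1n subnSK.
Qed.

Definition glue_letter r (a : R) (y : 'I_r.+1 -> R) : 'I_r.+2 -> R :=
  fun k => oapp y a (unlift ord0 k).

Lemma glue_letter0 r a (y : 'I_r.+1 -> R) : glue_letter a y ord0 = a.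
Proof. by rewrite /glue_letter unlift_none. Qed.

Lemma glue_letter_lift r a (y : 'I_r.+1 -> R) k : glue_letter a y (lift ord0 k) = y k.
Proof. by rewrite /glue_letter liftK. Qed.

(** The binomial coefficient counts the places of the letter [ord0]. As [F] sees only occurrences,
    induction on the first letter reduces this to Pascal's rule. *)
Lemma sum_occ_split r n (F : ('I_r.+2 -> R) -> R) :
  \sum_(w : {ffun 'I_n -> 'I_r.+2}) F (occ w) =
  \sum_(l < n.+1) 'C(n, l)%:R *
    \sum_(v : {ffun 'I_(n - l) -> 'I_r.+1}) F (glue_letter l%:R (occ v)).
Proof.
elim: n F => [|n IH] F.
  rewrite big_ord1 bin0 mul1r.
  pose u : {ffun 'I_0 -> 'I_r.+2} := [ffun=> ord0].
  pose v : {ffun 'I_0 -> 'I_r.+1} := [ffun=> ord0].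
  rewrite (big_pred1 u) => [|w]; last by apply/esym/eqP/ffunP => -[].
  rewrite (big_pred1 v) => [|w]; last by apply/esym/eqP/ffunP => -[].
  congr (F _); apply/funext => k; rewrite /occ big_ord0 /glue_letter.
  by case: unliftP => //= j _; rewrite big_ord0.
rewrite sum_words_recl.
pose a (G : ('I_r.+2 -> R) -> R) l N :=
  \sum_(v : {ffun 'I_N -> 'I_r.+1}) G (glue_letter l%:R (occ v)).
rewrite (sum_binomial_recl n (a F)).
transitivity (\sum_k \sum_(l < n.+1) 'C(n, l)%:R * a (F \o add_letter k) l (n - l)%N).
  apply: eq_bigr => k _; rewrite -IH; apply: eq_bigr => w _.
  by rewrite /= occ_word_cons.
rewrite exchange_big; apply: eq_bigr => l _ /=; rewrite -mulr_sumr; congr (_ * _).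
rewrite big_ord_recl; congr (_ + _).
  apply: eq_bigr => v _ /=; congr (F _); apply/funext => k; rewrite /add_letter.
  case: (unliftP ord0 k) => [j ->|->]; last by rewrite !glue_letter0 eqxx nat1r.
  by rewrite !glue_letter_lift add0r.
rewrite /a sum_words_recl; apply: eq_bigr => k _; apply: eq_bigr => v _ /=.
rewrite occ_word_cons; congr (F _); apply/funext => j; rewrite /add_letter.
case: (unliftP ord0 j) => [i ->|->]; last by rewrite !glue_letter0 add0r.
by rewrite !glue_letter_lift (inj_eq lift_inj).
Qed.

End word_splitting.

(** * Decomposition by the number of occurrences of one letter *)

Section letter_masses.
Context {R : realType} {r : nat}.
Local Notation q := r.+2.
Local Notation P := (@GRing.natmul R 1 r.+1).
Local Notation word n := {ffun 'I_n -> 'I_r.+2}.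
Implicit Types (b : R) (n l : nat).

(* The total weight, up to [fluctuation], of the words with [l] occurrences of
   [ord0]; the exponent is that of equal frequencies of the other letters. *)
Definition letter_height b n l : R :=
  'C(n, l)%:R * expR (b / (2 * n%:R) * (l%:R ^+ 2 + (n - l)%:R ^+ 2 / P)) * P ^+ (n - l).

Definition fluctuation (N : nat) (t : R) : R := @chi2_sum R r N t / P ^+ N.

(** The [N = n - l] other letters form a smaller model at parameter [t = b N / n], because
    [b / (2 n) = t / (2 N)]. The condition on [E] discards [l = n], where [N = 0]. *)
Lemma letter_mass b n (E : pred R) : (0 < n)%N -> ~~ E 1 ->
  \sum_(w : word n) (E (freq w ord0))%:R * cw_weight b w =
  \sum_(l < n.+1) (E (l%:R / n%:R))%:R *
    (letter_height b n l * fluctuation (n - l) (b * (n - l)%:R / n%:R)).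
Proof.
move=> n0 E1; have n_neq0 : n%:R != 0 :> R by rewrite pnatr_eq0 -lt0n.
pose F (x : 'I_q -> R) : R :=
  (E (x ord0 / n%:R))%:R * expR (b / (2 * n%:R) * \sum_k x k ^+ 2).
have := sum_occ_split n F; rewrite /F => ->; apply: eq_bigr => l _.
set N := (n - l)%N; under eq_bigr do rewrite glue_letter0.
rewrite -mulr_sumr; case: (ltnP l n) => ln; last first.
  have -> : nat_of_ord l = n by apply/eqP; rewrite eqn_leq ln -ltnS ltn_ord.
  by rewrite divff// (negbTE E1) !mul0r mulr0.
have N0 : (0 < N)%N by rewrite subn_gt0.
have N_neq0 : N%:R != 0 :> R by rewrite pnatr_eq0 -lt0n.
rewrite mulrCA; congr (_ * _); rewrite /letter_height -!mulrA; congr (_ * _).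
have P0 : P ^+ N != 0 by rewrite expf_neq0// pnatr_eq0.
rewrite /fluctuation [P ^+ N * _]mulrC divfK// mulr_sumr.
apply: eq_bigr => v _; rewrite big_ord_recl glue_letter0.
under [X in _ + X]eq_bigr do rewrite glue_letter_lift.
have h := @cw_weight_chi2 R r (b * N%:R / n%:R) N v N0.
rewrite mulrDr expRD.
have <- : cw_weight (b * N%:R / n%:R) v = expR (b / (2 * n%:R) * \sum_k occ v k ^+ 2).
  have aux (x m : R) : x != 0 -> m != 0 -> b * x / m / (2 * x) = b / (2 * m).
    by move=> x0 m0; field; rewrite x0 m0.
  by rewrite /cw_weight aux.
rewrite h /chi2_weight -!expRD; congr expR.
rewrite -/N; move: (chi2 v) => c; move: (l%:R) (N%:R) (n%:R) n_neq0 => x y m m0.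
have : P != 0 by []. move: P => a a0.
by field; rewrite m0 a0.
Qed.

Hypothesis r_gt0 : (0 < r)%N.
Local Notation bc := (@beta_c R r.+2).

(** Specific to [bc]: the identity [bc (P - 1) = 2 P ln P] makes the change of the energy compensate
    that of the count [P ^+ (n - l)] of the other letters. *)
Lemma letter_height_sym n l : (0 < n)%N -> (l <= n)%N ->
  letter_height bc n (n - l) = letter_height bc n l.
Proof.
move=> n0 l_le; have P0 : 0 < P by [].
have n_neq0 : n%:R != 0 :> R by rewrite pnatr_eq0 -lt0n.
have : bc * (P - 1) = 2 * P * ln P.
  rewrite /beta_c.
  have e1 : q%:R - 1 = P :> R by rewrite -[q%:R]natr1 addrK.
  have e2 : q%:R - 2 = P - 1 :> R by rewrite -e1; ring.
  rewrite e1 e2 divfK//.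
  by rewrite subr_eq0 gt_eqF// ltr1n ltnS.
move: bc => b bE; have lnP : ln P = b * (P - 1) / (2 * P).
  by rewrite bE mulrC mulKf// mulf_neq0// gt_eqF.
have eP k : P ^+ k = expR (k%:R * ln P) by rewrite expRM_natl lnK.
rewrite /letter_height bin_sub// subKn// -!mulrA; congr (_ * _).
rewrite !eP -!expRD natrB// lnP; congr expR.
by field; rewrite nat1r pnatr_eq0 n_neq0.
Qed.

Lemma letter_mass_reflect n (E : pred R) : (0 < n)%N ->
  \sum_(l < n.+1) (E (1 - l%:R / n%:R))%:R *
    (letter_height bc n l * fluctuation (n - l) (bc * (n - l)%:R / n%:R)) =
  \sum_(l < n.+1) (E (l%:R / n%:R))%:R *
    (letter_height bc n l * fluctuation l (bc * l%:R / n%:R)).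
Proof.
move=> n0; rewrite [LHS](reindex_inj rev_ord_inj); apply: eq_bigr => l _ /=.
have ln : (l <= n)%N by rewrite -ltnS ltn_ord.
have n_neq0 : n%:R != 0 :> R by rewrite pnatr_eq0 -lt0n.
rewrite subSS letter_height_sym// subKn//; congr ((E _)%:R * _).
by rewrite natrB//; field.
Qed.

End letter_masses.

(* On its own [field] would rewrite [a] = [k.+1%:R] as [1 + k%:R]. *)
Ltac field_atom a0 a1 :=
  match type of a0 with is_true (?a != _) =>
    let x := fresh in let h0 := fresh in let h1 := fresh in
    move: a a0 a1 => x h0 h1; field; rewrite ?h0 ?h1
  end.

(** * Limits of the fluctuation factors at the critical temperature *)

Section critical_fluctuations.
Context {R : realType} {r : nat}.
Hypothesis r_gt0 : (0 < r)%N.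
Local Notation q := r.+2.
Local Notation P := (@GRing.natmul R 1 r.+1).
Local Notation bc := (@beta_c R r.+2).

Let r1_gt1 : (1 < r.+1)%N. Proof. by rewrite ltnS. Qed.

Definition critical_point (i : option 'I_q) : 'I_q -> R :=
  if i is Some i then spike i (@crit_height R r.+1) else barycentre.

Lemma critical_points x : minimiser bc x -> exists i, x = critical_point i.
Proof.
by move=> /(critical_minimisers r1_gt1)[->|[i ->]]; [exists None|exists (Some i)].
Qed.

Let c : R := P / (P + 1).
Let P_gt1 : 1 < P. Proof. by rewrite ltr1n ltnS. Qed.
Let P_gt0 : 0 < P. Proof. by []. Qed.
Let qE : q%:R = P + 1 :> R. Proof. by rewrite natr1. Qed.
Let c_gt0 : 0 < c. Proof. by rewrite divr_gt0// addr_gt0. Qed.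

Let cE : c = 1 - (P + 1)^-1.
Proof.
have P1 : P + 1 != 0 by rewrite gt_eqF// addr_gt0.
by rewrite /c; move: P P1 => a a1; field.
Qed.

(** Concavity of [ln] between 1 and [y], with weights [(P + 1)^-1] and [c]. *)
Lemma weighted_ln_le (y : R) : 0 < y -> c * ln y <= ln ((P + 1)^-1 + c * y).
Proof.
move=> y0; set A := _ + _.
have A0 : 0 < A by rewrite addr_gt0 ?mulr_gt0// invr_gt0 addr_gt0.
have h1 : ln (y / A) <= y / A - 1 by apply: ln_le_subr1; rewrite divr_gt0.
have h2 : ln A^-1 <= A^-1 - 1 by apply: ln_le_subr1; rewrite invr_gt0.
rewrite ln_div ?posrE// in h1; rewrite lnV ?posrE// in h2.
have d0 : 0 < (P + 1)^-1 by rewrite invr_gt0 addr_gt0.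
have h3 := ler_wpM2l (ltW c_gt0) h1; have h4 := ler_wpM2l (ltW d0) h2.
have e : c * (y / A) + (P + 1)^-1 * A^-1 = 1 by rewrite mulrA -mulrDl addrC divff// gt_eqF.
move: h3 h4 e; rewrite !mulrBr mulrN !mulr1; move: (ln y) (ln A) => a l.
move: (y / A) (A^-1) => u v h3 h4 e.
have : c * a - c * l - (P + 1)^-1 * l <= 1 - (c + (P + 1)^-1) by lra.
by rewrite cE; lra.
Qed.

(** The gap is inherited from the full model at [bc]: [x] is completed to [x'] by giving the
    frequency [q^-1] to the letter [ord0] and scaling the rest by [c]. Concavity of [ln] bounds the
    excess of [x'] by [c] times that of [x]. *)
Lemma critical_gap (delta : R) : 0 < delta -> exists2 g : R, 0 < g &
  forall x : 'I_r.+1 -> R, (forall k, 0 <= x k) -> \sum_k x k = 1 ->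
  (exists k, delta < `|x k - P^-1|) ->
  cw_free (bc * c) (fun _ : 'I_r.+1 => P^-1) + g <= cw_free (bc * c) x.
Proof.
move=> d0; have P_neq0 : P != 0 by [].
have Q0 : 0 < P + 1 by rewrite addr_gt0.
have Q_neq0 : P + 1 != 0 by rewrite gt_eqF.
have bc0 : 0 < bc by exact: (beta_c_gt0 r1_gt1).
(* The difference between [q^-1] and a low coordinate of a critical spike, hence a lower bound for
   the distance of [x'] to each spike, seen on [ord0]. *)
pose e2 := (P - 1) / (P * (P + 1)).
have e20 : 0 < e2 by rewrite divr_gt0 ?subr_gt0// mulr_gt0.
pose eta := Num.min ((c * delta) ^+ 2) (e2 ^+ 2).
have eta0 : 0 < eta by rewrite lt_min !exprn_gt0// mulr_gt0.
have mb : minimiser bc (@barycentre R r.+1) by exact: critical_barycentre_minimiser.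
have [||g g0 gP] := @free_gap R r.+1 bc (option 'I_q) critical_point
    (cw_free bc (@barycentre R r.+1)) eta eta0.
- by move=> x sx; exact: mb.2.
- by move=> x sx xm; apply: critical_points; split=> // y sy; rewrite xm; exact: mb.2.
exists (g / c); first by rewrite divr_gt0.
move=> x x0 x1 [k xk].
pose x' := glue_letter (P + 1)^-1 (fun j => c * x j) : 'I_q -> R.
have sx' : simplex x'.
  split=> [j|]; rewrite /x'.
    case: (unliftP ord0 j) => [i ->|->]; rewrite ?glue_letter0 ?glue_letter_lift.
      by rewrite mulr_ge0// ltW.
    by rewrite invr_ge0 ltW.
  rewrite big_ord_recl glue_letter0.
  under eq_bigr do rewrite glue_letter_lift.
  by rewrite -mulr_sumr x1 /c; field_atom P_neq0 Q_neq0.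
have coord (y z : 'I_q -> R) j : (y j - z j) ^+ 2 <= sqdist y z.
  by rewrite /sqdist (bigD1 j)//= lerDl sumr_ge0// => i _; exact: sqr_ge0.
have far' i : eta <= sqdist x' (critical_point i).
  rewrite /eta ge_min; case: i => [i|] /=; apply/orP; [right|left].
    apply: le_trans (coord _ _ ord0); rewrite /x' glue_letter0 /spike.
    case: ifP => _; rewrite /crit_height.
      rewrite (_ : _ - _ = - (P - 1) / (P + 1)); last first.
        by field_atom P_neq0 Q_neq0.
      have h : e2 <= (P - 1) / (P + 1).
        rewrite /e2 ler_pM2l ?subr_gt0// lef_pV2 ?posrE ?mulr_gt0//.
        by rewrite ler_peMl// ltW.
      by rewrite mulNr sqrrN lerXn2r// nnegrE ?(ltW e20)// (le_trans (ltW e20)).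
    rewrite (_ : _ - _ = e2)//.
    by rewrite /e2; field_atom P_neq0 Q_neq0.
  apply: le_trans (coord _ _ (lift ord0 k)); rewrite /x' glue_letter_lift /barycentre qE.
  rewrite (_ : _ - _ = c * (x k - P^-1)); last first.
    by rewrite /c; field_atom P_neq0 Q_neq0.
  rewrite [leRHS]exprMn exprMn ler_wpM2l ?sqr_ge0//.
  rewrite -[leRHS]real_normK ?num_real// lerXn2r ?nnegrE//; exact: ltW.
have {}gP := gP x' sx' far'.
suff : cw_free bc x' - cw_free bc (@barycentre R r.+1) <=
    c * (cw_free (bc * c) x - cw_free (bc * c) (fun _ : 'I_r.+1 => P^-1)).
  move=> h; rewrite addrC -lerBrDr ler_pdivrMr// [leRHS]mulrC.
  by apply: le_trans h; rewrite lerBrDl.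
set S := \sum_k expR (bc * c * x k); have S0 : 0 < S by exact: sum_expR_gt0.
pose e := expR (bc / (P + 1)); have ee : 0 < e by exact: expR_gt0.
have x'E : cw_free bc x' =
    bc / 2 * ((P + 1)^-1 ^+ 2 + c ^+ 2 * \sum_k x k ^+ 2) - ln (e + S).
  have e1 : \sum_j x' j ^+ 2 = (P + 1)^-1 ^+ 2 + c ^+ 2 * \sum_k x k ^+ 2.
    rewrite big_ord_recl /x' glue_letter0 mulr_sumr; congr (_ + _).
    by apply: eq_bigr => j _; rewrite glue_letter_lift exprMn.
  have e2' : \sum_j expR (bc * x' j) = e + S.
    rewrite big_ord_recl /x' glue_letter0; congr (_ + _).
    by apply: eq_bigr => j _; rewrite glue_letter_lift mulrA.
  by rewrite /cw_free e1 e2'.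
have baryE : cw_free bc (@barycentre R r.+1) =
    bc / 2 * (P + 1)^-1 - ln ((P + 1) * e).
  rewrite /cw_free /barycentre !sumr_const card_ord -[_ ^+ 2 *+ _]mulr_natr.
  by rewrite -[expR _ *+ _]mulr_natl qE expr2 mulfVK.
have uE : cw_free (bc * c) (fun _ : 'I_r.+1 => P^-1) = bc * c / 2 * P^-1 - ln (P * e).
  rewrite /cw_free !sumr_const card_ord -[_ ^+ 2 *+ _]mulr_natr.
  rewrite -[expR _ *+ _]mulr_natl expr2 mulfVK//; congr (_ - ln (_ * expR _)).
  by rewrite /c; field_atom P_neq0 Q_neq0.
have y0 : 0 < S / (P * e) by rewrite divr_gt0// mulr_gt0.
have := weighted_ln_le y0.
have -> : (P + 1)^-1 + c * (S / (P * e)) = (e + S) / ((P + 1) * e).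
  have aux (a d u : R) : a != 0 -> a + 1 != 0 -> d != 0 ->
      (a + 1)^-1 + a / (a + 1) * (u / (a * d)) = (d + u) / ((a + 1) * d).
    by move=> a0 a10 d0'; field; rewrite a0 a10 d0'.
  exact: aux P_neq0 Q_neq0 (lt0r_neq0 ee).
rewrite !ln_div ?posrE ?mulr_gt0 ?addr_gt0// => h.
rewrite x'E baryE uE /cw_free -/S.
move: h; move: (ln (P * e)) (ln ((P + 1) * e)) (ln S) (ln (e + S)) => l1 l2 l3 l4 h.
move: (\sum_k _) => X.
rewrite -subr_ge0; move: h; rewrite -subr_ge0; congr (0 <= _).
by rewrite /c; field_atom P_neq0 Q_neq0.
Qed.

Local Notation T0 := (bc * c).
Let LA : R := 1 - bc / (q%:R * P).
Let LB : R := 1 - bc / q%:R.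

Lemma ln_close (s0 eps : R) : 0 < s0 -> 0 < eps ->
  exists2 d, 0 < d & forall s, `|s - s0| < d -> `|ln s - ln s0| <= eps.
Proof.
move=> s00 eps0; have /cvgrPdist_le/(_ _ eps0) := continuous_ln s00.
move=> /nbhs_ballP[d /= d0 dP]; exists d => // s sd.
by rewrite distrC; apply: dP; rewrite /ball /= distrC.
Qed.

Let bc_gt0 : 0 < bc. Proof. exact: (beta_c_gt0 r1_gt1). Qed.
Let bc_lt : bc < P + 1. Proof. by rewrite -qE; exact: (beta_c_lt r1_gt1). Qed.
Let Q_gt0 : 0 < P + 1. Proof. by rewrite addr_gt0. Qed.

Let LB_gt0 : 0 < LB.
Proof. by rewrite subr_gt0 qE ltr_pdivrMr// mul1r bc_lt. Qed.

Let LA_gt0 : 0 < LA.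
Proof.
rewrite subr_gt0 qE ltr_pdivrMr ?mulr_gt0// mul1r; apply: lt_trans bc_lt _.
by rewrite ltr_pMr.
Qed.

Let T0_bounds : 0 <= T0 /\ T0 < P.
Proof.
split; first by rewrite mulr_ge0// ltW.
by rewrite /c [bc * _]mulrCA gtr_pMr// ltr_pdivrMr// mul1r bc_lt.
Qed.

(** For [l / n] close to [q^-1] the parameters are close to [bc / q] and [bc c]; the limits at these
    values produce [1 - bc / (q P)] and [1 - bc / q], the bases of [weightA] and [weightB]. *)
Lemma fluctuation_lim (eps : R) : 0 < eps -> exists2 d : R, 0 < d & exists N, forall n l,
  (N <= n)%N -> (l <= n)%N -> `|l%:R / n%:R - q%:R^-1| < d ->
  `|ln (@fluctuation R r l (bc * l%:R / n%:R)) + (P - 1) / 2 * ln LA| <= eps /\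
  `|ln (@fluctuation R r (n - l) (bc * (n - l)%:R / n%:R)) + (P - 1) / 2 * ln LB| <= eps.
Proof.
move=> eps0; have e20 : 0 < eps / 2 by rewrite divr_gt0.
have K0 : 0 < (P - 1) / 2 by rewrite divr_gt0// subr_gt0.
have eK : 0 < eps / 2 / ((P - 1) / 2) by rewrite divr_gt0.
have [d1 d10 d1P] := ln_close LA_gt0 eK.
have [d2 d20 d2P] := ln_close LB_gt0 eK.
have [T00 T0P] := T0_bounds.
have [e1 e10 [N NP]] := ln_chi2_sum_lim T00 T0P critical_gap e20.
(* In turn: [l] and [n - l] are at least [n / (2 q)]; both parameters stay below [T0 + e1]; the
   arguments of the logarithms stay close to [LA] and [LB]. *)
pose d := Num.min ((2 * (P + 1))^-1) (Num.min (e1 / bc) (Num.min (d1 * P / bc) (d2 * P / bc))).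
have b0 := bc_gt0; have Q0 := Q_gt0; have P1 := P_gt1; have P0 := P_gt0.
have d0 : 0 < d.
  rewrite !lt_min; apply/and4P; split; first by rewrite invr_gt0 mulr_gt0.
  - exact: divr_gt0.
  - exact: divr_gt0 (mulr_gt0 d10 P0) b0.
  - exact: divr_gt0 (mulr_gt0 d20 P0) b0.
exists d => //; exists (2 * q * N).+1 => n l Nn ln_le.
have n0 : 0 < n%:R :> R by rewrite ltr0n; exact: leq_trans Nn.
set y := l%:R / n%:R; rewrite qE !lt_min => /andP[y1 /andP[y2 /andP[y3 y4]]].
have Nn' : N%:R <= n%:R / (2 * (P + 1)).
  by rewrite ler_pdivlMr ?mulr_gt0// -qE -!natrM ler_nat mulnC ltnW.
have lE : l%:R = n%:R * y by rewrite /y mulrC divfK// gt_eqF.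
have nlE : (n - l)%:R = n%:R * (1 - y) by rewrite natrB// lE mulrBr mulr1.
have i0 : 0 < (P + 1)^-1 by rewrite invr_gt0.
have i2 : (P + 1)^-1 <= 2^-1 by rewrite lef_pV2 ?posrE//; lra.
have y1' : `|y - (P + 1)^-1| < 2^-1 * (P + 1)^-1 by rewrite -invfM.
have [ya yb] : 2^-1 * (P + 1)^-1 <= y /\ 2^-1 * (P + 1)^-1 <= 1 - y.
  by move: y1'; rewrite ltr_norml => /andP[]; lra.
have Nl : (N <= l)%N.
  rewrite -(ler_nat R) lE; apply: le_trans Nn' _.
  by rewrite ler_pM2l// invfM.
have Nnl : (N <= n - l)%N.
  rewrite -(ler_nat R) nlE; apply: le_trans Nn' _.
  by rewrite ler_pM2l// invfM.
have tA : bc * l%:R / n%:R = bc * y by rewrite mulrA.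
have tB : bc * (n - l)%:R / n%:R = bc * (1 - y).
  by rewrite nlE -mulrA [n%:R * _]mulrC mulfK// gt_eqF.
have by1 : bc * `|y - (P + 1)^-1| <= e1 by rewrite mulrC -ler_pdivlMr// ltW.
have tA01 : 0 <= bc * y <= T0 + e1.
  rewrite mulr_ge0 ?(ltW b0)//=; last by apply: le_trans ya; rewrite mulr_ge0// ltW.
  rewrite -lerBlDl; apply: le_trans by1; rewrite -mulrBr ler_pM2l// cE.
  by apply: le_trans (ler_norm _); lra.
have tB01 : 0 <= bc * (1 - y) <= T0 + e1.
  rewrite mulr_ge0 ?(ltW b0)//=; last by apply: le_trans yb; rewrite mulr_ge0// ltW.
  rewrite -lerBlDl; apply: le_trans by1; rewrite -mulrBr ler_pM2l// cE distrC.
  by apply: le_trans (ler_norm _); lra.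
have lnK (s L : R) (K : R) X : 0 < K -> `|ln s - ln L| <= eps / 2 / K ->
    `|X + K * ln s| <= eps / 2 -> `|X + K * ln L| <= eps.
  move=> K0' h1 h2; rewrite (_ : _ + _ = (X + K * ln s) - K * (ln s - ln L)); last by ring.
  apply: le_trans (ler_normB _ _) _; rewrite [leRHS]splitr; apply: lerD => //.
  by rewrite normrM (gtr0_norm K0') mulrC -ler_pdivlMr.
split.
  rewrite tA; apply: lnK K0 (d1P (1 - bc * y / P) _) (NP l _ Nl tA01).2.
  rewrite /LA qE (_ : _ - _ = - (bc / P * (y - (P + 1)^-1))); last first.
    by rewrite invfM; ring.
  rewrite normrN normrM (gtr0_norm (divr_gt0 b0 P0)) mulrAC ltr_pdivrMr//.
  by rewrite mulrC -ltr_pdivlMr.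
rewrite tB; apply: lnK K0 (d2P (1 - bc * (1 - y) / P) _) (NP (n - l)%N _ Nnl tB01).2.
rewrite /LB qE (_ : _ - _ = bc / P * (y - (P + 1)^-1)); last first.
  have Q1 : P + 1 != 0 by rewrite gt_eqF.
  have P1' : P != 0 by rewrite gt_eqF.
  by field_atom P1' Q1.
rewrite normrM (gtr0_norm (divr_gt0 b0 P0)) mulrAC ltr_pdivrMr//.
by rewrite mulrC -ltr_pdivlMr.
Qed.

End critical_fluctuations.

(** * Comparison of the masses of the barycentre and of a spike *)

Section critical_masses.
Context {R : realType} {r : nat}.
Hypothesis r_gt0 : (0 < r)%N.
Local Notation q := r.+2.
Local Notation P := (@GRing.natmul R 1 r.+1).
Local Notation bc := (@beta_c R r.+2).
Local Notation word n := {ffun 'I_n -> 'I_r.+2}.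
Local Notation wA := ((@weightA R r.+2)%:num : R).
Local Notation wB := ((@weightB R r.+2)%:num : R).

Let r1_gt1 : (1 < r.+1)%N. Proof. by rewrite ltnS. Qed.
Let qE : q%:R = P + 1 :> R. Proof. by rewrite natr1. Qed.

Let q1E : q%:R - 1 = P :> R. Proof. by rewrite qE addrK. Qed.

Let q2E : q%:R - 2 = P - 1 :> R. Proof. by rewrite -q1E; ring. Qed.

Lemma weightA_gt0 : 0 < wA.
Proof.
rewrite /= q1E; apply: powR_gt0; rewrite subr_gt0 ltr_pdivrMr ?mulr_gt0// mul1r.
apply: lt_trans (beta_c_lt r1_gt1) _.
by rewrite ltr_pMr// ltr1n ltnS.
Qed.

Lemma weightB_gt0 : 0 < wB.
Proof.
apply: powR_gt0; rewrite subr_gt0 ltr_pdivrMr// mul1r.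
exact: (beta_c_lt r1_gt1).
Qed.

Definition coord_near (i : 'I_q) (a d : R) (x : 'I_q -> R) : bool := `|x i - a| < d.

Lemma fluctuation_gt0 N (t : R) : 0 <= t -> 0 < @fluctuation R r N t.
Proof.
move=> t0; rewrite divr_gt0 ?exprn_gt0//.
by apply: lt_le_trans (chi2_sum_ge N t0); rewrite exprn_gt0.
Qed.

(** The ratio [u = x / y] lies between [expR (- 2 eps)] and [expR (2 eps)]; the lower side is no
    worse than the upper one since [1 - u <= u^-1 - 1]. *)
Lemma ln_close_dist (x y eps : R) : 0 < x -> 0 < y -> `|ln x| <= eps -> `|ln y| <= eps ->
  `|x - y| <= (expR (2 * eps) - 1) * y.
Proof.
move=> x0 y0 lx ly; have [u u0 uE] : exists2 u : R, 0 < u & expR (ln x - ln y) = u.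
  by exists (expR (ln x - ln y)); rewrite ?expR_gt0.
have xE : x = u * y by rewrite -uE expRB !lnK// divfK// gt_eqF.
have d : `|ln x - ln y| <= 2 * eps.
  by apply: le_trans (ler_normB _ _) _; move: lx ly; lra.
move: d; rewrite ler_norml => /andP[d1 d2].
have u1 : u <= expR (2 * eps) by rewrite -uE ler_expR.
have u2 : u^-1 <= expR (2 * eps) by rewrite -uE -expRN ler_expR lerNl.
have u3 : 1 - u <= u^-1 - 1.
  rewrite -subr_ge0 (_ : _ - _ = (u - 1) ^+ 2 / u); last by field; rewrite gt_eqF.
  by rewrite divr_ge0 ?sqr_ge0 ?ltW.
rewrite xE -{2}[y]mul1r -mulrBl normrM (gtr0_norm y0) ler_pM2r// ler_norml.
by apply/andP; split; lra.
Qed.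

(** After [l -> n - l] in the spike window, both masses are sums over the same [l] with the same
    [letter_height], and the fluctuation factors tend to [1 / B] and [1 / A]; the sums are compared
    term by term. *)
Lemma critical_mass_ratio (theta d0 : R) : 0 < theta -> 0 < d0 ->
  exists2 d : R, 0 < d <= d0 & exists N, forall n, (N <= n)%N ->
  `|cw_mean bc (fun w : word n => (coord_near ord0 q%:R^-1 d (freq w))%:R) * wB -
    cw_mean bc (fun w : word n => (coord_near ord0 (@crit_height R r.+1) d (freq w))%:R) * wA| <= theta.
Proof.
move=> theta0 d00; have wA0 := weightA_gt0.
(* So that [expR (2 eps) - 1 = theta / wA]; the factor [wA] is cancelled by the one in the spike
   terms. *)
pose eps := ln (1 + theta / wA) / 2.
have tA0 : 0 < theta / wA by rewrite divr_gt0.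
have eps0 : 0 < eps by rewrite divr_gt0// ln_gt0// ltrDl.
have [d1 d10 [N NP]] := fluctuation_lim r_gt0 eps0.
(* The bound [q^-1] excludes [l = 0] and [l = n] from the window. *)
pose d := Num.min d0 (Num.min d1 q%:R^-1).
have q0 : 0 < q%:R^-1 :> R by rewrite invr_gt0.
have dd : 0 < d by rewrite !lt_min d00 d10 q0.
exists d; first by rewrite dd ge_min lexx.
exists N.+1 => n Nn; have n0 : (0 < n)%N by exact: leq_trans Nn.
pose E (y : R) := `|y - q%:R^-1| < d.
have dq : d <= q%:R^-1 by rewrite !ge_min lexx !orbT.
have q2 : q%:R^-1 <= 2^-1 :> R by rewrite lef_pV2 ?posrE// ler_nat.
have E1 : ~~ E 1.
  rewrite /E -leNgt; apply: le_trans dq _; apply: le_trans (ler_norm _).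
  by move: (q%:R^-1) q2 => a; lra.
have E0 : ~~ E (1 - 1).
  by rewrite /E subrr sub0r normrN -leNgt (gtr0_norm q0).
have mA : \sum_(w : word n) (coord_near ord0 q%:R^-1 d (freq w))%:R * cw_weight bc w = 
  \sum_(l < n.+1) (E (l%:R / n%:R))%:R *
    (@letter_height R r bc n l * @fluctuation R r (n - l)%N (bc * (n - l)%:R / n%:R)).
  exact: (letter_mass bc n0 E1).
have mB : \sum_(w : word n) (coord_near ord0 (@crit_height R r.+1) d (freq w))%:R * cw_weight bc w = 
  \sum_(l < n.+1) (E (l%:R / n%:R))%:R *
    (@letter_height R r bc n l * @fluctuation R r l (bc * l%:R / n%:R)).
  rewrite -(letter_mass_reflect r_gt0 E n0) -(letter_mass bc n0 (E := fun y => E (1 - y)) E0).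
  apply: eq_bigr => w _; congr (_%:R * _); rewrite /coord_near /E.
  rewrite -normrN; congr (`|_| < _); rewrite /crit_height qE opprB.
  have Q1 : P + 1 != 0 by rewrite gt_eqF.
  by move: P Q1 => a a1; field.
rewrite /cw_mean mA mB ![_ / _ * _]mulrAC -mulrBl normrM normfV.
have Z0 := cw_partition_gt0 (p := r.+1) bc n.
rewrite (gtr0_norm Z0) ler_pdivrMr// !mulr_suml -sumrB.
apply: le_trans (ler_norm_sum _ _ _) _.
have mBZ : \sum_(w : word n) (coord_near ord0 (@crit_height R r.+1) d (freq w))%:R *
    cw_weight bc w <= @cw_partition R r.+1 bc n.
  rewrite /cw_partition; apply: ler_sum => w _; rewrite ler_piMl ?expR_ge0//.
  by rewrite lern1 leq_b1.
apply: le_trans (ler_wpM2l (ltW theta0) mBZ); rewrite mB mulr_sumr.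
apply: ler_sum => l _; case: (boolP (E _)) => El; last by rewrite !mul0r subrr normr0 mulr0.
rewrite !mul1r.
have distr (W x y a b : R) : W * x * a - W * y * b = W * (x * a - y * b) by ring.
rewrite distr normrM.
have bc0 := beta_c_gt0 (R := R) r1_gt1.
have h0 : 0 <= @letter_height R r bc n l.
  by rewrite !mulr_ge0 ?expR_ge0// exprn_ge0.
rewrite (ger0_norm h0) [theta * _]mulrCA; apply: ler_wpM2l => //.
have l_le : (l <= n)%N by rewrite -ltnS ltn_ord.
have Ed1 : `|l%:R / n%:R - q%:R^-1| < d1.
  by apply: lt_le_trans El _; rewrite !ge_min lexx orbT.
have [fA fB] := NP n l (ltnW Nn) l_le Ed1.
have pos m : 0 < @fluctuation R r m (bc * m%:R / n%:R).
  by apply: fluctuation_gt0; rewrite divr_ge0// mulr_ge0// ltW.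
have wB0 := weightB_gt0.
have lnA : ln wA = (P - 1) / 2 * ln (1 - bc / (q%:R * P)) by rewrite /= ln_powR q1E q2E.
have lnB : ln wB = (P - 1) / 2 * ln (1 - bc / q%:R) by rewrite /= ln_powR q2E.
have xl : `|ln (@fluctuation R r (n - l)%N (bc * (n - l)%:R / n%:R) * wB)| <= eps.
  by rewrite lnM ?posrE// lnB.
have yl : `|ln (@fluctuation R r l (bc * l%:R / n%:R) * wA)| <= eps.
  by rewrite lnM ?posrE// lnA.
apply: le_trans (ln_close_dist (mulr_gt0 (pos (n - l)%N) wB0) (mulr_gt0 (pos l) wA0) xl yl) _.
rewrite /eps [2 * _]mulrC divfK// lnK ?posrE; last by rewrite addr_gt0.
have aux (a b x : R) : b != 0 -> a / b * (x * b) = a * x by move=> b0; field.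
by rewrite [1 + _]addrC addrK aux// gt_eqF.
Qed.

End critical_masses.

(** * Limits of the probabilities of cylinders *)

Section limits.
Context {R : realType} {p : nat}.
Hypothesis p_gt1 : (1 < p)%N.
Local Notation q := p.+1.
Local Notation word n := {ffun 'I_n -> 'I_p.+1}.
Local Notation bc := (@beta_c R p.+1).
Implicit Types (b : R).

Lemma cw_mean_coord b n (i j : 'I_q) (E : R -> bool) :
  cw_mean b (fun w : word n => (E (freq w i))%:R) =
  cw_mean b (fun w : word n => (E (freq w j))%:R).
Proof.
rewrite -(cw_mean_relabel b (tperm i j) (fun w : word n => (E (freq w j))%:R)).
congr (cw_mean b _); apply/funext => w.
by rewrite /freq; have := @occ_relabel R p n (tperm i j) w i; rewrite tpermL => ->.
Qed.

Lemma subcritical_cylinder b m (v : word m) : 0 < b -> b < bc ->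
  fdist (@prob_gibbs R p n b) (initial_word ^~ m) v @[n --> \oo] -->
  (\prod_j barycentre (v j) : R).
Proof.
move=> b0 bbc; pose z (_ : unit) := @barycentre R p.
have z_min x : minimiser b x -> exists i, x = z i.
  by move=> mx; exists tt; exact: (subcritical_minimisers p_gt1 b0 bbc mx).
have h := @gibbs_cylinder_localise R p b b0 unit z z_min (fun _ _ => true) 1 ltr01 _ m v
  (fun=> simplex_barycentre).
apply/subr_cvg0; apply: cvg_trans (h _); last by case; case.
apply: near_eq_cvg; apply: nearW => n; rewrite (big_pred1 tt); last by case.
by rewrite cw_mean_cst mul1r.
Qed.

Lemma supercritical_cylinder b m (v : word m) : bc < b ->
  fdist (@prob_gibbs R p n b) (initial_word ^~ m) v @[n --> \oo] -->
  (q%:R^-1 * \sum_k \prod_j letter_weight k (b * s_ q b) (v j) : R).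
Proof.
move=> bbc; have b0 : 0 < b by apply: lt_trans bbc; exact: beta_c_gt0.
have [a /andP[a2 a1] [min_a all_min wE]] := supercritical_minimisers p_gt1 bbc.
(* One coordinate of each spike is above [1/2] and the others are below, so this test identifies the
   spike that is near. *)
pose E (i : 'I_q) (x : 'I_q -> R) := 2^-1 < x i.
pose d := (a - 2^-1) / 2.
have d0 : 0 < d by rewrite divr_gt0// subr_gt0.
have d20 : 0 < d ^+ 2 by rewrite exprn_gt0.
have pa : (1 - a) / p%:R <= 1 - a.
  by rewrite ler_pdivrMr ?ltr0n ?(ltnW p_gt1)// ler_peMr ?subr_ge0 ?ltW// ltr1n.
have E_loc i j x : sqdist x (spike j a) < d ^+ 2 -> E i x = (i == j).
  move=> /ltW xj; have := sqdist_coord i (ltW d0) xj; rewrite ler_norml /E /spike.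
  case: eqP => [_|_] /andP[h1 h2].
    by move: h1; rewrite /d; lra.
  apply/negbTE; rewrite -leNgt; move: h2 pa; move: (_ / p%:R) => c; rewrite /d; lra.
have tot := cw_prob_total b0 all_min d20 E_loc.
have h := gibbs_cylinder_localise b0 all_min d20 E_loc v (fun i => (min_a i).1).
pose M n := cw_mean b (fun w : word n => (E ord0 (freq w))%:R).
have ME n i : cw_mean b (fun w : word n => (E i (freq w))%:R) = M n.
  exact: (@cw_mean_coord b n i ord0 (fun y : R => 2^-1 < y)).
have Mlim : M n @[n --> \oo] --> (q%:R^-1 : R).
  rewrite -[X in _ --> X]mulr1; apply: cvg_trans (cvgM (cvg_cst (q%:R^-1 : R)) tot).
  apply: near_eq_cvg; apply: nearW => n; rewrite /= (eq_bigr (fun=> M n))//.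
  by rewrite sumr_const card_ord -[M n *+ _]mulr_natl mulKf// pnatr_eq0.
rewrite -[X in _ --> X]add0r.
apply: cvg_trans (cvgD h (cvgM Mlim (cvg_cst (_ : R)))); apply: near_eq_cvg; apply: nearW => n.
rewrite ?fctE /= (eq_bigr (fun i => M n * \prod_j letter_weight i (b * s_ q b) (v j))).
  by rewrite -mulr_sumr subrK.
by move=> i _; rewrite ME; congr (_ * _); apply: eq_bigr => j _; rewrite wE.
Qed.

End limits.

Lemma sum_option {R : realType} (I : finType) (F : option I -> R) :
  \sum_i F i = F None + \sum_i F (Some i).
Proof.
rewrite (bigD1 None)//= (reindex_omap Some id) => [|[]//]; congr (_ + _).
by apply: eq_bigl => i; rewrite eqxx.
Qed.

(** * Convergence at the critical temperature *)

Section critical_limit.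
Context {R : realType} {r : nat}.
Hypothesis r_gt0 : (0 < r)%N.
Local Notation q := r.+2.
Local Notation P := (@GRing.natmul R 1 r.+1).
Local Notation bc := (@beta_c R r.+2).
Local Notation word n := {ffun 'I_n -> 'I_r.+2}.
Local Notation wA := ((@weightA R r.+2)%:num : R).
Local Notation wB := ((@weightB R r.+2)%:num : R).
Local Notation ch := (@crit_height R r.+1).

Let r1_gt1 : (1 < r.+1)%N. Proof. by rewrite ltnS. Qed.
Let qE : q%:R = P + 1 :> R. Proof. by rewrite natr1. Qed.
Let bc_gt0 : 0 < bc. Proof. exact: (beta_c_gt0 r1_gt1). Qed.

(** The barycentre is tested on [ord0] alone, to match the windows of [critical_mass_ratio]. *)
Definition critical_region (d : R) (i : option 'I_q) (x : 'I_q -> R) : bool :=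
  if i is Some i then coord_near i ch d x else coord_near ord0 q%:R^-1 d x.

(** Half the smallest difference between the three values [q^-1], [ch] and [(1 - ch) / P] that
    coordinates take at the critical points. *)
Let sep : R := (P - 1) / (P * (P + 1)) / 2.

Let sep_gt0 : 0 < sep.
Proof.
have P1 : 1 < P by rewrite ltr1n ltnS.
by rewrite /sep divr_gt0// divr_gt0 ?subr_gt0// mulr_gt0// addr_gt0.
Qed.

Lemma critical_region_local d i j x : 0 < d <= sep ->
  sqdist x (critical_point j) < (d / 2) ^+ 2 -> critical_region d i x = (i == j).
Proof.
move=> /andP[d0 ds]; have d20 : 0 <= d / 2 by rewrite divr_ge0// ltW.
move=> /ltW xj; have close k := sqdist_coord k d20 xj.
have near_true k c : c = critical_point j k -> coord_near k c d x.
  by move=> ->; apply: le_lt_trans (close k) _; rewrite ltr_pdivrMr// ltr_pMr// ltr1n.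
have near_false k c : 2 * sep <= `|critical_point j k - c| -> ~~ coord_near k c d x.
  move=> h; rewrite -leNgt; have := ler_distD (x k) (critical_point j k) c.
  by move: (close k); rewrite [`|_ - x k|]distrC; lra.
have P0 : 0 < P by [].
have P1 : 1 < P by rewrite ltr1n ltnS.
have Q0 : 0 < P + 1 by rewrite addr_gt0.
have [P_neq0 Q_neq0] : P != 0 /\ P + 1 != 0 by rewrite !gt_eqF.
have s20 : 0 < 2 * sep by rewrite mulr_gt0// sep_gt0.
have h12 : 2 * sep <= `|q%:R^-1 - ch|.
  rewrite qE /crit_height distrC (_ : _ - _ = 2 * sep * P); last first.
    by rewrite /sep; field_atom P_neq0 Q_neq0.
  by rewrite (gtr0_norm (mulr_gt0 s20 P0)); apply: ler_peMr; exact: ltW.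
have h13 : 2 * sep <= `|(1 - ch) / P - q%:R^-1|.
  rewrite qE /crit_height distrC (_ : _ - _ = 2 * sep); last first.
    by rewrite /sep; field_atom P_neq0 Q_neq0.
  exact: ler_norm.
have h23 : 2 * sep <= `|(1 - ch) / P - ch|.
  rewrite /crit_height distrC (_ : _ - _ = 2 * sep * (P + 1)); last first.
    by rewrite /sep; field_atom P_neq0 Q_neq0.
  by rewrite (gtr0_norm (mulr_gt0 s20 Q0)); apply: ler_peMr; rewrite ?lerDr ltW.
have h21 : 2 * sep <= `|ch - q%:R^-1| by rewrite distrC.
case: i => [i|]; case: j close near_true near_false {xj} => [j|] _ near_true near_false /=.
- rewrite (inj_eq (@Some_inj _)); have [ij|ij] := eqVneq i j.
    by rewrite near_true//= /spike ij eqxx.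
  by apply/negbTE/near_false; rewrite /= /spike (negbTE ij).
- exact/negbTE/near_false.
- apply/negbTE/near_false; rewrite /= /spike; by case: ifP.
- exact: near_true.
Qed.

Let sep_loc k j x := @critical_region_local sep k j x (introT andP (conj sep_gt0 (lexx sep))).

Let s20 : 0 < (sep / 2) ^+ 2.
Proof. by rewrite exprn_gt0// divr_gt0// sep_gt0. Qed.

Let M d n i := cw_mean bc (fun w : word n => (critical_region d i (freq w))%:R).

(** [critical_mass_ratio] yields a window depending on the accuracy [theta]; this transfers its
    estimate to windows of fixed width. *)
Let region_cvg d i : 0 < d <= sep -> M d n i - M sep n i @[n --> \oo] --> (0 : R).
Proof.
move=> d0s; have /andP[d0 ds] := d0s.
have pointE j : critical_region d i (critical_point j) = (i == j).
  apply: critical_region_local => //.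
  rewrite /sqdist big1 => [|k _]; last by rewrite subrr expr0n.
  by rewrite exprn_gt0// divr_gt0.
have h := @cw_mean_localise R r.+1 bc bc_gt0 (option 'I_q) critical_point
  (critical_points r_gt0) (critical_region sep) ((sep / 2) ^+ 2) s20 sep_loc
  (fun x => (critical_region d i x)%:R) 1.
apply: cvg_trans (h _ _ _).
- apply: near_eq_cvg; apply: nearW => n; congr (_ - _).
  rewrite (bigD1 i)//= pointE eqxx mulr1 big1 ?addr0// => j /negbTE ji.
  by rewrite pointE eq_sym ji mulr0.
- by move=> x _; case: critical_region; rewrite ?normr1 ?normr0.
- by move=> j; case: critical_region; rewrite ?normr1 ?normr0.
- move=> eps eps0; exists ((d / 2) ^+ 2); first by rewrite exprn_gt0// divr_gt0.
  move=> j x _ xj; rewrite pointE (critical_region_local _ d0s xj) subrr normr0.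
  exact: ltW.
Qed.

Lemma critical_ratio_cvg :
  M sep n None * wB - M sep n (Some ord0) * wA @[n --> \oo] --> (0 : R).
Proof.
apply/cvgr0Pnorm_le => theta theta0; have t20 : 0 < theta / 2 by rewrite divr_gt0.
have [d /[dup] /andP[d0 ds] dd [N NP]] := critical_mass_ratio r_gt0 t20 sep_gt0.
have h : (M d n None - M sep n None) * wB -
    (M d n (Some ord0) - M sep n (Some ord0)) * wA @[n --> \oo] --> 0 * wB - 0 * wA.
  apply: cvgB; apply: cvgM; try exact: cvg_cst; exact: region_cvg.
rewrite !mul0r subrr in h.
have /cvgr0Pnorm_le/(_ _ t20)[N' _ N'P] := h.
exists (maxn N N') => // n /=; rewrite geq_max => /andP[nN nN'].
have aux (x y u w a c t : R) : `|x * a - y * c| <= t / 2 ->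
    `|(x - u) * a - (y - w) * c| <= t / 2 -> `|u * a - w * c| <= t.
  move=> h1 h2; have -> : u * a - w * c = (x * a - y * c) - ((x - u) * a - (y - w) * c) by ring.
  by apply: le_trans (ler_normB _ _) _; rewrite [leRHS]splitr lerD.
exact: aux (NP n nN) (N'P n nN').
Qed.

Lemma critical_masses_cvg :
  M sep n None @[n --> \oo] --> (wA / (wA + q%:R * wB) : R) /\
  forall i, M sep n (Some i) @[n --> \oo] --> (wB / (wA + q%:R * wB) : R).
Proof.
have wA0 := @weightA_gt0 R r r_gt0; have wB0 := @weightB_gt0 R r r_gt0.
set W := wA + _; have W0 : 0 < W by rewrite addr_gt0// mulr_gt0.
have tot := cw_prob_total bc_gt0 (critical_points r_gt0) s20 sep_loc.
have ME n i : M sep n (Some i) = M sep n (Some ord0).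
  exact: (@cw_mean_coord R r.+1 bc n i ord0 (fun y : R => `|y - ch| < sep)).
have {}tot : M sep n None + q%:R * M sep n (Some ord0) @[n --> \oo] --> (1 : R).
  apply: cvg_trans tot; apply: near_eq_cvg; apply: nearW => n.
  rewrite sum_option (eq_bigr (fun=> M sep n (Some ord0))); last by move=> i _; exact: ME.
  by rewrite sumr_const card_ord -[M sep n (Some ord0) *+ _]mulr_natl.
have ratio := critical_ratio_cvg.
(* The total mass and the ratio are a linear system for the two masses; these combinations solve it
   exactly, so that convergence of the masses need not be known beforehand. *)
have limA : ((M sep n None + q%:R * M sep n (Some ord0)) * wA +
    q%:R * (M sep n None * wB - M sep n (Some ord0) * wA)) / W
    @[n --> \oo] --> (1 * wA + q%:R * 0) / W.
  apply: cvgM; last exact: cvg_cst.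
  by apply: cvgD; apply: cvgM; try exact: cvg_cst; [exact: tot|exact: ratio].
have limB : ((M sep n None + q%:R * M sep n (Some ord0)) * wB -
    (M sep n None * wB - M sep n (Some ord0) * wA)) / W
    @[n --> \oo] --> (1 * wB - 0) / W.
  apply: cvgM; last exact: cvg_cst.
  by apply: cvgB; [apply: cvgM; [exact: tot|exact: cvg_cst]|exact: ratio].
rewrite mul1r mulr0 addr0 in limA; rewrite mul1r subr0 in limB.
have W_neq0 : wA + q%:R * wB != 0 by rewrite gt_eqF.
split=> [|i].
  apply: cvg_trans limA; apply: near_eq_cvg; apply: nearW => n.
  rewrite /W; move: (M _ _ _) (M _ _ _) wA wB q%:R W_neq0 => x y a c e h.
  by field.
apply: cvg_trans limB; apply: near_eq_cvg; apply: nearW => n.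
rewrite ME /W; move: (M _ _ _) (M _ _ _) wA wB q%:R W_neq0 => x y a c e h.
by field.
Qed.

Lemma critical_cylinder m (v : word m) :
  fdist (@prob_gibbs R r.+1 n bc) (initial_word ^~ m) v @[n --> \oo] -->
  ((wA + q%:R * wB)^-1 * (wA * \prod_j letter_weight ord0 0 (v j) +
     wB * \sum_k \prod_j letter_weight k (bc * s_ q bc) (v j)) : R).
Proof.
have [limA limB] := critical_masses_cvg.
have z_simplex i : simplex (@critical_point R r i).
  case: i => [i|]; last exact: simplex_barycentre.
  exact: (critical_spike_minimiser r1_gt1 i).1.
have h := gibbs_cylinder_localise bc_gt0 (critical_points r_gt0) s20 sep_loc v z_simplex.
have lim : \sum_i M sep n i * \prod_j critical_point i (v j) @[n --> \oo] -->
    (wA / (wA + q%:R * wB) * \prod_j critical_point None (v j) +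
     \sum_i wB / (wA + q%:R * wB) * \prod_j critical_point (Some i) (v j) : R).
  under eq_fun do rewrite sum_option.
  apply: cvgD; first by apply: cvgM; [exact: limA|exact: cvg_cst].
  apply: cvg_big => [|i _]; first exact: add_continuous.
  by apply: cvgM; [exact: limB|exact: cvg_cst].
set L := (X in _ --> X) in lim.
rewrite [X in _ --> X](_ : _ = 0 + L); last first.
  rewrite add0r /L mulrDr -mulr_sumr; move: (_^-1) => c.
  rewrite !mulrA ![c * _]mulrC; congr (_ * _ + _ * _).
    by apply: eq_bigr => j _; rewrite letter_weight0.
  by apply: eq_bigr => i _; apply: eq_bigr => j _; rewrite critical_spike_weight.
apply: cvg_trans (cvgD h lim); apply: near_eq_cvg; apply: nearW => n.
by rewrite !fctE subrK.
Qed.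

End critical_limit.

Section mixtures.
Context {R : realType} {p : nat} {d : measure_display} {T : measurableType d}.
Implicit Types (A : set T).

Lemma letter_sumE (m : 'I_p.+1 -> {measure set T -> \bar R}) A (a : 'I_p.+1 -> R) :
  (forall k, m k A = (a k)%:E) -> letter_sum m A = (\sum_k a k)%:E.
Proof.
move=> mA; transitivity (\sum_(k < p.+1) m (inord k) A)%E; first by [].
by rewrite -sumEFin; apply: eq_bigr => k _; rewrite inord_val mA.
Qed.

Lemma mscaleE (c : {nonneg R}) (m : {measure set T -> \bar R}) A (a : R) :
  m A = a%:E -> mscale c m A = (c%:num * a)%:E.
Proof. by move=> mA; rewrite /mscale /= mA EFinM. Qed.

Lemma measure_addE_fin (m1 m2 : {measure set T -> \bar R}) A (a1 a2 : R) :
  m1 A = a1%:E -> m2 A = a2%:E -> measure_add m1 m2 A = (a1 + a2)%:E.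
Proof. by move=> h1 h2; rewrite measure_addE h1 h2 EFinD. Qed.

End mixtures.

Section gibbs_measures.
Context {R : realType} {p : nat}.

Lemma dynamical_gibbs_total (k : 'I_p.+1) (b : R) :
  dynamical_gibbs (letter_potential k b) setT = 1%E.
Proof. exact: probability_setT. Qed.

Lemma dynamical_gibbs_word (k : 'I_p.+1) (b : R) n (w : {ffun 'I_n -> 'I_p.+1}) :
  dynamical_gibbs (letter_potential k b) [set x : Sigma R p | initial_word x n == w] =
  (\prod_i letter_weight k b (w i))%:E.
Proof.
rewrite -dynamical_gibbs_cylinder /fdist fineK//.
apply: unit_mass_fin_num; first exact: dynamical_gibbs_total.
exact: (@initial_word_finite_valued R p n (pred1 w)).
Qed.

End gibbs_measures.

Theorem theorem3 (R : realType) (p : nat) (hq : (2 < p.+1)%N)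
    (beta : R) (hbeta : 0 < beta) :
  let q := p.+1 in
  let mu_tilde (k : 'I_p.+1) (b : R) : probability (Sigma R p) R :=
    dynamical_gibbs (letter_potential k b) in
  let A : {nonneg R} := weightA q in
  let B : {nonneg R} := weightB q in
  let mu_ (n : nat) : {measure set (Sigma R p) -> \bar R} :=
    prob_gibbs n beta in
  [/\ beta < beta_c q ->
        weak_cvg mu_ (product_measure rho),
      beta_c q < beta ->
        weak_cvg mu_
          (mscale (q%:R^-1)%:nng
             (letter_sum (fun k => mu_tilde k (beta * s_ q beta)))) &
      beta = beta_c q ->
        weak_cvg mu_
          (mscale ((A%:num + q%:R * B%:num)^-1)%:nng
             (measure_add
                (mscale A (mu_tilde ord0 0))
                (mscale B
                   (letter_sum
                      (fun k => mu_tilde k (beta_c q * s_ q (beta_c q)))))))].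
Proof.
have p1 : (1 < p)%N by [].
split=> [lt_c|gt_c|eq_c].
- apply: weak_cvg_cylinder => [n||m w]; [exact: prob_gibbs_total|exact: probability_setT|].
  rewrite fdist_product_rho (_ : _ ^- m = \prod_(i < m) barycentre (w i)).
    exact: subcritical_cylinder.
  by rewrite prodr_const card_ord exprVn.
- apply: weak_cvg_cylinder => [n||m w]; first exact: prob_gibbs_total.
    apply: etrans (mscaleE _ (letter_sumE (fun k => dynamical_gibbs_total k _))) _.
    by rewrite sumr_const card_ord/= mulVf// pnatr_eq0.
  rewrite [X in _ --> X](_ : _ = p.+1%:R^-1 *
      \sum_k \prod_j letter_weight k (beta * s_ p.+1 beta) (w j)).
    exact: supercritical_cylinder.
  apply: (congr1 fine (x := mscale _ _ _) (y := (_ * _)%:E)); apply: mscaleE.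
  by apply: letter_sumE => k; exact: dynamical_gibbs_word.
(* One more successor is exposed, since removing one letter must leave the nonempty alphabet
   ['I_r.+1]. *)
- case: p hq p1 eq_c => // r _ r0 ->.
  have A0 := @weightA_gt0 R r r0; have B0 := @weightB_gt0 R r r0.
  apply: weak_cvg_cylinder => [n||m w]; first exact: prob_gibbs_total.
    apply: etrans (mscaleE _ (measure_addE_fin (mscaleE _ (dynamical_gibbs_total ord0 0))
      (mscaleE _ (letter_sumE (fun k => dynamical_gibbs_total k _))))) _.
    rewrite sumr_const card_ord mulr1 [_ * r.+2%:R]mulrC /= mulVf//.
    by rewrite gt_eqF// addr_gt0// mulr_gt0.
  rewrite [X in _ --> X](_ : _ = ((weightA r.+2)%:num + r.+2%:R * (weightB r.+2)%:num)^-1 *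
      ((weightA r.+2)%:num * (\prod_j letter_weight ord0 0 (w j)) +
       (weightB r.+2)%:num * \sum_k \prod_j
         letter_weight k (beta_c r.+2 * s_ r.+2 (beta_c r.+2)) (w j))).
    exact: (@critical_cylinder R r r0 m w).
  apply: (congr1 fine (x := mscale _ _ _) (y := (_ * _)%:E)); apply: mscaleE.
  refine (measure_addE_fin (mscaleE _ (dynamical_gibbs_word _ _ _))
    (mscaleE _ (letter_sumE (fun k => dynamical_gibbs_word _ _ _)))).
Qed.
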